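(* Consider $a=2$ groups and assume $n_i/N\to\kappa_i\in(0,1]$, $i=1,2$, as $\min(n_1,n_2)\to\infty$, where $N=n_1+n_2$. Let $$\boldsymbol T=\sqrt N\left(\begin{pmatrix}\widehat V_{111}\\ \widehat V_{122}\\ \vdots\\ \widehat V_{1dd}\\ \widehat{\boldsymbol r}_1\end{pmatrix}-\begin{pmatrix}\widehat V_{211}\\ \widehat V_{222}\\ \vdots\\ \widehat V_{2dd}\\ \widehat{\boldsymbol r}_2\end{pmatrix}\right)\in\mathbb R^p .$$ Then, under the null hypothesis $\mathcal H_0:\boldsymbol V_1=\boldsymbol V_2$, $$\boldsymbol T\xrightarrow{\ \mathcal D\ }\mathcal N_p(\boldsymbol 0_p,\boldsymbol\Gamma),\qquad \boldsymbol\Gamma=\sum_{i=1}^2\kappa_i^{-1}\begin{pmatrix}\boldsymbol A\\ \boldsymbol M(\boldsymbol v_i,\boldsymbol r_i)\end{pmatrix}\boldsymbol\Sigma_i\begin{pmatrix}\boldsymbol A\\ \boldsymbol M(\boldsymbol v_i,\boldsymbol r_i)\end{pmatrix}^\top .$$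
   Context: Model: $d\ge2$; $\boldsymbol X_{ik}=\boldsymbol\mu_i+\boldsymbol\epsilon_{ik}$, $i=1,2$, $k=1,\dots,n_i$, are independent $d$-dimensional random vectors. Within each group $i$ the residuals $\boldsymbol\epsilon_{i1},\dots,\boldsymbol\epsilon_{in_i}$ are i.i.d. with $\mathbb E(\boldsymbol\epsilon_{i1})=\boldsymbol 0_d$ and $\mathbb E(\|\boldsymbol\epsilon_{i1}\|^4)<\infty$; across groups they are only independent (distributions may differ). $\operatorname{Cov}(\boldsymbol\epsilon_{i1})=\boldsymbol V_i=(V_{ijk})_{j,k\le d}$ has positive diagonal $V_{i11},\dots,V_{idd}>0$. $\boldsymbol R_i$ is the correlation matrix of group $i$. Vectorizations: $p=d(d+1)/2$, $p_u=d(d-1)/2$. For a $d\times d$ matrix $\boldsymbol B=(B_{jk})$, $\operatorname{vech}(\boldsymbol B)=(B_{11},B_{12},\dots,B_{1d},B_{22},\dots,B_{2d},\dots,B_{dd})^\top\in\mathbb R^p$ and $\operatorname{vech}^-(\boldsymbol B)=(B_{12},\dots,B_{1d},B_{23},\dots,B_{2d},\dots,B_{(d-1)d})^\top\in\mathbb R^{p_u}$. $\boldsymbol v_i=\operatorname{vech}(\boldsymbol V_i)$, $\boldsymbol r_i=\operatorname{vech}^-(\boldsymbol R_i)$, $\boldsymbol\Sigma_i=\operatorname{Cov}(\operatorname{vech}(\boldsymbol\epsilon_{i1}\boldsymbol\epsilon_{i1}^\top))$. Estimators: $\widehat{\boldsymbol V}_i=(\widehat V_{ijk})_{j,k\le d}=\frac1{n_i-1}\sum_{k=1}^{n_i}(\boldsymbol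 X_{ik}-\overline{\boldsymbol X}_i)(\boldsymbol X_{ik}-\overline{\boldsymbol X}_i)^\top$ is the empirical covariance matrix; $\widehat{\boldsymbol R}_i=\widehat{\boldsymbol V}_{i,0}^{-1/2}\widehat{\boldsymbol V}_i\widehat{\boldsymbol V}_{i,0}^{-1/2}$ the empirical correlation matrix, $\widehat{\boldsymbol V}_{i,0}$ being the diagonal matrix with the diagonal of $\widehat{\boldsymbol V}_i$ (defined arbitrarily on the asymptotically negligible event that a diagonal entry vanishes); $\widehat{\boldsymbol r}_i=\operatorname{vech}^-(\widehat{\boldsymbol R}_i)$. Auxiliary matrices: $\boldsymbol e_{k,p}$ is the $k$-th standard basis vector of $\mathbb R^p$. $\boldsymbol a=(a_1,\dots,a_d)$ is the row vector with $a_k=1+\sum_{j=1}^{k-1}(d+1-j)$, and $\boldsymbol A=\sum_{\ell=1}^d\boldsymbol e_{\ell,d}\boldsymbol e_{a_\ell,p}^\top\in\mathbb R^{d\times p}$ (so that $\boldsymbol A\operatorname{vech}(\boldsymbol B)$ is the diagonal of $\boldsymbol B$). $\boldsymbol b\in\mathbb R^{p_u}$ contains the numbers $1,\dots,p$ in ascending order without the elements of $\boldsymbol a$. $\boldsymbol H=\boldsymbol 1_d\boldsymbol a$ is the $d\times d$ matrix all of whose rows equal $\boldsymbol a$; $\boldsymbol h_1=\operatorname{vech}^-(\boldsymbol H)$, $\boldsymbol h_2=\operatorname{vech}^-(\boldsymbol H^\top)$, with $\ell$-th components $h_{1,\ell},h_{2,\ell}$. Then $\boldsymbol M_1=\sum_{\ell=1}^{p_u}\boldsymbol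 e_{\ell,p_u}(\boldsymbol e_{h_{1,\ell},p}+\boldsymbol e_{h_{2,\ell},p})^\top$, $\boldsymbol L_p^u=\sum_{\ell=1}^{p_u}\boldsymbol e_{\ell,p_u}\boldsymbol e_{b_\ell,p}^\top$, and $$\boldsymbol M(\boldsymbol v_i,\boldsymbol r_i)=\left[\boldsymbol L_p^u-\tfrac12\operatorname{diag}(\boldsymbol r_i)\boldsymbol M_1\right]\operatorname{diag}\Big(\operatorname{vech}\big((V_{i11},\dots,V_{idd})^\top(V_{i11},\dots,V_{idd})\big)\Big)^{-1/2},$$ where $\operatorname{diag}(\boldsymbol x)$ is the diagonal matrix with diagonal $\boldsymbol x$. $\xrightarrow{\mathcal D}$ denotes convergence in distribution. *)

(* Defs.v *)
From HB Require Import structures.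
From mathcomp Require Import all_boot all_order all_algebra.
From mathcomp Require Import all_classical all_reals all_analysis.

Set Implicit Arguments.
Unset Strict Implicit.
Unset Printing Implicit Defensive.

Import Order.TTheory GRing.Theory Num.Theory.
Import numFieldNormedType.Exports.

Local Open Scope classical_set_scope.
Local Open Scope ring_scope.

Definition pdim (d : nat) : nat := (d * d.+1)./2.
Definition pudim (d : nat) : nat := (d * d.-1)./2.

Lemma pdim_split (d : nat) : (d + pudim d)%N = pdim d.
Proof. by rewrite /pudim /pdim -bin2 (mulnC d) -(bin2 d.+1) binS bin1 addnC. Qed.

(* The lists run row by row through the upper triangle and have lengths
   [pdim d] and [pudim d] (see [size_vech_seq], [size_vechu_seq]), so the
   default value of [nth] below is never used. The entries live in an
   arbitrary [nmodType] so that index matrices over [nat] can be vectorized. *)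
Definition vech_seq (V : Type) (d : nat) (B : 'M[V]_d) : seq V :=
  [seq B j k | j : 'I_d <- enum 'I_d,
         k : 'I_d <- [seq k : 'I_d <- enum 'I_d | (j <= k)%N]].
Definition vechu_seq (V : Type) (d : nat) (B : 'M[V]_d) : seq V :=
  [seq B j k | j : 'I_d <- enum 'I_d,
         k : 'I_d <- [seq k : 'I_d <- enum 'I_d | (j < k)%N]].

Definition vech (V : nmodType) (d : nat) (B : 'M[V]_d) : 'cV[V]_(pdim d) :=
  \col_l (vech_seq B)`_l.
Definition vechu (V : nmodType) (d : nat) (B : 'M[V]_d) : 'cV[V]_(pudim d) :=
  \col_l (vechu_seq B)`_l.

Lemma count_ord_geq (d i : nat) :
  count (fun k : 'I_d => (i <= k)%N) (enum 'I_d) = (d - i)%N.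
Proof.
rewrite -(count_map (@nat_of_ord d) (leq i)) val_enum_ord.
elim: d => [|d IH] //.
rewrite -addn1 iotaD count_cat IH add0n /= addn0 addn1.
case: (leqP i d) => h; first by rewrite addn1 subSn.
by rewrite addn0 (eqP (ltnW h)) (eqP h).
Qed.

Lemma size_vech_seq (V : Type) (d : nat) (B : 'M[V]_d) :
  size (vech_seq B) = pdim d.
Proof.
rewrite size_allpairs_dep (eq_map (fun j : 'I_d => size_filter _ _)).
rewrite (eq_map (fun j : 'I_d => count_ord_geq d j)) sumnE big_map big_enum /=.
rewrite /pdim mulnC -bin2 -bin2_sum big_mkord big_ord_recl add0n.
rewrite (reindex_inj rev_ord_inj) /=; apply: eq_bigr => j _.
by rewrite subKn // ltn_ord.
Qed.

Lemma size_vechu_seq (V : Type) (d : nat) (B : 'M[V]_d) :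
  size (vechu_seq B) = pudim d.
Proof.
rewrite size_allpairs_dep (eq_map (fun j : 'I_d => size_filter _ _)).
rewrite (eq_map (fun j : 'I_d => count_ord_geq d j.+1)) sumnE big_map big_enum.
rewrite /= /pudim -bin2 -bin2_sum big_mkord.
by rewrite (reindex_inj rev_ord_inj) /=; apply: eq_bigr => j _;
   rewrite [LHS](congr1 val (rev_ordK j)).
Qed.

(* Positions are 1-based, as in R^p with basis e_1, ..., e_p. *)
Definition evec (R : pzSemiRingType) (k p : nat) : 'cV[R]_p :=
  \col_(l < p) (l.+1 == k)%:R.

(* a_k, with k 1-based *)
Definition apos (d k : nat) : nat := (1 + \sum_(1 <= j < k) (d.+1 - j))%N.

Definition bseq (d : nat) : seq nat :=
  [seq m <- iota 1 (pdim d) | m \notin [seq apos d k | k <- iota 1 d]].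

Definition Amx (R : pzSemiRingType) (d : nat) : 'M[R]_(d, pdim d) :=
  \sum_(l < d) evec R l.+1 d *m (evec R (apos d l.+1) (pdim d))^T.

Definition Hmx (d : nat) : 'M[nat]_d := \matrix_(j, k) apos d k.+1.

Definition M1mx (R : pzSemiRingType) (d : nat) : 'M[R]_(pudim d, pdim d) :=
  \sum_(l < pudim d) evec R l.+1 (pudim d) *m
    (evec R (vechu (Hmx d) l 0) (pdim d) +
     evec R (vechu (Hmx d)^T l 0) (pdim d))^T.

Definition Lmx (R : pzSemiRingType) (d : nat) : 'M[R]_(pudim d, pdim d) :=
  \sum_(l < pudim d) evec R l.+1 (pudim d) *m
    (evec R (nth 0%N (bseq d) l) (pdim d))^T.

Definition dg (V : Type) (d : nat) (B : 'M[V]_d) : 'cV[V]_d := \col_j B j j.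

(* diag(x)^{-1/2} *)
Definition diag_invsqrt (R : rcfType) (n : nat) (x : 'cV[R]_n) : 'M[R]_n :=
  diag_mx (\row_j (Num.sqrt (x j 0))^-1).

Definition Mmx (R : rcfType) (d : nat) (V : 'M[R]_d) (r : 'cV[R]_(pudim d)) :
    'M[R]_(pudim d, pdim d) :=
  (Lmx R d - 2^-1 *: (diag_mx r^T *m M1mx R d)) *m
  diag_invsqrt (vech (dg V *m (dg V)^T)).

(* V_0^{-1/2} V V_0^{-1/2}, with V_0 the diagonal part of V *)
Definition cor_mx (R : rcfType) (d : nat) (V : 'M[R]_d) : 'M[R]_d :=
  diag_invsqrt (dg V) *m V *m diag_invsqrt (dg V).

Definition sample_mean (R : rcfType) (d n : nat) (x : nat -> 'cV[R]_d) :
    'cV[R]_d :=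
  n%:R^-1 *: \sum_(k < n) x k.

Definition sample_cov (R : rcfType) (d n : nat) (x : nat -> 'cV[R]_d) :
    'M[R]_d :=
  (n%:R - 1)^-1 *:
    \sum_(k < n) (x k - sample_mean n x) *m (x k - sample_mean n x)^T.

(* The value [C0] is used when some empirical variance vanishes. *)
Definition sample_cor (R : rcfType) (d n : nat) (C0 : 'M[R]_d)
    (x : nat -> 'cV[R]_d) : 'M[R]_d :=
  if [forall j, sample_cov n x j j != 0] then cor_mx (sample_cov n x) else C0.

(* The dimension is written [d + pudim d], which equals [pdim d]
   (see [pdim_split]). *)
Definition var_cor_stat (R : rcfType) (d n : nat) (C0 : 'M[R]_d)
    (x : nat -> 'cV[R]_d) : 'cV[R]_(d + pudim d) :=
  col_mx (dg (sample_cov n x)) (vechu (sample_cor n C0 x)).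

Definition mxborel (R : realType) (m n : nat) :=
  g_sigma_algebraType (@open 'M[R]_(m, n)).

Definition enorm (R : rcfType) (n : nat) (x : 'cV[R]_n) : R :=
  Num.sqrt (\sum_j x j 0 ^+ 2).

Definition cov_mx (dsp : measure_display) (Om : measurableType dsp)
    (R : realType) (P : probability Om R) (n : nat) (Y : Om -> 'cV[R]_n) :
    'M[R]_n :=
  \matrix_(j, k) fine (covariance P (fun w => Y w j 0) (fun w => Y w k 0)).

Definition mutually_independent (dsp dsp' : measure_display)
    (Om : measurableType dsp) (E : measurableType dsp') (R : realType)
    (P : probability Om R) (I : choiceType) (X : I -> Om -> E) : Prop :=
  forall (s : seq I) (B : I -> set E), uniq s ->
    (forall i, measurable (B i)) ->
    P (\bigcap_(i in [set` s]) (X i @^-1` B i)) =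
    (\prod_(i <- s) P (X i @^-1` B i))%E.

Definition identically_distributed (dsp dsp' : measure_display)
    (Om : measurableType dsp) (E : measurableType dsp') (R : realType)
    (P : probability Om R) (X Y : Om -> E) : Prop :=
  forall B : set E, measurable B -> P (X @^-1` B) = P (Y @^-1` B).

(* N(m, v) for v >= 0. The library's [normal_prob] takes the standard
   deviation as argument and is not the Dirac measure when it is 0. *)
Definition normal1 (R : realType) (m v : R) (B : set R) : \bar R :=
  if 0 < v then normal_prob m (Num.sqrt v) B else \d_m B.

(* mu = N_p(m, G), where G may be singular: every linear form t^T x has the
   law N(t^T m, t^T G t). *)
Definition is_mvnormal (R : realType) (p : nat)
    (mu : probability (mxborel R p 1) R) (m : 'cV[R]_p) (G : 'M[R]_p) : Prop :=
  [/\ G^T = G,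
      (forall t : 'cV[R]_p, 0 <= (t^T *m G *m t) 0 0) &
      forall (t : 'cV[R]_p) (B : set R), measurable B ->
        mu [set x : 'cV[R]_p | B ((t^T *m x) 0 0)] =
        normal1 ((t^T *m m) 0 0) ((t^T *m G *m t) 0 0) B].

Definition cvg_in_distribution (dsp : measure_display)
    (Om : measurableType dsp) (R : realType) (P : probability Om R) (p : nat)
    (Y : nat -> Om -> 'cV[R]_p) (mu : probability (mxborel R p 1) R) : Prop :=
  forall f : 'cV[R]_p -> R, continuous f -> (exists M, forall x, `|f x| <= M) ->
    'E_P[fun w => f (Y m w)]%E @[m --> \oo] --> 'E_mu[f]%E.

(* Main.v *)
(** Fix a test function [g] and let an independent vector [Z] act on it by
    averaging, [x |-> E g (x + Z)]. Averaging operators commute and do not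
    increase the sup distance of bounded Lipschitz functions, so that replacing
    the [n] summands of a normalized sum one by one by Gaussian vectors with the
    same covariance costs [n] times the error of a single replacement (Lindeberg,
    in the form of Trotter), and that error is [o(1/n)] when [g] has a Taylor
    expansion of order 2. Gaussian vectors are represented as [\sum_b z_b b]
    with independent standard normal [z_b] and covariance [\sum_b b b^T]; the sum
    of [n] independent copies scaled by [n^-1/2] has the same law.

    Bounded continuous functions are reached from such [g] by a partition of
    unity made of products of cubic B-splines.

    The statistic is a smooth function of the two empirical covariance matrices.
    On the event where the centred sums of the residuals and of their products
    are at most [K sqrt n], a first order expansion shows that it differs from
    the normalized sum of the vectors [J (vech (e e^T) - vech V)] by [O(n^-1/2)];
    the complement of the event is controlled by second moments. *)

Require Import Defs.
From HB Require Import structures.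
From mathcomp Require Import all_boot all_order all_algebra.
From mathcomp Require Import all_classical all_reals all_analysis.
From mathcomp Require Import measurable_realfun ring lra.

Set Implicit Arguments.
Unset Strict Implicit.
Unset Printing Implicit Defensive.

Import Order.TTheory GRing.Theory Num.Theory.
Import numFieldNormedType.Exports.

Local Open Scope classical_set_scope.
Local Open Scope ring_scope.

(** * Borel sets of matrices and real integrals *)

(** The summands are quadratic in the residuals, so that four moments of the residuals give only two
    moments of the summands. This fixes the shape of the remainder of a test function, $\min(r^2,
    r^3)$: the cube makes the error of one replacement $o(1/n)$, and the square keeps it integrable.
    Piecewise cubic splines have such expansions, and the class is stable under products, which is
    all that a partition of unity needs.

    The two samples form a single sum with weights $\sqrt N/n_1$ and $-\sqrt N/n_2$. As averaging
    operators commute, the replacements in the two samples do not interfere. Under the null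
    hypothesis the two statistics have the same centre, which cancels in the difference; what is
    left are the linear parts and an error of order $\sqrt N/n_i$.

    The limit covariance may be singular. A Gaussian law is therefore built from a list of vectors
    instead of a density, and any positive semidefinite matrix is the covariance of such a list. *)

Lemma continuous_measurable_mxborel (R : realType) m n (f : 'M[R]_(m, n) -> R) :
  continuous f -> measurable_fun [set: mxborel R m n] f.
Proof.
move=> /continuousP cf; apply: (measurability _ (RGenOpens.measurableE R)).
move=> _ [_ [a [b ->] <-]]; rewrite setTI; apply: sub_sigma_algebra.
exact/cf/interval_open.
Qed.

Lemma measurable_coord d (T : measurableType d) (R : realType) m n
    (Y : T -> mxborel R m n) i j :
  measurable_fun [set: T] Y -> measurable_fun [set: T] (fun w => Y w i j).
Proof.
move=> mY; apply: (measurableT_comp (f := fun A : mxborel R m n => A i j)) => //.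
apply: continuous_measurable_mxborel; exact: coord_continuous.
Qed.

Lemma le_mx_norm_coord (R : realType) m n (A : 'M[R]_(m, n)) i j :
  `|A i j| <= `|A|.
Proof.
rewrite [leRHS]/Num.Def.normr /= mx_normrE; apply/bigmax_geP; right => /=.
by exists (i, j).
Qed.

Lemma mx_norm_ltP (R : realType) m n (A : 'M[R]_(m, n)) e : 0 < e ->
  (forall i j, `|A i j| < e) -> `|A| < e.
Proof.
move=> e0 Ae; rewrite [ltLHS]/Num.Def.normr /= mx_normrE.
by apply/bigmax_ltP; split => // -[i j] _ /=; exact: Ae.
Qed.

(** The sigma-algebra is generated by the open sets, not by the coordinates. Since balls of the
    maximum norm are boxes, an open set is the countable union of the boxes with rational centre and
    radius [k.+1%:R^-1] that it contains. *)
Lemma measurable_mxborelP d (T : measurableType d) (R : realType) m n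
    (Y : T -> 'M[R]_(m, n)) :
  (forall i j, measurable_fun [set: T] (fun w => Y w i j)) ->
  measurable_fun [set: T] (Y : T -> mxborel R m n).
Proof.
move=> mY; apply: (@measurability _ _ T (mxborel R m n) setT Y open) => //.
move=> _ [U oU <-]; rewrite setTI.
pose box (q : 'M[rat]_(m, n)) (e : R) : set 'M[R]_(m, n) :=
  [set A | forall i j, `|A i j - ratr (q i j)| < e].
pose F (qk : 'M[rat]_(m, n) * nat) : set T :=
  if `[< box qk.1 qk.2.+1%:R^-1 `<=` U >]
  then Y @^-1` box qk.1 qk.2.+1%:R^-1 else set0.
have -> : Y @^-1` U = \bigcup_qk F qk.
  apply/seteqP; split=> [w Uw|w [[q k] _]]; last first.
    by rewrite /F; case: asboolP => //= + Yw; exact.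
  have [e /= e0 eU] : exists2 e : R, 0 < e & ball (Y w) e `<=` U.
    by apply/nbhs_ballP; exact: open_nbhs_nbhs.
  (* Half of [e], because a box that contains [Y w] extends up to twice its radius away from
     [Y w]. *)
  have [k ke] : exists k : nat, k.+1%:R^-1 < e / 2.
    have [k _ /(_ k (leqnn _)) /= ?] := near_infty_natSinv_lt (PosNum (divr_gt0 e0 (ltr0Sn R 1))).
    by exists k.
  have /choice[q /= qP] ij : exists q : rat,
      `|Y w ij.1 ij.2 - ratr q| < k.+1%:R^-1.
    have : Y w ij.1 ij.2 - k.+1%:R^-1 < Y w ij.1 ij.2 + k.+1%:R^-1.
      by rewrite ltrBlDr -addrA ltrDl addr_gt0 ?invr_gt0.
    move=> /rat_in_itvoo[q]; rewrite in_itv /= => /andP[q1 q2].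
    by exists q; rewrite ltr_distlC; apply/andP; split; rewrite ?ltrBlDr // -?ltrBlDr.
  exists (\matrix_(i, j) q (i, j), k) => //.
  rewrite /F; case: asboolP => [_ i j /=|]; first by rewrite mxE; exact: (qP (i, j)).
  case=> A /= Ab; apply: eU; rewrite -ball_normE /=.
  apply: mx_norm_ltP => // i j; rewrite !mxE.
  have := Ab i j; have := qP (i, j); rewrite /= !mxE.
  rewrite (distrC (A i j)) => h1 h2.
  rewrite (le_lt_trans (ler_distD (ratr (q (i, j))) _ _))//.
  by rewrite [ltRHS]splitr ltrD ?(lt_trans _ ke).
apply: countable_bigcupT_measurable => // -[q k]; rewrite /F /=.
case: asboolP => // _.
have -> : Y @^-1` box q k.+1%:R^-1 = \bigcap_ij
    [set w | `|Y w ij.1 ij.2 - ratr (q ij.1 ij.2)| < k.+1%:R^-1].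
  by apply/seteqP; split => [w Yw ij _|w Yw i j] /=; [exact: Yw|exact: (Yw (i, j))].
apply: fin_bigcap_measurable => // -[i j] _ /=.
have mZ : measurable_fun setT (fun w => `|Y w i j - ratr (q i j)|).
  by apply: measurableT_comp => //; apply: measurable_funB.
have := mZ measurableT `]-oo, k.+1%:R^-1[%classic (measurable_itv _).
by rewrite setTI; congr (measurable _); apply/seteqP; split => w /=; rewrite in_itv.
Qed.

Section Integration.
Variable R : realType.

Lemma integrable_bounded d (T : measurableType d) (mu : probability T R)
    (f : T -> R) (M : R) :
  measurable_fun [set: T] f -> (forall x, `|f x| <= M) ->
  mu.-integrable [set: T] (EFin \o f).
Proof.
move=> mf fM; apply: measurable_bounded_integrable => //.
  by rewrite [X in (X < _)%E]probability_setT ltry.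
by exists M; split; [exact: num_real|move=> x Mx y _ /=; exact: le_trans (ltW Mx)].
Qed.

Lemma Rintegral_prob_cst d (T : measurableType d) (mu : probability T R) (c : R) :
  \int[mu]_w c = c.
Proof. by rewrite Rintegral_cst// [X in fine X](@probability_setT _ _ _ mu) mulr1. Qed.

Lemma Rintegral_bounded d (T : measurableType d) (mu : probability T R)
    (f : T -> R) (M : R) :
  measurable_fun [set: T] f -> (forall x, `|f x| <= M) ->
  `|\int[mu]_w f w| <= M.
Proof.
move=> mf fM; have fi := integrable_bounded mu mf fM.
apply: (le_trans (le_normr_Rintegral _ _)) => //.
rewrite -[leRHS](Rintegral_prob_cst mu); apply: le_Rintegral => //.
  apply: (@integrable_bounded _ _ _ _ M) => [|x]; first exact: measurableT_comp.
  by rewrite normr_id.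
exact: finite_measure_integrable_cst.
Qed.

Lemma EFin_Rintegral d (T : measurableType d) (mu : {measure set T -> \bar R})
    (f : T -> R) :
  mu.-integrable [set: T] (EFin \o f) ->
  ((\int[mu]_w f w)%:E = \int[mu]_w (f w)%:E)%E.
Proof. by move=> fi; rewrite fineK//; exact: integrable_fin_num. Qed.

Section IntegrableR.
Context d (T : measurableType d) (mu : {measure set T -> \bar R}).
Implicit Types f g : T -> R.

Definition integrableR f := mu.-integrable [set: T] (EFin \o f).

Lemma integrableRD f g : integrableR f -> integrableR g ->
  integrableR (fun w => f w + g w).
Proof. by move=> fi gi; exact: (integrableD measurableT fi gi). Qed.

Lemma integrableRB f g : integrableR f -> integrableR g ->
  integrableR (fun w => f w - g w).
Proof. by move=> fi gi; exact: (integrableB measurableT fi gi). Qed.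

Lemma integrableRZ c f : integrableR f -> integrableR (fun w => c * f w).
Proof. by move=> fi; exact: (integrableZl measurableT c fi). Qed.

Lemma integrableR_le f g : measurable_fun [set: T] f ->
  (forall w, `|f w| <= g w) -> integrableR g -> integrableR f.
Proof.
move=> mf fg; apply: le_integrable => //; first exact/measurable_EFinP.
by move=> w _ /=; rewrite lee_fin (le_trans (fg w)) ?ler_norm.
Qed.

Lemma integrableR_norm f : integrableR f -> integrableR (fun w => `|f w|).
Proof. by move=> /integrable_norm. Qed.

Lemma integrableR_sum I (s : seq I) (F : I -> T -> R) :
  (forall i, integrableR (F i)) ->
  integrableR (fun w => \sum_(i <- s) F i w).
Proof.
move=> Fi; elim: s => [|i s IHs].
  by under eq_fun do rewrite big_nil; exact: integrable0.
by under eq_fun do rewrite big_cons; exact: integrableRD.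
Qed.

Lemma Rintegral_sum I (s : seq I) (F : I -> T -> R) :
  (forall i, integrableR (F i)) ->
  \int[mu]_w (\sum_(i <- s) F i w) = \sum_(i <- s) \int[mu]_w F i w.
Proof.
move=> Fi; elim: s => [|i s IHs].
  by under eq_Rintegral do rewrite big_nil; rewrite big_nil /Rintegral integral0.
under eq_Rintegral do rewrite big_cons; rewrite big_cons -IHs RintegralD//; first exact: Fi.
exact: (integrableR_sum s Fi).
Qed.

End IntegrableR.

Lemma integrableR_cst d (T : measurableType d) (mu : probability T R) (c : R) :
  integrableR mu (fun=> c).
Proof. exact: finite_measure_integrable_cst. Qed.

Section FubiniR.
Context d1 d2 (T1 : measurableType d1) (T2 : measurableType d2).
Variables (m1 : probability T1 R) (m2 : probability T2 R).
Variables (f : T1 * T2 -> R) (M : R).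
Hypotheses (mf : measurable_fun [set: T1 * T2] f) (fM : forall z, `|f z| <= M).

Lemma measurable_Rintegral_section :
  measurable_fun [set: T1] (fun x => \int[m2]_y f (x, y)).
Proof.
apply/measurable_EFinP; rewrite (_ : _ \o _ = fubini_F m2 (EFin \o f)).
  apply: measurable_fubini_F; exact: integrable_bounded fM.
apply/funext => x /=; rewrite EFin_Rintegral//.
apply: (@integrable_bounded _ _ _ _ M) => //.
exact: (measurableT_comp mf).
Qed.

Lemma Rintegral_product :
  \int[(m1 \x m2)%E]_z f z = \int[m1]_x \int[m2]_y f (x, y).
Proof.
have fi : (m1 \x m2)%E.-integrable setT (EFin \o f) by exact: integrable_bounded fM.
rewrite /Rintegral -(integral12_prod_meas1 fi) /fubini_F; congr fine.
apply: eq_integral => x _; rewrite -EFin_Rintegral//.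
by apply: (@integrable_bounded _ _ _ _ M) => //; exact: (measurableT_comp mf).
Qed.

End FubiniR.

Lemma Rintegral_exchange d1 d2 (T1 : measurableType d1) (T2 : measurableType d2)
    (m1 : probability T1 R) (m2 : probability T2 R) (f : T1 * T2 -> R) (M : R) :
  measurable_fun [set: T1 * T2] f -> (forall z, `|f z| <= M) ->
  \int[m1]_x \int[m2]_y f (x, y) = \int[m2]_y \int[m1]_x f (x, y).
Proof.
move=> mf fM.
have fi : (m1 \x m2)%E.-integrable setT (EFin \o f) by exact: integrable_bounded fM.
rewrite /Rintegral; have := Fubini fi => /= ff; congr fine.
transitivity (\int[m1]_x \int[m2]_y (f (x, y))%:E)%E.
  apply: eq_integral => x _; rewrite -EFin_Rintegral//.
  by apply: (@integrable_bounded _ _ _ _ M) => //; exact: (measurableT_comp mf).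
rewrite ff; apply: eq_integral => y _; rewrite -EFin_Rintegral//.
by apply: (@integrable_bounded _ _ _ _ M) => //; exact: (measurableT_comp mf).
Qed.

End Integration.

(** * Averaging operators *)

Section Averaging.
Variables (R : realType) (p : nat).
Implicit Types (g h : 'cV[R]_p -> R) (C e : R) (x y u : 'cV[R]_p).

(** The sum norm, chosen because its square is the double sum of [|u i| * |u j|], which dominates
    quadratic forms with bounded entries. *)
Definition norm1 u : R := \sum_i `|u i 0|.

Lemma norm1_ge0 u : 0 <= norm1 u.
Proof. exact: sumr_ge0. Qed.

Lemma norm1D u v : norm1 (u + v) <= norm1 u + norm1 v.
Proof. by rewrite -big_split; apply: ler_sum => i _; rewrite mxE ler_normD. Qed.

Lemma norm1Z (c : R) u : norm1 (c *: u) = `|c| * norm1 u.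
Proof. by rewrite mulr_sumr; apply: eq_bigr => i _; rewrite mxE normrM. Qed.

Lemma coord_le_norm1 u i : `|u i 0| <= norm1 u.
Proof. by rewrite /norm1 (bigD1 i)//= lerDl sumr_ge0. Qed.

Lemma measurable_norm1 d (T : measurableType d) (Y : T -> mxborel R p 1) :
  measurable_fun [set: T] Y -> measurable_fun [set: T] (fun w => norm1 (Y w)).
Proof.
move=> mY; apply: measurable_sum => i.
by apply: measurableT_comp => //; exact: measurable_coord.
Qed.

(** One constant serves for both bounds. Averaging preserves it, so that a single hypothesis
    survives any number of iterations. *)
Definition bounded_lipschitz C g :=
  (forall x, `|g x| <= C) /\ (forall x y, `|g x - g y| <= C * norm1 (x - y)).

Lemma bounded_lipschitz_continuous C g : bounded_lipschitz C g -> continuous g.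
Proof.
move=> [gC gL] x; apply/(@cvgrPdist_le _ _ _ _ (nbhs_filter x)) => /= e e0.
have C0 : 0 <= C by rewrite (le_trans _ (gC 0)).
(* [norm1] is at most [p] times the maximum norm; the added ones keep [D] positive. *)
pose D := (C + 1) * (p%:R + 1).
have D0 : 0 < D by rewrite mulr_gt0// ltr_wpDl.
apply/nbhs_ballP; exists (e / D) => /= [|y]; first by rewrite divr_gt0.
rewrite mx_norm_ball /= => xy; rewrite (le_trans (gL _ _))//.
have xy1 : norm1 (x - y) <= p%:R * (e / D).
  rewrite /norm1 mulr_natl -[X in _ *+ X]card_ord -sumr_const.
  by apply: ler_sum => i _; exact: le_trans (le_mx_norm_coord _ _ _) (ltW xy).
rewrite (le_trans (ler_wpM2l C0 xy1))//.
rewrite (_ : C * _ = e * (C * p%:R / D)); last by ring.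
by rewrite ger_pMr// ler_pdivrMr// mul1r ler_pM ?lerDl.
Qed.

Lemma bounded_lipschitz_measurable C g :
  bounded_lipschitz C g -> measurable_fun [set: mxborel R p 1] g.
Proof.
by move=> /bounded_lipschitz_continuous; exact: continuous_measurable_mxborel.
Qed.

Definition average d (T : measurableType d) (mu : probability T R)
    (Y : T -> 'cV[R]_p) g x : R := \int[mu]_w g (x + Y w).

(** The probability space is quantified away, so that the law of a summand on [Om] and a Gaussian
    law on vectors are operators of the same kind. *)
Definition averaging (A : ('cV[R]_p -> R) -> 'cV[R]_p -> R) : Prop :=
  exists d (T : measurableType d) (mu : probability T R) (Y : T -> 'cV[R]_p),
    measurable_fun [set: T] (Y : T -> mxborel R p 1) /\ A = average mu Y.

Lemma measurable_bounded_lipschitz C g d (T : measurableType d)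
    (Y : T -> mxborel R p 1) : bounded_lipschitz C g ->
  measurable_fun [set: T] Y -> measurable_fun [set: T] (fun w => g (Y w)).
Proof.
move=> gL mY; apply: (measurableT_comp (f := (g : mxborel R p 1 -> R))) => //.
exact: bounded_lipschitz_measurable gL.
Qed.

Lemma measurable_mxD m n d (T : measurableType d) (Y Z : T -> mxborel R m n) :
  measurable_fun [set: T] Y -> measurable_fun [set: T] Z ->
  measurable_fun [set: T] ((fun w => (Y w : 'M[R]_(m, n)) + Z w) : T -> mxborel R m n).
Proof.
move=> mY mZ; apply: measurable_mxborelP => i j.
under eq_fun do rewrite mxE.
by apply: measurable_funD; exact: measurable_coord.
Qed.

Lemma measurable_mx_cst m n d (T : measurableType d) (x : 'M[R]_(m, n)) :
  measurable_fun [set: T] (cst x : T -> mxborel R m n).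
Proof. exact: measurable_cst. Qed.

Lemma bounded_lipschitz_shift C g u :
  bounded_lipschitz C g -> bounded_lipschitz C (fun x => g (u + x)).
Proof.
move=> [gC gL]; split => [x|x y]; first exact: gC.
by rewrite (le_trans (gL _ _))// (_ : u + x - _ = x - y)// opprD addrACA subrr add0r.
Qed.

Section AverageTheory.
Context d (T : measurableType d).
Variables (mu : probability T R) (Y : T -> mxborel R p 1).
Hypothesis mY : measurable_fun [set: T] Y.

Lemma average_integrable C g x : bounded_lipschitz C g ->
  mu.-integrable [set: T] (EFin \o (fun w => g (x + (Y w : 'cV_p)))).
Proof.
move=> gL; apply: (@integrable_bounded _ _ _ _ _ C) => [|w]; last exact: gL.1.
exact: measurable_bounded_lipschitz (bounded_lipschitz_shift x gL) mY.
Qed.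

Lemma average_bounded_lipschitz C g :
  bounded_lipschitz C g -> bounded_lipschitz C (average mu Y g).
Proof.
move=> gL; split => [x|x y].
  apply: Rintegral_bounded => [|w]; last exact: gL.1.
  exact: measurable_bounded_lipschitz (bounded_lipschitz_shift x gL) mY.
rewrite /average -RintegralB//; [|exact: average_integrable gL..].
apply: Rintegral_bounded => [|w].
  by apply: measurable_funB;
    exact: measurable_bounded_lipschitz (bounded_lipschitz_shift _ gL) mY.
by rewrite (le_trans (gL.2 _ _))// opprD addrACA subrr addr0.
Qed.

Lemma average_dist C g h e : bounded_lipschitz C g -> bounded_lipschitz C h ->
  (forall x, `|g x - h x| <= e) ->
  forall x, `|average mu Y g x - average mu Y h x| <= e.
Proof.
move=> gL hL ghe x; rewrite /average -RintegralB//;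
  [|exact: average_integrable gL|exact: average_integrable hL].
apply: Rintegral_bounded => [|w]; last exact: ghe.
by apply: measurable_funB;
  [exact: measurable_bounded_lipschitz (bounded_lipschitz_shift _ gL) mY|
   exact: measurable_bounded_lipschitz (bounded_lipschitz_shift _ hL) mY].
Qed.

End AverageTheory.

Lemma averaging_bounded_lipschitz A C g : averaging A ->
  bounded_lipschitz C g -> bounded_lipschitz C (A g).
Proof. by move=> [d [T [mu [Y [mY ->]]]]]; exact: average_bounded_lipschitz. Qed.

Lemma averaging_dist A C g h e : averaging A ->
  bounded_lipschitz C g -> bounded_lipschitz C h ->
  (forall x, `|g x - h x| <= e) -> forall x, `|A g x - A h x| <= e.
Proof. by move=> [d [T [mu [Y [mY ->]]]]]; exact: average_dist. Qed.

(** Both sides are double integrals of [g (x + Y w + Z v)], so that this is Fubini's theorem. *)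
Lemma averagingC A B C g : averaging A -> averaging B ->
  bounded_lipschitz C g -> A (B g) = B (A g).
Proof.
move=> [d [T [mu [Y [mY ->]]]]] [d' [T' [mu' [Z [mZ ->]]]]] gL.
apply/funext => x; rewrite /average.
pose f (z : T * T') : R := g (x + Y z.1 + Z z.2).
rewrite [LHS](_ : _ = \int[mu]_w \int[mu']_v f (w, v))//.
rewrite (@Rintegral_exchange _ _ _ _ _ _ _ _ C).
- by under eq_Rintegral do under eq_Rintegral do rewrite /f /= addrAC.
- apply: (measurable_bounded_lipschitz gL).
  apply: measurable_mxD; [apply: measurable_mxD; first exact: measurable_mx_cst|].
  + exact: (measurableT_comp mY).
  + exact: (measurableT_comp mZ).
- by move=> z; exact: gL.1.
Qed.

Lemma iter_bounded_lipschitz A C g n : averaging A ->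
  bounded_lipschitz C g -> bounded_lipschitz C (iter n A g).
Proof.
by move=> aA gL; elim: n => //= n IHn; exact: averaging_bounded_lipschitz.
Qed.

Lemma iter_averagingC A B C g n : averaging A -> averaging B ->
  bounded_lipschitz C g -> iter n A (B g) = B (iter n A g).
Proof.
move=> aA aB gL; elim: n => //= n ->.
exact: (averagingC aA aB (iter_bounded_lipschitz n aA gL)).
Qed.

Lemma iter_averaging_dist A C g h e n : averaging A ->
  bounded_lipschitz C g -> bounded_lipschitz C h ->
  (forall x, `|g x - h x| <= e) ->
  forall x, `|iter n A g x - iter n A h x| <= e.
Proof.
move=> aA gL hL ghe; elim: n => //= n IHn.
exact: (averaging_dist aA (iter_bounded_lipschitz n aA gL)
  (iter_bounded_lipschitz n aA hL) IHn).
Qed.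

(** One operator is exchanged per step: the innermost [A] becomes [B] at cost [e], since the outer
    iterates do not increase distances; [B] is then commuted to the outside, where the induction
    hypothesis applies behind it. *)
Lemma iter_averaging_telescope A B C g e n : averaging A -> averaging B ->
  bounded_lipschitz C g -> (forall x, `|A g x - B g x| <= e) ->
  forall x, `|iter n A g x - iter n B g x| <= n%:R * e.
Proof.
move=> aA aB gL ABe; elim: n => [|n IHn] x; first by rewrite subrr normr0 mul0r.
rewrite iterSr iterS.
rewrite (le_trans (ler_distD (iter n A (B g) x) _ _))// -nat1r mulrDl mul1r.
apply: lerD.
  exact: (iter_averaging_dist n aA (averaging_bounded_lipschitz aA gL)
    (averaging_bounded_lipschitz aB gL) ABe).
rewrite (iter_averagingC _ aA aB gL).
exact: (averaging_dist aB (iter_bounded_lipschitz n aA gL)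
  (iter_bounded_lipschitz n aB gL) IHn).
Qed.

End Averaging.

(** * Independence *)

Section ProductLaw.
Context dsp d1 d2 (Om : measurableType dsp) (E1 : measurableType d1)
  (E2 : measurableType d2) (R : realType).
Variables (P : probability Om R) (U : Om -> E1) (W : Om -> E2).
Hypotheses (mU : measurable_fun [set: Om] U) (mW : measurable_fun [set: Om] W).
Hypothesis UW_indep : forall A B, measurable A -> measurable B ->
  P (U @^-1` A `&` W @^-1` B) = (P (U @^-1` A) * P (W @^-1` B))%E.

Let mUW : measurable_fun [set: Om] (fun w => (U w, W w)).
Proof. exact: measurable_fun_pair. Qed.

Let lawU : probability E1 R := distribution P (mfun_Sub (mem_set mU)).
Let lawW : probability E2 R := distribution P (mfun_Sub (mem_set mW)).
Let lawUW : probability _ R := distribution P (mfun_Sub (mem_set mUW)).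

(** A product measure is determined by its values on rectangles, and there [UW_indep] gives them. *)
Let lawUW_prod A : measurable A -> lawUW A = (lawU \x lawW)%E A.
Proof.
by move=> mA; apply/esym; apply: product_measure_unique => // *; exact: UW_indep.
Qed.

(** The iterated integral is taken over two copies of [Om] and not over the two laws, so that it can
    be read as an average of averages over [P]. *)
Lemma ge0_integral_independent (f : E1 * E2 -> \bar R) :
  measurable_fun [set: E1 * E2] f -> (forall z, 0 <= f z)%E ->
  (\int[P]_w f (U w, W w) = \int[P]_w \int[P]_v f (U w, W v))%E.
Proof.
move=> mf f0.
have -> : (\int[P]_w f (U w, W w) = \int[lawUW]_z f z)%E.
  by rewrite ge0_integral_distribution.
rewrite (eq_measure_integral (lawU \x lawW)%E); last by move=> A mA _; exact: lawUW_prod.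
rewrite fubini_tonelli1// ge0_integral_distribution//; last 2 first.
  exact: measurable_fun_fubini_tonelli_F.
  by move=> x; apply: integral_ge0.
apply: eq_integral => w _ /=; rewrite /fubini_F ge0_integral_distribution//.
exact: measurableT_comp.
Qed.

Lemma Rintegral_independent (f : E1 * E2 -> R) (M : R) :
  measurable_fun [set: E1 * E2] f -> (forall z, `|f z| <= M) ->
  \int[P]_w f (U w, W w) = \int[P]_w \int[P]_v f (U w, W v).
Proof.
move=> mf fM.
have bi d (T : measurableType d) (mu : probability T R) (h : T -> E1 * E2) :
    measurable_fun setT h -> mu.-integrable setT (EFin \o (f \o h)).
  move=> mh; apply: (@integrable_bounded _ _ _ _ _ M) => [|x]; last exact: fM.
  exact: measurableT_comp.
have -> : \int[P]_w f (U w, W w) = \int[lawUW]_z f z.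
  congr fine; rewrite integral_distribution//; first exact/measurable_EFinP.
  exact: bi.
have -> : \int[lawUW]_z f z = \int[(lawU \x lawW)%E]_z f z.
  by congr fine; apply: eq_measure_integral => A mA _; exact: lawUW_prod.
rewrite (@Rintegral_product _ _ _ _ _ lawU lawW f M mf fM).
rewrite [LHS](_ : _ = \int[P]_w \int[lawW]_y f (U w, y)).
  apply: eq_Rintegral => w _; congr fine.
  rewrite integral_distribution//; first by apply/measurable_EFinP; exact: measurableT_comp.
  by apply: bi; exact: measurable_fun_pair.
have mF := @measurable_Rintegral_section _ _ _ _ _ lawU lawW f M mf fM.
congr fine; rewrite integral_distribution//; first exact/measurable_EFinP.
apply: (@integrable_bounded _ _ _ _ _ M) => [|x]; first exact: (measurableT_comp mF mU).
by apply: Rintegral_bounded => [|y]; [exact: (measurableT_comp mf)|exact: fM].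
Qed.

End ProductLaw.

Section IndependentFamily.
Context dsp dsp' (Om : measurableType dsp) (E : measurableType dsp') (R : realType).
Variables (P : probability Om R) (I : choiceType) (X : I -> Om -> E).
Hypothesis mX : forall i, measurable_fun [set: Om] (X i).
Hypothesis X_indep : mutually_independent P X.

(** A pi-system that generates the sigma-algebra of the variables [X i] with [i] in [s]. *)
Let cylinder (s : seq I) : set (set Om) :=
  [set D | exists2 B : I -> set E, (forall i, measurable (B i)) &
    D = \bigcap_(i in [set` s]) (X i @^-1` B i)].

Let mpreimage i B : measurable B -> measurable (X i @^-1` B).
Proof. by move=> mB; rewrite -[_ @^-1` _]setTI; exact: mX. Qed.

(** Dynkin's theorem: the events that factorize with a fixed event are closed under complements and
    disjoint unions. Measurability of [D] is part of the conclusion because both closure steps use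
    it. *)
Lemma independent_cylinder s i B D : i \notin s -> uniq s -> measurable B ->
  <<s cylinder s>> D ->
  measurable D /\ P (D `&` X i @^-1` B) = (P D * P (X i @^-1` B))%E.
Proof.
move=> si us mB.
have mC := mpreimage i mB; set C := X i @^-1` B in mC *.
have PfinC : P C \is a fin_num by exact: fin_num_measure.
move=> DG; pose G := cylinder s.
apply: (@dynkin_induction _ (g_sigma_algebraType G) G
  (fun D => measurable (D : set Om) /\ P (D `&` C) = (P D * P C)%E)) => //.
- move=> _ _ [B1 mB1 ->] [B2 mB2 ->]; exists (fun i => B1 i `&` B2 i).
    by move=> j; exact: measurableI.
  by rewrite -bigcapI.
- by split => //; rewrite setTI [X in _ = (X * _)%E]probability_setT mul1e.
- move=> _ [B' mB' ->]; split.
    by apply: fin_bigcap_measurable => // j _; exact: mpreimage.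
  have us' : uniq (i :: s) by rewrite /= si.
  (* [B''] puts [B] at the new index and, as [i] is not in [s], agrees with [B'] on [s]; the product
     rule for [i :: s] then splits off its first factor. *)
  pose B'' j := if j == i then B else B' j.
  have mB'' j : measurable (B'' j) by rewrite /B''; case: ifP.
  have B''i : B'' i = B by rewrite /B'' eqxx.
  have := X_indep us' mB''; rewrite big_cons B''i -/C.
  have eqB j : j \in s -> B'' j = B' j.
    by rewrite /B''; case: eqP => // ->; rewrite (negbTE si).
  rewrite big_seq; under eq_bigr => j js do rewrite (eqB _ js); rewrite -big_seq.
  rewrite -X_indep// muleC => <-; congr (P _).
  apply/seteqP; split => w /=.
    move=> [B'w Cw] j /=; rewrite inE => /orP[/eqP->|js]; first by rewrite B''i.
    by rewrite eqB//; exact: B'w.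
  move=> Bw; split; last by rewrite /C -B''i; apply: Bw; rewrite /= mem_head.
  by move=> j js; rewrite -(eqB _ js); apply: Bw; rewrite /= inE js orbT.
- move=> S _ [mS PS]; split; first exact: measurableC.
  rewrite setIC -setDE measureD//; last by rewrite -ge0_fin_numE.
  rewrite probability_setC// muleBl ?fin_num_measure// mul1e.
  by congr (_ - _)%E; rewrite setIC; exact: PS.
- move=> F _ tF FP; split.
    by apply: bigcupT_measurable => n; exact: (FP n).1.
  rewrite setI_bigcupl measure_bigcup//; last 2 first.
    by move=> n _; apply: measurableI => //; exact: (FP n).1.
    by apply: trivIset_setIr.
  rewrite measure_bigcup//; last by move=> n _; exact: (FP n).1.
  rewrite -[P C]fineK// muleC -nneseriesZl//.
  apply: eq_eseriesr => n _; rewrite fineK// muleC; exact: (FP n).2.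
Qed.

Lemma measurable_cylinder s i : i \in s ->
  measurable_fun [set: g_sigma_algebraType (cylinder s)]
    (X i : g_sigma_algebraType (cylinder s) -> E).
Proof.
move=> si _ B mB; rewrite setTI; apply: sub_sigma_algebra.
exists (fun j => if j == i then B else setT).
  by move=> j; case: ifP => // _; exact: measurableT.
apply/seteqP; split => w /= => [Bw j _ /=|Bw].
  by case: eqP => [->|].
by have := Bw i si; rewrite /= eqxx.
Qed.

Section SumIndependent.
Context d1 (E1 : measurableType d1).
Variables (i : I) (s : seq I) (U : Om -> E1).
Hypotheses (si : i \notin s) (us : uniq s).
Hypothesis mU : measurable_fun [set: g_sigma_algebraType (cylinder s)]
  (U : g_sigma_algebraType (cylinder s) -> E1).

Lemma cylinder_independent A B : measurable A -> measurable B ->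
  P (X i @^-1` B `&` U @^-1` A) = (P (X i @^-1` B) * P (U @^-1` A))%E.
Proof.
move=> mA mB; rewrite setIC muleC.
have sUA : <<s cylinder s>> (U @^-1` A) by rewrite -[_ @^-1` _]setTI; exact: mU.
by have [] := independent_cylinder si us mB sUA.
Qed.

Lemma cylinder_measurable_fun : measurable_fun [set: Om] U.
Proof.
move=> _ A mA; rewrite setTI.
have sUA : <<s cylinder s>> (U @^-1` A) by rewrite -[_ @^-1` _]setTI; exact: mU.
by have [] := independent_cylinder si us measurableT sUA.
Qed.

End SumIndependent.

Section SumOfVectors.
Variables (p : nat) (phi : I -> E -> mxborel R p 1).
Hypothesis mphi : forall i, measurable_fun [set: E] (phi i).

Let Z i w : 'cV[R]_p := phi i (X i w).

Let measurable_sum_vector d (T : measurableType d) (s : seq I)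
    (Y : I -> T -> 'cV[R]_p) :
  (forall i, i \in s -> measurable_fun [set: T] (Y i : T -> mxborel R p 1)) ->
  measurable_fun [set: T] ((fun w => \sum_(i <- s) Y i w) : T -> mxborel R p 1).
Proof.
elim: s => [|i s IHs] mY.
  by under eq_fun do rewrite big_nil; exact: measurable_mx_cst.
under eq_fun do rewrite big_cons.
apply: measurable_mxD; first by apply: mY; exact: mem_head.
by apply: IHs => j js; apply: mY; rewrite inE js orbT.
Qed.

(** The head of the list is independent of the sum over the tail, which depends on the variables of
    the tail only. One application of Fubini's theorem per summand turns the average into a
    composition. *)
Lemma average_sum_independent (s : seq I) C g : uniq s ->
  bounded_lipschitz C g ->
  average P (fun w => \sum_(i <- s) Z i w) g =
  foldr (fun i => average P (Z i)) g s.
Proof.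
move=> + gL; elim: s => [_|i s IHs /= /andP[si us]].
  apply/funext => x; rewrite /average /=.
  by under eq_Rintegral do rewrite big_nil addr0; rewrite Rintegral_prob_cst.
rewrite -IHs//; apply/funext => x; rewrite /average.
under eq_Rintegral do rewrite big_cons.
pose f (z : E * mxborel R p 1) := g (x + ((phi i z.1 : 'cV_p) + z.2)).
(* The partial sum is measurable for the sigma-algebra of the cylinders, not just on [Om]; this is
   what makes it independent of [X i]. *)
have mS : measurable_fun [set: g_sigma_algebraType (cylinder s)]
    ((fun w => \sum_(i <- s) Z i w) : g_sigma_algebraType (cylinder s) -> mxborel R p 1).
  apply: measurable_sum_vector => j js.
  by apply: (measurableT_comp (mphi j)); exact: measurable_cylinder.
have mSO := cylinder_measurable_fun si us mS.
have mf : measurable_fun [set: E * mxborel R p 1] f.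
  apply: (measurable_bounded_lipschitz gL).
  apply: measurable_mxD; first exact: measurable_mx_cst.
  by apply: measurable_mxD; first exact: (measurableT_comp (mphi i)).
have ind A B mA mB := @cylinder_independent _ _ i s _ si us mS B A mB mA.
have RI := @Rintegral_independent _ _ _ _ _ (mxborel R p 1) _ P _ _ (mX i) mSO ind f C mf.
rewrite [LHS](_ : _ = \int[P]_w f (X i w, \sum_(j <- s) Z j w)); last first.
  by apply: eq_Rintegral => w _; rewrite /f /= addrA.
rewrite RI.
  by under eq_Rintegral do under eq_Rintegral do rewrite /f /= addrA.
by move=> z; exact: gL.1.
Qed.

End SumOfVectors.

(** Additivity of variances for centred variables. The integral is extended real because Tonelli's
    theorem is used before the square of the sum is known to be integrable. *)
Lemma sum_independent_sqr (f : I -> E -> R) (v : I -> R) (s : seq I) : uniq s ->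
  (forall i, measurable_fun [set: E] (f i)) ->
  (forall i, i \in s -> integrableR P (fun w => f i (X i w))) ->
  (forall i, i \in s -> integrableR P (fun w => f i (X i w) ^+ 2)) ->
  (forall i, i \in s -> \int[P]_w f i (X i w) = 0) ->
  (forall i, i \in s -> \int[P]_w (f i (X i w) ^+ 2) = v i) ->
  (\int[P]_w ((\sum_(i <- s) f i (X i w)) ^+ 2)%:E = (\sum_(i <- s) v i)%:E)%E.
Proof.
move=> + mf; elim: s => [_ _ _ _ _|i s IHs /= /andP[si us] fi f2i f0 fv].
  under eq_integral do rewrite big_nil expr0n /=.
  by rewrite integral0 big_nil.
have mS d (T : measurableType d) (Y : I -> T -> E) t :
    (forall j, j \in t -> measurable_fun [set: T] (Y j)) ->
    measurable_fun [set: T] (fun w => \sum_(i <- t) f i (Y i w)).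
  elim: t => [|j t IHt] mY; first by under eq_fun do rewrite big_nil; exact: measurable_cst.
  under eq_fun do rewrite big_cons; apply: measurable_funD.
    by apply: (measurableT_comp (mf j)); apply: mY; exact: mem_head.
  by apply: IHt => k kt; apply: mY; rewrite inE kt orbT.
have mSs := mS _ (g_sigma_algebraType (cylinder s)) X s (@measurable_cylinder s).
have mSO := cylinder_measurable_fun si us mSs.
under eq_integral do rewrite big_cons.
pose h (z : E * R) := ((f i z.1 + z.2) ^+ 2)%:E.
have mh : measurable_fun [set: E * R] h.
  apply/measurable_EFinP/measurable_funX/measurable_funD => //.
  exact: (measurableT_comp (mf i)).
have h0 z : (0 <= h z)%E by rewrite lee_fin sqr_ge0.
have ind A B mA mB := @cylinder_independent _ _ i s _ si us mSs B A mB mA.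
rewrite [LHS](@ge0_integral_independent _ _ _ _ _ _ _ P _ _ (mX i) mSO ind h mh h0)//.
(* The order is exchanged so that the inner integral runs over the new summand, whose mean 0 removes
   the cross term. *)
rewrite (@fubini_tonelli _ _ _ _ _ P P (fun z => h (X i z.1, \sum_(i <- s) f i (X i z.2))))//;
  last first.
  apply: (measurableT_comp mh); apply: measurable_fun_pair.
    exact: (measurableT_comp (mX i)).
  exact: (measurableT_comp mSO).
have is_ : i \in i :: s by exact: mem_head.
pose S w := \sum_(j <- s) f j (X j w).
have inner w : (\int[P]_u h (X i u, S w) = (v i)%:E + (S w ^+ 2)%:E)%E.
  rewrite (_ : (fun u => h (X i u, S w)) = fun u =>
    (f i (X i u) ^+ 2 + (2 * S w * f i (X i u) + S w ^+ 2))%:E); last first.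
    by apply/funext => u; rewrite /h /=; congr EFin; ring.
  have ci := integrableRZ (2 * S w) (fi i is_).
  have c2i := integrableRD ci (integrableR_cst P (S w ^+ 2)).
  rewrite -EFin_Rintegral; last exact: (integrableRD (f2i i is_) c2i).
  rewrite RintegralD//; last exact: f2i.
  rewrite RintegralD//; last exact: integrableR_cst.
  rewrite RintegralZl//; last exact: fi.
  by rewrite f0// mulr0 add0r fv// Rintegral_prob_cst EFinD.
rewrite [LHS](_ : _ = \int[P]_w ((v i)%:E + (S w ^+ 2)%:E))%E; last first.
  by apply: eq_integral => w _; exact: inner.
rewrite ge0_integralD//=.
- rewrite integral_cst// [X in (_ * X)%E]probability_setT mule1 IHs// ?big_cons -?EFinD//.
  + by move=> j js; apply: fi; rewrite inE js orbT.
  + by move=> j js; apply: f2i; rewrite inE js orbT.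
  + by move=> j js; apply: f0; rewrite inE js orbT.
  + by move=> j js; apply: fv; rewrite inE js orbT.
- move=> _ _; rewrite lee_fin -(fv i)//; apply: Rintegral_ge0 => w _; exact: sqr_ge0.
- by move=> w _; rewrite lee_fin sqr_ge0.
- by apply/measurable_EFinP/measurable_funX.
Qed.

End IndependentFamily.

(** * Gaussian measures *)

Section LebesgueAffine.
Variable R : realType.
Local Notation lam := (@lebesgue_measure R).

(** The right-hand side is a measure that gives half-open intervals their length, and this
    characterizes Lebesgue measure. A negative slope turns []x, y]] into an interval that is closed
    on the other side. *)
Lemma lebesgue_affine (c b : R) (A : set R) : c != 0 -> measurable A ->
  (lam A = `|c|%:E * lam ((fun x => c * x + b)%R @^-1` A))%E.
Proof.
move=> c0 mA.
have maff : measurable_fun [set: R] (fun x : R => c * x + b).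
  by apply: measurable_funD => //; exact: measurable_funM.
have cN : 0 <= `|c| by [].
have @pf : {measure set (measurableTypeR R) -> \bar R}.
  by refine (pushforward lam ((fun x => c * x + b) : measurableTypeR R -> measurableTypeR R)); exact: maff.
pose m' : {measure set (measurableTypeR R) -> \bar R} := mscale (NngNum cN) pf.
rewrite (@lebesgue_measure_unique R m')//.
move=> _ [[x y] _ <-]; rewrite /m' /pf /= /mscale /= /pushforward.
have [c_gt0|c_le0] := ltP 0 c.
  have -> : (fun x0 => c * x0 + b) @^-1` `]x, y] = `](x - b) / c, (y - b) / c]%classic.
    apply/seteqP; split => z /=; rewrite !in_itv /=.
      by rewrite ltr_pdivrMr// ler_pdivlMr// (mulrC z) ltrBlDr lerBrDr.
    by rewrite ltr_pdivrMr// ler_pdivlMr// (mulrC z) ltrBlDr lerBrDr.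
  rewrite !lebesgue_measure_itv /= !lte_fin ltr_pM2r ?invr_gt0// ltrD2r.
  case: ifP => _; last by rewrite mule0.
  by rewrite -!EFinD -EFinM gtr0_norm//; congr EFin; field; rewrite gt_eqF.
have c_lt0 : c < 0 by rewrite lt_neqAle c0.
have -> : (fun x0 => c * x0 + b) @^-1` `]x, y] = `[(y - b) / c, (x - b) / c[%classic.
  apply/seteqP; split => z /=; rewrite !in_itv /=.
    by rewrite ler_ndivrMr// ltr_ndivlMr// (mulrC z) ltrBlDr lerBrDr andbC.
  by rewrite ler_ndivrMr// ltr_ndivlMr// (mulrC z) ltrBlDr lerBrDr andbC.
rewrite !lebesgue_measure_itv /= !lte_fin ltr_nM2r ?invr_lt0// ltrD2r.
case: ifP => _; last by rewrite mule0.
by rewrite -!EFinD -EFinM ltr0_norm//; congr EFin; field; rewrite lt_eqF.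
Qed.

Lemma ge0_integral_affine (c b : R) (f : R -> \bar R) : c != 0 ->
  measurable_fun [set: R] f -> (forall x, 0 <= f x)%E ->
  (\int[lam]_x f x = `|c|%:E * \int[lam]_x f (c * x + b)%R)%E.
Proof.
move=> c0 mf f0.
have maff : measurable_fun [set: R] (fun x : R => c * x + b).
  by apply: measurable_funD => //; exact: measurable_funM.
have cN : 0 <= `|c| by [].
have @pf : {measure set (measurableTypeR R) -> \bar R}.
  by refine (pushforward lam ((fun x => c * x + b) : measurableTypeR R -> measurableTypeR R)); exact: maff.
pose m' : {measure set (measurableTypeR R) -> \bar R} := mscale (NngNum cN) pf.
rewrite (eq_measure_integral m'); last by move=> A mA _; exact: lebesgue_affine.
by rewrite ge0_integral_mscale// ge0_integral_pushforward.
Qed.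

End LebesgueAffine.

Section NormalDensity.
Variable R : realType.
Variables (m s : R).
Local Notation lam := (@lebesgue_measure R).
Local Notation N := (@normal_prob R m s).

Let mpdf : measurable_fun [set: R] (fun x => (normal_pdf m s x)%:E).
Proof. by apply/measurable_EFinP; exact: measurable_normal_pdf. Qed.

Import HBNNSimple.

Let integral_normal_nnsfun (g : {nnsfun R >-> R}) :
  (\int[N]_x (g x)%:E = \int[lam]_x ((g x)%:E * (normal_pdf m s x)%:E))%E.
Proof.
have gE x : (g x)%:E = (\sum_(k \in range g) (k * \1_(g @^-1` [set k]) x)%R%:E)%E.
  by rewrite fsumEFin//= fimfunE.
have gn0 (k : R) x : (0 <= (k * \1_(g @^-1` [set k]) x)%R%:E)%E.
  by rewrite EFinM nnfun_muleindic_ge0.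
have mk (k : R) : measurable_fun [set: R] (fun x => (k * \1_(g @^-1` [set k]) x)%:E).
  by apply/measurable_EFinP/measurable_funM.
have mi (k : R) : measurable_fun [set: R] (fun x => (\1_(g @^-1` [set k]) x : R)%:E).
  by apply/measurable_EFinP; apply: measurable_indic.
under eq_integral do rewrite gE.
rewrite ge0_integral_fsum//.
under [RHS]eq_integral => x _.
  rewrite gE ge0_mule_fsuml//; over.
rewrite ge0_integral_fsum//; last 2 first.
- by move=> k; apply: emeasurable_funM; [exact: mk|exact: mpdf].
- by move=> k x _; rewrite mule_ge0// lee_fin normal_pdf_ge0.
apply: eq_fsbigr => k /[!inE] -[x0 _ <-].
have k0 : 0 <= g x0 by [].
under eq_integral do rewrite EFinM.
rewrite ge0_integralZl//; last exact: mi.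
under [RHS]eq_integral do rewrite EFinM -muleA.
rewrite [RHS]ge0_integralZl//; last 2 first.
- by apply: emeasurable_funM; [exact: mi|exact: mpdf].
- by move=> x _; rewrite mule_ge0// lee_fin ?normal_pdf_ge0.
have mA : measurable (g @^-1` [set g x0]) by [].
rewrite integral_indic; [congr (_ * _)%E|exact: measurableT|exact: mA].
rewrite [LHS](_ : _ = normal_prob m s (g @^-1` [set g x0])); last first.
  by congr (normal_prob _ _ _); exact: setIT.
rewrite /normal_prob.
rewrite [LHS]integral_mkcond; apply: eq_integral => x _.
by rewrite patchE indicE; case: ifP => _; rewrite ?mul1e ?mul0e.
Qed.

(** The density defines the measure of sets; simple functions and monotone convergence carry this
    over to integrals. *)
Lemma ge0_integral_normal_prob (f : R -> \bar R) :
  measurable_fun [set: R] f -> (forall x, 0 <= f x)%E ->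
  (\int[N]_x f x = \int[lam]_x (f x * (normal_pdf m s x)%:E))%E.
Proof.
move=> mf f0; pose f_ := nnsfun_approx measurableT mf.
have f_nd x a b : (a <= b)%N -> ((f_ a x)%:E <= (f_ b x)%:E)%E.
  by move=> ab; rewrite lee_fin; have /lefP := nd_nnsfun_approx measurableT mf ab; apply.
have mf_ n : measurable_fun [set: R] (f_ n : R -> R) by [].
transitivity (limn (fun n => \int[N]_x (f_ n x)%:E))%E.
  rewrite -monotone_convergence//=.
  - by apply: eq_integral => x _; apply/esym/cvg_lim => //; exact: cvg_nnsfun_approx.
  - by move=> n; apply/measurable_EFinP; exact: mf_.
  - by move=> n x _; rewrite lee_fin.
  - by move=> x _ a b; exact: f_nd.
rewrite [LHS](_ : _ = limn (fun n =>
    \int[lam]_x ((f_ n x)%:E * (normal_pdf m s x)%:E)))%E; last first.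
  by congr (limn _); apply/funext => n; exact: integral_normal_nnsfun.
rewrite -monotone_convergence//=.
- apply: eq_integral => x _; apply/cvg_lim => //; apply: cvgeZr => //.
  exact: cvg_nnsfun_approx.
- by move=> n; apply: emeasurable_funM; [apply/measurable_EFinP; exact: mf_|exact: mpdf].
- by move=> n x _; rewrite mule_ge0// lee_fin ?normal_pdf_ge0.
- by move=> x _ a b ab; rewrite lee_wpmul2r ?lee_fin ?normal_pdf_ge0// -lee_fin f_nd.
Qed.

End NormalDensity.

(** * Scaling and convolution of one-dimensional normal laws *)

Section GaussianConvolution.
Variable R : realType.
Local Notation lam := (@lebesgue_measure R).
Local Notation gam := (@normal_prob R 0 1).

Lemma normal_probE (m s : R) (B : set R) : measurable B ->
  (normal_prob m s B = \int[lam]_x ((\1_B x)%:E * (normal_pdf m s x)%:E))%E.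
Proof.
move=> mB; rewrite /normal_prob [LHS]integral_mkcond; apply: eq_integral => x _.
by rewrite patchE indicE; case: ifP => _; rewrite ?mul1e ?mul0e.
Qed.

Lemma normal_pdf_gt0E (m s x : R) : 0 < s ->
  normal_pdf m s x =
  (s * Num.sqrt (pi *+ 2))^-1 * expR (- (x - m) ^+ 2 / (s ^+ 2 *+ 2)).
Proof.
move=> s0; rewrite normal_pdfE ?gt_eqF// /normal_peak /normal_fun.
by rewrite -mulrnAr sqrtrM ?sqr_ge0// sqrtr_sqr gtr0_norm.
Qed.

Lemma measurable_normal_pdfE (m s : R) :
  measurable_fun [set: R] (fun x => (normal_pdf m s x)%:E).
Proof. by apply/measurable_EFinP; exact: measurable_normal_pdf. Qed.

Lemma measurable_indicE (B : set R) : measurable B ->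
  measurable_fun [set: R] (fun x => (\1_B x : R)%:E).
Proof. by move=> mB; apply/measurable_EFinP; exact: measurable_indic. Qed.

Lemma normal_pdfM_ge0 (B : set R) (m s x : R) :
  (0 <= (\1_B x)%:E * (normal_pdf m s x)%:E)%E.
Proof. by rewrite mule_ge0// lee_fin ?normal_pdf_ge0. Qed.

Lemma normal_prob_scale (c : R) (B : set R) : c != 0 -> measurable B ->
  gam ((fun z => c * z) @^-1` B) = normal_prob 0 `|c| B.
Proof.
move=> c0 mB; have nc0 : 0 < `|c| by rewrite normr_gt0.
have mc : measurable_fun [set: R] (fun z : R => c * z) by exact: measurable_funM.
have mcB : measurable ((fun z => c * z) @^-1` B).
  by rewrite -[X in measurable X]setTI; exact: mc.
have mF : measurable_fun [set: R] (fun x => (\1_B x)%:E * (normal_pdf 0 `|c| x)%:E)%E.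
  by apply: emeasurable_funM; [exact: measurable_indicE|exact: measurable_normal_pdfE].
rewrite (normal_probE 0 1 mcB) (normal_probE 0 `|c| mB).
rewrite [RHS](ge0_integral_affine 0 c0 mF (normal_pdfM_ge0 B 0 `|c|)).
rewrite -ge0_integralZl//; last 2 first.
- apply: emeasurable_funM; under eq_fun do rewrite addr0.
    exact: (measurableT_comp (measurable_indicE mB) mc).
  exact: (measurableT_comp (measurable_normal_pdfE 0 `|c|) mc).
- by move=> x _; exact: normal_pdfM_ge0.
apply: eq_integral => x _; rewrite addr0 muleCA; congr (_ * _)%E.
rewrite -EFinM; congr EFin; rewrite !normal_pdf_gt0E// !subr0 expr1n.
rewrite real_normK ?num_real// exprMn mulrA; congr (_ * expR _).
  have K0 : 0 < Num.sqrt (pi *+ 2 : R) by rewrite sqrtr_gt0 mulrn_wgt0// pi_gt0.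
  move: (Num.sqrt (pi *+ 2)) `|c| K0 nc0 => K C K0 C0.
  by field; rewrite !gt_eqF.
by field.
Qed.

(** Completing the square. On the left is the joint density of [z] and [y = a z + b w] for
    independent standard normal [z] and [w]; on the right it is factored into the law of [y] and the
    conditional law of [z] given [y], with mean [a * y / c ^+ 2] and deviation [|b| / c]. *)
Lemma normal_pdf_convolution (a b y z : R) (c := Num.sqrt (a ^+ 2 + b ^+ 2)) :
  b != 0 ->
  `|b|^-1 * (normal_pdf 0 1 z * normal_pdf 0 1 ((y - a * z) / b)) =
  normal_pdf 0 c y * normal_pdf (a * y / c ^+ 2) (`|b| / c) z.
Proof.
move=> b0; have nb0 : 0 < `|b| by rewrite normr_gt0.
have c2 : c ^+ 2 = a ^+ 2 + b ^+ 2 by rewrite sqr_sqrtr// addr_ge0 ?sqr_ge0.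
have c2_gt0 : 0 < a ^+ 2 + b ^+ 2.
  by rewrite ltr_wpDl ?sqr_ge0// exprn_even_gt0.
have c0 : 0 < c by rewrite sqrtr_gt0.
rewrite !normal_pdf_gt0E ?divr_gt0//.
have K0 : 0 < Num.sqrt (pi *+ 2 : R) by rewrite sqrtr_gt0 mulrn_wgt0// pi_gt0.
move: (Num.sqrt (pi *+ 2)) K0 => K K0.
have expM (k k' e e' : R) :
  k * expR e * (k' * expR e') = k * k' * expR (e + e') by rewrite expRD mulrACA.
rewrite !expM mulrA; congr (_ * expR _).
  by move: `|b| nb0 => B B0; field; rewrite !gt_eqF.
rewrite !subr0 !(expr_div_n `|b|%R) real_normK ?num_real// expr1n c2.
by field; rewrite b0 gt_eqF.
Qed.

Lemma normal_prob_convolution (a b : R) (B : set R) : measurable B ->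
  (\int[gam]_z gam [set w | B (a * z + b * w)%R] =
   gam [set z | B (Num.sqrt (a ^+ 2 + b ^+ 2) * z)%R])%E.
Proof.
move=> mB.
have mlin (c e : R) : measurable_fun [set: R] (fun z : R => c * z + e).
  by apply: measurable_funD => //; exact: measurable_funM.
have gamE (c : R) : gam [set z | B (c * z)] = gam [set z | B (`|c| * z)].
  have [->|c0] := eqVneq c 0; first by rewrite normr0.
  have c0' : `|c| != 0 by rewrite normr_eq0.
  by rewrite [LHS](normal_prob_scale c0 mB) [RHS](normal_prob_scale c0' mB) normr_id.
(* For [b = 0] the pair [(z, a z)] has no joint density, and the substitution below would divide by
   [b]. *)
have [->|b0] := eqVneq b 0.
  rewrite expr0n addr0 sqrtr_sqr -gamE.
  have mB' : measurable [set z | B (a * z)].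
    rewrite -[X in measurable X]setTI; have := mlin a 0.
    by under eq_fun do rewrite addr0; apply.
  have := @integral_indic _ _ _ gam setT measurableT _ mB'.
  rewrite setIT => <-; apply: eq_integral => z _.
  have [Baz|nBaz] := pselect (B (a * z)).
    rewrite (_ : [set w | _] = setT) ?[LHS]probability_setT ?indicE ?mem_set//.
    by apply/seteqP; split => // w _ /=; rewrite mul0r addr0.
  rewrite (_ : [set w | _] = set0) ?measure0 ?indicE ?memNset//.
  by apply/seteqP; split => // w /=; rewrite mul0r addr0.
pose c := Num.sqrt (a ^+ 2 + b ^+ 2); rewrite -/c.
have c0 : c != 0 by rewrite gt_eqF// sqrtr_gt0 ltr_wpDl ?sqr_ge0// exprn_even_gt0.
rewrite [RHS](normal_prob_scale c0 mB) ger0_norm ?sqrtr_ge0//.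
pose F (zy : R * R) := ((\1_B zy.2)%:E *
  (normal_pdf 0 c zy.2 * normal_pdf (a * zy.2 / c ^+ 2) (`|b| / c) zy.1)%R%:E)%E.
have F0 zy : (0 <= F zy)%E.
  by rewrite mule_ge0// lee_fin ?mulr_ge0 ?normal_pdf_ge0.
have mF : measurable_fun [set: R * R] F.
  apply: emeasurable_funM; first exact: (measurableT_comp (measurable_indicE mB)).
  rewrite (_ : (fun zy : R * R => _) = fun zy : R * R => (`|b|^-1 *
      (normal_pdf 0 1 zy.1 * normal_pdf 0 1 ((zy.2 - a * zy.1) / b)))%:E); last first.
    by apply/funext => zy; rewrite normal_pdf_convolution.
  apply/measurable_EFinP/measurable_funM => //; apply: measurable_funM.
    exact: (measurableT_comp (measurable_normal_pdf 0 1)).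
  apply: (measurableT_comp (measurable_normal_pdf 0 1)).
  by apply: measurable_funM => //; apply: measurable_funB => //; exact: measurable_funM.
transitivity (\int[lam]_z \int[lam]_y F (z, y))%E.
  rewrite ge0_integral_normal_prob//; last first.
    pose A : set (R * R) := [set zw | B (a * zw.1 + b * zw.2)].
    have mA : measurable A.
      rewrite -[A]setTI; apply: (_ : measurable_fun _ (fun zw : R * R => a * zw.1 + b * zw.2)) => //.
      by apply: measurable_funD; exact: measurable_funM.
    have := measurable_fun_xsection gam mA; apply: eq_measurable_fun => z _ /=.
    by congr (gam _); apply/seteqP; split => w /=; rewrite /xsection /= inE.
  apply: eq_integral => z _.
  have mBz : measurable [set w | B (a * z + b * w)].
    rewrite -[X in measurable X]setTI; have := mlin b (a * z).
    by under eq_fun do rewrite addrC; apply.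
  rewrite (normal_probE 0 1 mBz) [LHS]muleC.
  have mG := emeasurable_funM (measurable_indicE mBz) (measurable_normal_pdfE 0 1).
  have p0 : (0 <= (normal_pdf 0 1 z)%:E)%E by rewrite lee_fin normal_pdf_ge0.
  rewrite -[LHS](ge0_integralZl lam measurableT mG _ p0); last first.
    by move=> x _; exact: normal_pdfM_ge0.
  rewrite [RHS](@ge0_integral_affine _ b (a * z))//; last first.
    exact: (measurableT_comp mF).
  rewrite -ge0_integralZl//; last first.
    apply: (measurableT_comp mF); apply: measurable_fun_pair => //; exact: mlin.
  apply: eq_integral => w _; rewrite /F /= -normal_pdf_convolution//.
  rewrite addrK mulrAC divff// mul1r.
  have -> : \1_[set w | B (a * z + b * w)] w = \1_B (b * w + a * z) :> R.
    by rewrite !indicE; congr (nat_of_bool _)%:R; apply/idP/idP; rewrite !inE /= addrC.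
  rewrite -!EFinM; congr EFin.
  move: (normal_pdf 0 1 z) (normal_pdf 0 1 w) (\1_B _) => p q i.
  by rewrite [RHS]mulrCA mulVKf ?normr_eq0// mulrCA.
(* With [z] integrated first, the conditional density has total mass 1 and only the density of [y]
   remains. *)
transitivity (\int[lam]_y \int[lam]_z F (z, y))%E; first exact: fubini_tonelli.
rewrite (normal_probE 0 c mB).
apply: eq_integral => y _; rewrite /F /=.
rewrite ge0_integralZl//; last 2 first.
- under eq_fun do rewrite EFinM; apply: emeasurable_funM => //.
  exact: measurable_normal_pdfE.
- by move=> z _; rewrite lee_fin mulr_ge0 ?normal_pdf_ge0.
congr (_ * _)%E; under eq_integral do rewrite EFinM.
rewrite ge0_integralZl//; last 3 first.
- exact: measurable_normal_pdfE.
- by move=> z _; rewrite lee_fin normal_pdf_ge0.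
- by rewrite lee_fin normal_pdf_ge0.
by rewrite integral_normal_pdf mule1.
Qed.

End GaussianConvolution.

(** * Moments of the standard normal law *)

Section GaussianMoments.
Variable R : realType.
Local Notation lam := (@lebesgue_measure R).
Local Notation gam := (@normal_prob R 0 1).
Local Notation phi := (@normal_pdf R 0 1).

Let phiE x : phi x = (Num.sqrt (pi *+ 2))^-1 * expR (- (x ^+ 2) / 2).
Proof. by rewrite normal_pdf_gt0E// mul1r subr0 expr1n. Qed.

Let continuous_phi : continuous phi.
Proof. by apply: continuous_normal_pdf; rewrite oner_neq0. Qed.

Let is_derive_phi (x : R) : is_derive x 1 (fun u => - phi u) (x * phi x).
Proof.
have -> : (fun u => - phi u) = (fun u => - (Num.sqrt (pi *+ 2))^-1 * expR (- (u ^+ 2) / 2)).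
  by apply/funext => u; rewrite phiE [RHS]mulNr.
have dsq : is_derive x (1 : R) (fun u : R => - (u ^+ 2) / 2) (- x).
  apply: is_derive_eq; rewrite /GRing.scale /=; by field.
have := @is_derive1_comp _ (@expR R) (fun u : R => - (u ^+ 2) / 2) x _ _ (is_derive_expR _) dsq.
move=> dexp; apply: is_derive_eq.
by rewrite /GRing.scale /= phiE; ring.
Qed.

Let cvg_phi : phi u @[u --> +oo%R] --> (0 : R).
Proof.
rewrite (_ : phi = fun u => (Num.sqrt (pi *+ 2))^-1 * gauss_fun (u / Num.sqrt 2)); last first.
  apply/funext => u; rewrite phiE /gauss_fun expr_div_n sqr_sqrtr//.
  by rewrite mulNr.
rewrite -[X in _ --> X](mulr0 (Num.sqrt (pi *+ 2))^-1).
apply: cvgMr; apply: (cvg_comp (fun u => u / Num.sqrt 2) (@gauss_fun R)); last exact: cvg_gauss_fun.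
apply: gt0_cvgMly; last exact: cvg_id.
by rewrite invr_gt0 sqrtr_gt0.
Qed.

Let phi_tail (z : R) : 0 <= z ->
  (\int[lam]_(u in `[z, +oo[) (u * phi u)%:E = (phi z)%:E)%E.
Proof.
move=> z0; rewrite (@ge0_continuous_FTC2y _ _ (fun u => - phi u) z 0).
- by rewrite sub0e -EFinN opprK.
- by move=> x zx; rewrite mulr_ge0 ?normal_pdf_ge0// (le_trans z0).
- apply: continuous_subspaceT => x; apply: cvgM; [exact: cvg_id|exact: continuous_phi].
- rewrite -[X in _ --> X]oppr0; apply: (@cvgN _ R^o); exact: cvg_phi.
- by move=> x _; have [] := is_derive_phi x.
- apply: cvg_at_right_filter; apply: (@cvgN _ R^o); exact: continuous_phi.
- by move=> x _; rewrite derive1E; have [_ ->] := is_derive_phi x.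
Qed.

(** By symmetry it suffices to integrate over the half-line. There $u^2\varphi(u)$ is the integral
    of $u\varphi(u)$ over $z\in[0,u]$; after exchanging the integrals, the integral of $u\varphi(u)$
    over $u\ge z$ is $\varphi(z)$, and the total mass of $\varphi$ appears. *)
Lemma integral_gaussian_sqr : (\int[gam]_z (z ^+ 2)%:E = 1)%E.
Proof.
rewrite ge0_integral_normal_prob//; last 2 first.
  by apply/measurable_EFinP; exact: measurable_funX.
  by move=> x; rewrite lee_fin sqr_ge0.
under eq_integral do rewrite -EFinM.
rewrite ge0_symfun_integralT; last 3 first.
- by move=> x; rewrite mulr_ge0 ?sqr_ge0 ?normal_pdf_ge0.
- move=> x; apply: cvgM; last exact: continuous_phi.
  exact: sqr_continuous.
- by move=> x /=; rewrite sqrrN !phiE sqrrN.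
rewrite -(@integral_normal_pdf R 0 1) ge0_symfun_integralT; last 3 first.
- by move=> x; rewrite normal_pdf_ge0.
- exact: continuous_phi.
- by move=> x /=; rewrite !phiE sqrrN.
congr (_ * _)%E.
rewrite (_ : [set x | 0 <= x] = `[0, +oo[%classic :> set R); last first.
  by rewrite set_itvcy.
pose I (x : R) : R := \1_(`[0, +oo[%classic : set R) x.
have mI : measurable_fun [set: R] I by exact: measurable_indic.
have I0 x : 0 <= I x by rewrite /I indicE.
have IE (x : R) : I x = ((0 <= x)%R)%:R.
  by rewrite /I indicE mem_setE in_itv /= andbT.
(* [u * phi u] restricted to [0 <= z <= u], with [zu] standing for [(z, u)]. *)
pose F (zu : R * R) : \bar R := (I zu.1 * I (zu.2 - zu.1) * (zu.2 * phi zu.2))%:E.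
have F0 zu : (0 <= F zu)%E.
  rewrite lee_fin /F !IE; have [z0|_] := leP 0 zu.1; last by rewrite !mul0r.
  rewrite subr_ge0; have [zu12|_] := leP zu.1 zu.2; last by rewrite mulr0 mul0r.
  by rewrite !mul1r mulr_ge0 ?normal_pdf_ge0// (le_trans z0).
have mF : measurable_fun [set: R * R] F.
  apply/measurable_EFinP; apply: measurable_funM.
    apply: measurable_funM; first exact: (measurableT_comp mI).
    by apply: (measurableT_comp mI); exact: measurable_funB.
  apply: measurable_funM => //.
  by apply: (measurableT_comp (measurable_normal_pdf 0 1)).
transitivity (\int[lam]_u \int[lam]_z F (z, u))%E.
  rewrite integral_mkcond; apply: eq_integral => u _; rewrite patchE mem_setE in_itv /= andbT.
  rewrite (_ : (fun z => F (z, u)) = fun z => ((u * phi u) * (\1_(`[0, u] : set R) z))%:E); last first.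
    apply/funext => z; rewrite /F /= !IE indicE mem_setE in_itv /= subr_ge0 mulrC.
    by case: (0 <= z); case: (z <= u); rewrite /= ?mul0r ?mulr0 ?mulr1.
  have [u0|u0] := leP 0 u; last first.
    rewrite integral0_eq// => z _; rewrite indicE mem_setE in_itv /= (_ : _ && _ = false) ?mulr0//.
    by apply/negP => /andP[z0 zu]; move: (le_trans z0 zu); rewrite leNgt u0.
  under [RHS]eq_integral do rewrite EFinM.
  rewrite ge0_integralZl//; last 2 first.
  - by apply/measurable_EFinP; exact: measurable_indic.
  - by rewrite lee_fin mulr_ge0 ?normal_pdf_ge0.
  rewrite integral_indic//= setIT lebesgue_measure_itv /= lte_fin.
  move: u0; rewrite le_eqVlt => /orP[/eqP <-|u0].
    by rewrite ltxx mule0 expr0n mul0r.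
  by rewrite u0 oppr0 adde0 -EFinM; congr EFin; ring.
transitivity (\int[lam]_z \int[lam]_u F (z, u))%E.
  by apply/esym; exact: fubini_tonelli.
rewrite [RHS]integral_mkcond; apply: eq_integral => z _.
rewrite patchE mem_setE in_itv /= andbT.
case: leP => z0; last first.
  by apply: integral0_eq => u _; rewrite /F /= IE leNgt z0 !mul0r.
rewrite -phi_tail// [RHS]integral_mkcond; apply: eq_integral => u _.
rewrite patchE mem_setE in_itv /= andbT /F /= !IE z0 mul1r subr_ge0.
by case: leP; rewrite ?mul1r ?mul0r.
Qed.

Lemma integrable_gaussian_sqr : integrableR gam (fun z => z ^+ 2).
Proof.
apply/integrableP; split; first by apply/measurable_EFinP; exact: measurable_funX.
under eq_integral do rewrite /= ger0_norm ?sqr_ge0//.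
by rewrite integral_gaussian_sqr ltry.
Qed.

Lemma integrable_gaussian : integrableR gam id.
Proof.
apply: (integrableR_le _ _ (integrableRD (integrableR_cst gam 1) integrable_gaussian_sqr)).
  exact: measurable_id.
by move=> z; rewrite ler_norml /=; apply/andP; split; nra.
Qed.

(** The law is invariant under [z |-> -1 * z], so that the mean equals its own opposite. *)
Lemma Rintegral_gaussian_id : \int[gam]_z z = 0.
Proof.
have mN : measurable_fun [set: measurableTypeR R] ((fun z : R => -1 * z) : measurableTypeR R -> measurableTypeR R) by exact: measurable_funM.
have : \int[gam]_z z = \int[gam]_z (-1 * z).
  have mE : measurable_fun [set: measurableTypeR R] (EFin : measurableTypeR R -> \bar R) by apply/measurable_EFinP.
  have iE : integrableR gam (fun z => -1 * z) by exact: (integrableRZ (-1) integrable_gaussian).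
  rewrite /Rintegral -[in RHS](@integral_distribution _ _ _ _ _ gam
    (@mfun_Sub _ _ (measurableTypeR R) (measurableTypeR R) _ (mem_set mN)) _ mE iE).
  congr fine; apply: eq_measure_integral => A mA _.
  have N10 : (-1 : R) != 0 by rewrite oppr_eq0 oner_eq0.
  by rewrite [RHS](normal_prob_scale N10 mA) normrN1.
rewrite RintegralZl//; last exact: integrable_gaussian.
by move: (\int[gam]_z z) => I; lra.
Qed.

End GaussianMoments.

(** * Gaussian vectors given by lists of vectors *)

Section GaussianVector.
Variables (R : realType) (p : nat).
Local Notation gam := (@normal_prob R 0 1).
Local Notation E1 := (measurableTypeR R).
Implicit Types (b t y : 'cV[R]_p) (bs : seq 'cV[R]_p).

Definition gaussian_step b (zy : E1 * mxborel R p 1) : mxborel R p 1 :=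
  (zy.1 : R) *: b + (zy.2 : 'cV_p).

Lemma measurable_line b : measurable_fun [set: E1]
  ((fun z : R => z *: b) : E1 -> mxborel R p 1).
Proof.
apply: measurable_mxborelP => i j; under eq_fun do rewrite mxE.
exact: measurable_funM.
Qed.

Lemma measurable_gaussian_step b : measurable_fun [set: E1 * mxborel R p 1] (gaussian_step b).
Proof.
apply: measurable_mxD; last exact: measurable_snd.
exact: (measurableT_comp (measurable_line b)).
Qed.

(* The law of the sum of the [z_b *: b], for [b] in [bs] and independent standard normal [z_b]. *)
Fixpoint gaussian bs : probability (mxborel R p 1) R :=
  if bs is b :: bs' then
    distribution (gam \x gaussian bs')%E (mfun_Sub (mem_set (measurable_gaussian_step b)))
  else \d_(0 : mxborel R p 1).

(** Averaging turns the recursive product measure into a composition of one-dimensional averages;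
    scaling and iteration are carried out in this form. *)
Lemma average_gaussian bs C g : bounded_lipschitz C g ->
  average (gaussian bs) id g = foldr (fun b => average gam (fun z => z *: b)) g bs.
Proof.
move=> gL; elim: bs => [|b bs IHbs] /=; apply/funext => x; rewrite /average.
  have mg : measurable_fun [set: mxborel R p 1] (EFin \o (fun y : mxborel R p 1 => g (x + (y : 'cV_p)))).
    apply/measurable_EFinP; apply: bounded_lipschitz_measurable.
    exact: bounded_lipschitz_shift x gL.
  by rewrite /Rintegral (integral_dirac _ measurableT mg) diracT mul1e /= addr0.
rewrite -IHbs /average.
have gxL := bounded_lipschitz_shift x gL.
have mg := bounded_lipschitz_measurable gxL.
have mgs := measurableT_comp mg (measurable_gaussian_step b).
have mE : measurable_fun [set: mxborel R p 1] (EFin \o (fun y : mxborel R p 1 => g (x + (y : 'cV_p)))).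
  exact/measurable_EFinP.
have iE : integrableR (gam \x gaussian bs)%E (fun z => g (x + gaussian_step b z)).
  by apply: (@integrable_bounded _ _ _ _ _ C) => // z; exact: gL.1.
rewrite {1}/Rintegral (@integral_distribution _ _ _ _ _ (gam \x gaussian bs)%E
  (mfun_Sub (mem_set (measurable_gaussian_step b))) _ mE iE).
rewrite [LHS](_ : _ = \int[(gam \x gaussian bs)%E]_z g (x + gaussian_step b z))//.
rewrite (@Rintegral_product _ _ _ _ _ _ _ _ C mgs); last by move=> z; exact: gL.1.
by under eq_Rintegral do under eq_Rintegral do rewrite /gaussian_step /= addrA.
Qed.

Definition dotv t y : R := (t^T *m y) 0 0.

Lemma dotvE t y : dotv t y = \sum_i t i 0 * y i 0.
Proof. by rewrite /dotv mxE; apply: eq_bigr => i _; rewrite mxE. Qed.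

Lemma dotvD t y y' : dotv t (y + y') = dotv t y + dotv t y'.
Proof. by rewrite /dotv mulmxDr mxE. Qed.

Lemma dotvZ t c y : dotv t (c *: y) = c * dotv t y.
Proof. by rewrite /dotv -scalemxAr mxE. Qed.

Lemma measurable_dotv t : measurable_fun [set: mxborel R p 1] (dotv t).
Proof.
apply: (eq_measurable_fun (fun y : mxborel R p 1 => \sum_i t i 0 * y i 0)) => [y _|].
  by rewrite dotvE.
apply: measurable_sum => i; apply: measurable_funM => //.
exact: (measurable_coord (Y := id)).
Qed.

(** Each vector of the list contributes an independent one-dimensional normal variable, which the
    convolution formula absorbs into the variance. *)
Lemma gaussian_dotv bs t (B : set R) : measurable B ->
  gaussian bs [set y | B (dotv t y)] =
  gam [set z | B (Num.sqrt (\sum_(b <- bs) dotv t b ^+ 2) * z)].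
Proof.
elim: bs B => [|b bs IHbs] B mB.
  rewrite big_nil sqrtr0 /= diracE.
  have t0 : dotv t 0 = 0 by rewrite /dotv mulmx0 mxE.
  have [B0|nB0] := pselect (B 0).
    have -> : [set z | B (0 * z)] = setT.
      by apply/seteqP; split => // z _ /=; rewrite mul0r.
    by rewrite [RHS]probability_setT mem_set//= t0.
  have -> : [set z | B (0 * z)] = set0.
    by apply/seteqP; split => // z /=; rewrite mul0r.
  by rewrite measure0 memNset//= t0.
rewrite big_cons /= /distribution /pushforward /=.
have mBz (z : R) : measurable [set x : R | B (dotv t b * z + x)].
  rewrite -[X in measurable X]setTI.
  by apply: (_ : measurable_fun _ (fun x : R => dotv t b * z + x)) => //; exact: measurable_funD.
rewrite [LHS](_ : _ = (\int[gam]_z gaussian bs [set y | B (dotv t b * z + dotv t y)%R])%E); last first.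
  rewrite /product_measure1 /=; apply: eq_integral => z _ /=; congr (gaussian bs _).
  apply/seteqP; split => y; rewrite /xsection /= ?inE /= /gaussian_step dotvD dotvZ mulrC//.
under eq_integral => z _ do rewrite (IHbs _ (mBz z)).
rewrite (normal_prob_convolution (dotv t b) _ mB) sqr_sqrtr//.
by apply: sumr_ge0 => b' _; exact: sqr_ge0.
Qed.

Lemma normal1_normal_prob (v : R) (B : set R) : 0 <= v -> measurable B ->
  normal1 0 v B = gam [set z | B (Num.sqrt v * z)].
Proof.
rewrite /normal1 le_eqVlt => /orP[/eqP <-|v0] mB.
  rewrite ltxx sqrtr0 diracE.
  have [B0|nB0] := pselect (B 0).
    have -> : [set z | B (0 * z)] = setT.
      by apply/seteqP; split => // z _ /=; rewrite mul0r.
    by rewrite [RHS]probability_setT mem_set.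
  have -> : [set z | B (0 * z)] = set0.
    by apply/seteqP; split => // z /=; rewrite mul0r.
  by rewrite measure0 memNset.
have s0 : 0 < Num.sqrt v by rewrite sqrtr_gt0.
rewrite v0 -[X in normal_prob 0 X](gtr0_norm s0).
by rewrite -(normal_prob_scale (lt0r_neq0 s0) mB).
Qed.

Definition gram bs : 'M[R]_p := \sum_(b <- bs) b *m b^T.

Lemma gram_quad bs t : (t^T *m gram bs *m t) 0 0 = \sum_(b <- bs) dotv t b ^+ 2.
Proof.
rewrite mulmx_sumr mulmx_suml summxE; apply: eq_bigr => b _.
rewrite mulmxA -mulmxA mxE big_ord1 expr2; congr (_ * _).
by rewrite -[t in LHS]trmxK -trmx_mul mxE.
Qed.

Lemma gaussian_mvnormal bs : is_mvnormal (gaussian bs) 0 (gram bs).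
Proof.
split=> [|t|t B mB].
- rewrite /gram linear_sum /=; apply: eq_bigr => b _.
  by rewrite trmx_mul trmxK.
- by rewrite gram_quad; apply: sumr_ge0 => b _; exact: sqr_ge0.
- rewrite gram_quad mulmx0 mxE normal1_normal_prob//.
    exact: gaussian_dotv.
  by apply: sumr_ge0 => b _; exact: sqr_ge0.
Qed.

Section Moments.
Variables (bs : seq 'cV[R]_p) (t : 'cV[R]_p).
Let s := Num.sqrt (\sum_(b <- bs) dotv t b ^+ 2).

Let md : measurable_fun [set: mxborel R p 1] (dotv t : mxborel R p 1 -> E1).
Proof. exact: measurable_dotv. Qed.

Let ms : measurable_fun [set: E1] ((fun z : R => s * z) : E1 -> E1).
Proof. exact: measurable_funM. Qed.

Let X : {mfun mxborel R p 1 >-> E1} := mfun_Sub (mem_set md).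
Let Z : {mfun E1 >-> E1} := @mfun_Sub _ _ E1 E1 _ (mem_set ms).

Let lawE (A : set E1) : measurable A ->
  distribution (gaussian bs) X A = distribution gam Z A.
Proof. by move=> mA; exact: gaussian_dotv. Qed.

Lemma ge0_integral_gaussian_dotv (f : E1 -> \bar R) :
  measurable_fun [set: E1] f -> (forall x, 0 <= f x)%E ->
  (\int[gaussian bs]_y f (dotv t y) = \int[gam]_z f (s * z)%R)%E.
Proof.
move=> mf f0; transitivity (\int[distribution (gaussian bs) X]_x f x)%E.
  by rewrite (ge0_integral_distribution X mf f0).
rewrite [LHS](eq_measure_integral (distribution gam Z)); last by move=> A mA _; exact: lawE.
by rewrite (ge0_integral_distribution Z mf f0).
Qed.

Let mX2 : measurable_fun [set: mxborel R p 1] (fun y => dotv t y ^+ 2).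
Proof. by apply: measurable_funX; exact: measurable_dotv. Qed.

Let integral_sqr : (\int[gaussian bs]_y (dotv t y ^+ 2)%:E =
  (\sum_(b <- bs) dotv t b ^+ 2)%:E)%E.
Proof.
rewrite (@ge0_integral_gaussian_dotv (fun x : R => (x ^+ 2)%:E)); last 2 first.
- by apply/measurable_EFinP; exact: measurable_funX.
- by move=> x; rewrite lee_fin sqr_ge0.
under eq_integral do rewrite exprMn EFinM.
rewrite ge0_integralZl//.
- rewrite integral_gaussian_sqr mule1 sqr_sqrtr// sumr_ge0// => b _; exact: sqr_ge0.
- by apply/measurable_EFinP; exact: measurable_funX.
- by move=> z _; rewrite lee_fin sqr_ge0.
- by rewrite lee_fin sqr_ge0.
Qed.

Lemma integrable_gaussian_dotv_sqr : integrableR (gaussian bs) (fun y => dotv t y ^+ 2).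
Proof.
apply/integrableP; split; first exact/measurable_EFinP.
under eq_integral do rewrite /= ger0_norm ?sqr_ge0//.
by rewrite integral_sqr ltry.
Qed.

Lemma Rintegral_gaussian_dotv_sqr :
  \int[gaussian bs]_y (dotv t y ^+ 2) = \sum_(b <- bs) dotv t b ^+ 2.
Proof. by rewrite /Rintegral integral_sqr. Qed.

Lemma integrable_gaussian_dotv : integrableR (gaussian bs) (dotv t).
Proof.
apply: (integrableR_le _ _ (integrableRD (integrableR_cst _ 1) integrable_gaussian_dotv_sqr)).
  exact: measurable_dotv.
by move=> z; move: (dotv t z) => x; rewrite ler_norml /=; apply/andP; split; nra.
Qed.

Lemma Rintegral_gaussian_dotv : \int[gaussian bs]_y dotv t y = 0.
Proof.
have mE : measurable_fun [set: E1] (EFin : E1 -> \bar R) by apply/measurable_EFinP.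
have iX : integrableR (gaussian bs) (dotv t) by exact: integrable_gaussian_dotv.
have iZ : integrableR gam (fun z => s * z) by exact: (integrableRZ s (@integrable_gaussian R)).
transitivity (\int[gam]_z (s * z)); last first.
  by rewrite RintegralZl ?Rintegral_gaussian_id ?mulr0//; exact: integrable_gaussian.
congr fine; transitivity (\int[distribution (gaussian bs) X]_x x%:E)%E.
  by rewrite (@integral_distribution _ _ _ _ _ (gaussian bs) X _ mE iX).
rewrite [LHS](eq_measure_integral (distribution gam Z)); last by move=> A mA _; exact: lawE.
by rewrite (@integral_distribution _ _ _ _ _ gam Z _ mE iZ).
Qed.

End Moments.

Let delta_dotv i y : dotv (delta_mx i 0) y = y i 0.
Proof. by rewrite /dotv trmx_delta -rowE mxE. Qed.

Lemma integrable_gaussian_coord_sqr bs i : integrableR (gaussian bs) (fun y => y i 0 ^+ 2).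
Proof.
have := integrable_gaussian_dotv_sqr bs (delta_mx i 0).
by apply: eq_integrable => // y _ /=; rewrite delta_dotv.
Qed.

Lemma Rintegral_gaussian_coord bs i : \int[gaussian bs]_y (y i 0) = 0.
Proof.
rewrite -[RHS](Rintegral_gaussian_dotv bs (delta_mx i 0)).
by apply: eq_Rintegral => y _; rewrite delta_dotv.
Qed.

(** Polarization, as the known second moments are those of linear forms. The identity [dE] is used a
    second time, from right to left, for every vector of [bs]. *)
Lemma Rintegral_gaussian_coordM bs i j :
  \int[gaussian bs]_y (y i 0 * y j 0) = gram bs i j.
Proof.
have dE y : y i 0 * y j 0 = 2^-1 * (dotv (delta_mx i 0 + delta_mx j 0) y ^+ 2 -
    (dotv (delta_mx i 0) y ^+ 2 + dotv (delta_mx j 0) y ^+ 2)).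
  have -> : dotv (delta_mx i 0 + delta_mx j 0) y = dotv (delta_mx i 0) y + dotv (delta_mx j 0) y.
    by rewrite /dotv linearD /= mulmxDl mxE.
  by rewrite !delta_dotv; field.
under eq_Rintegral do rewrite dE.
have I t := integrable_gaussian_dotv_sqr bs t.
have ID := integrableRD (I (delta_mx i 0)) (I (delta_mx j 0)).
rewrite (RintegralZl _ measurableT (integrableRB (I _) ID)) (RintegralB measurableT (I _) ID).
rewrite (RintegralD measurableT (I _) (I _)) !Rintegral_gaussian_dotv_sqr.
rewrite -big_split /= -sumrB mulr_sumr.
rewrite summxE; apply: eq_bigr => b _.
by rewrite !mxE big_ord1 mxE -dE.
Qed.

End GaussianVector.

(** * Iteration and scaling of Gaussian averages *)

Section GaussianSemigroup.
Variables (R : realType) (p : nat).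
Local Notation gam := (@normal_prob R 0 1).
Local Notation E1 := (measurableTypeR R).
Implicit Types (b x y : 'cV[R]_p) (bs : seq 'cV[R]_p) (C : R).

Definition line_average b := average gam (fun z : R => z *: b).
Definition gaussian_average bs := average (gaussian bs) (id : mxborel R p 1 -> 'cV[R]_p).
Definition scale_seq (c : R) bs : seq 'cV[R]_p := [seq c *: b | b <- bs].

Lemma averaging_line b : averaging (line_average b).
Proof.
by exists _, E1, gam, (fun z : R => z *: b); split => //; exact: measurable_line.
Qed.

Lemma averaging_gaussian bs : averaging (gaussian_average bs).
Proof. by exists _, (mxborel R p 1), (gaussian bs), id; split => //; exact: measurable_id. Qed.

Lemma gaussian_average_cons b bs C g : bounded_lipschitz C g ->
  gaussian_average (b :: bs) g = line_average b (gaussian_average bs g).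
Proof.
by move=> gL; rewrite /gaussian_average (average_gaussian _ gL) /= -(average_gaussian _ gL).
Qed.

Lemma gaussian_average_nil C g : bounded_lipschitz C g -> gaussian_average [::] g = g.
Proof. by move=> gL; rewrite /gaussian_average (average_gaussian _ gL). Qed.

Lemma gaussian_average_cat bs bs' C g : bounded_lipschitz C g ->
  gaussian_average (bs ++ bs') g = gaussian_average bs (gaussian_average bs' g).
Proof.
move=> gL; have gL' := averaging_bounded_lipschitz (averaging_gaussian bs') gL.
elim: bs => [|b bs IHbs] /=; first by rewrite (gaussian_average_nil gL').
by rewrite (gaussian_average_cons _ _ gL) IHbs (gaussian_average_cons _ _ gL').
Qed.

Lemma line_average_convolution (a a' : R) b C g : bounded_lipschitz C g ->
  line_average (a *: b) (line_average (a' *: b) g) =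
  line_average (Num.sqrt (a ^+ 2 + a' ^+ 2) *: b) g.
Proof.
move=> gL; apply/funext => x; rewrite /line_average /average.
set c := Num.sqrt _.
have mh : measurable_fun [set: E1] (fun s : E1 => g (x + (s : R) *: b)).
  exact: measurable_bounded_lipschitz (bounded_lipschitz_shift x gL) (measurable_line b).
have mE : measurable_fun [set: E1] (EFin \o (fun s : E1 => g (x + (s : R) *: b))).
  exact/measurable_EFinP.
have ms : measurable_fun [set: E1 * E1] ((fun z => a * z.1 + a' * z.2) : E1 * E1 -> E1).
  by apply: measurable_funD; exact: measurable_funM.
have mc : measurable_fun [set: E1] ((fun z : R => c * z) : E1 -> E1).
  exact: measurable_funM.
pose S : {mfun (E1 * E1)%type >-> E1} := @mfun_Sub _ _ (E1 * E1)%type E1 _ (mem_set ms).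
pose Z : {mfun E1 >-> E1} := @mfun_Sub _ _ E1 E1 _ (mem_set mc).
have lawE (B : set E1) : measurable B ->
    distribution (gam \x gam)%E S B = distribution gam Z B.
  move=> mB; rewrite [RHS](_ : _ = gam [set z | B (c * z)])//.
  rewrite -(normal_prob_convolution a a' mB) /distribution /pushforward /= /product_measure1.
  apply: eq_integral => z _ /=; congr (gam _).
  by apply/seteqP; split => w; rewrite /xsection /= inE.
have iS : integrableR (gam \x gam)%E (fun z : E1 * E1 => g (x + (a * z.1 + a' * z.2) *: b)).
  apply: (@integrable_bounded _ _ _ _ _ C) => [|z]; last exact: gL.1.
  exact: (measurableT_comp mh ms).
have iZ : integrableR gam (fun z => g (x + (c * z) *: b)).
  apply: (@integrable_bounded _ _ _ _ _ C) => [|z]; last exact: gL.1.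
  exact: (measurableT_comp mh mc).
transitivity (\int[(gam \x gam)%E]_z g (x + (a * z.1 + a' * z.2) *: b)).
  rewrite (@Rintegral_product _ _ _ _ _ _ _ _ C).
  - apply: eq_Rintegral => z _; apply: eq_Rintegral => w _; congr g.
    by rewrite !scalerA -addrA scalerDl mulrC (mulrC w).
  - exact: (measurableT_comp mh ms).
  - by move=> z; exact: gL.1.
transitivity (\int[gam]_z g (x + (c * z) *: b)); last first.
  by apply: eq_Rintegral => z _; rewrite scalerA mulrC.
congr fine.
transitivity (\int[distribution (gam \x gam)%E S]_s (g (x + (s : R) *: b))%:E)%E.
  by rewrite (@integral_distribution _ _ _ _ _ (gam \x gam)%E S _ mE iS).
rewrite [LHS](eq_measure_integral (distribution gam Z)); last by move=> A mA _; exact: lawE.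
by rewrite (@integral_distribution _ _ _ _ _ gam Z _ mE iZ).
Qed.

Lemma iter_line_average (c : R) b n C g : 0 <= c -> bounded_lipschitz C g ->
  iter n (line_average (c *: b)) g = line_average ((c * Num.sqrt n%:R) *: b) g.
Proof.
move=> c0 gL; elim: n => [|n IHn].
  apply/funext => x; rewrite /= sqrtr0 mulr0 scale0r /line_average /average.
  by under eq_Rintegral do rewrite scaler0 addr0; rewrite Rintegral_prob_cst.
rewrite iterS IHn (line_average_convolution _ _ _ gL).
suff -> : Num.sqrt (c ^+ 2 + (c * Num.sqrt n%:R) ^+ 2) = c * Num.sqrt n.+1%:R by [].
rewrite exprMn sqr_sqrtr ?ler0n// -[X in X + _]mulr1 -mulrDr nat1r.
by rewrite sqrtrM ?sqr_ge0// sqrtr_sqr ger0_norm.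
Qed.

Lemma iter_averaging_comp (A B : ('cV[R]_p -> R) -> 'cV[R]_p -> R) C g n :
  averaging A -> averaging B -> bounded_lipschitz C g ->
  iter n (fun h => A (B h)) g = iter n A (iter n B g).
Proof.
move=> aA aB gL; elim: n => //= n ->.
by rewrite -(iter_averagingC n aA aB (iter_bounded_lipschitz n aB gL)).
Qed.

(** As averages commute, the iterates along different vectors can be separated; on each line the
    variances add up, whence the factor [Num.sqrt n%:R]. *)
Lemma iter_gaussian_average (c : R) bs n C g : 0 <= c -> bounded_lipschitz C g ->
  iter n (gaussian_average (scale_seq c bs)) g =
  gaussian_average (scale_seq (c * Num.sqrt n%:R) bs) g.
Proof.
move=> c0 gL; elim: bs => [|b bs IHbs] /=.
  rewrite (gaussian_average_nil gL).
  by elim: n => //= n ->; rewrite (gaussian_average_nil gL).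
rewrite (gaussian_average_cons _ _ gL) -IHbs.
have aB := averaging_gaussian (scale_seq c bs).
rewrite -(iter_line_average b n c0 (iter_bounded_lipschitz n aB gL)).
rewrite -(iter_averaging_comp n (averaging_line (c *: b)) aB gL).
have itL m : bounded_lipschitz C
    (iter m (fun h => line_average (c *: b) (gaussian_average (scale_seq c bs) h)) g).
  elim: m => //= m IHm; apply: (averaging_bounded_lipschitz (averaging_line _)).
  exact: averaging_bounded_lipschitz aB IHm.
by elim: n {IHbs} => //= n ->; exact: gaussian_average_cons (itL n).
Qed.

Let M1 : R := \int[gam]_z `|z|.

Let M1_ge0 : 0 <= M1. Proof. by apply: Rintegral_ge0 => z _. Qed.

Lemma line_average_lipschitz (c c' : R) b C g x : bounded_lipschitz C g ->
  `|line_average (c *: b) g x - line_average (c' *: b) g x| <=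
  C * (`|c - c'| * norm1 b * M1).
Proof.
move=> gL; have C0 : 0 <= C by rewrite (le_trans _ (gL.1 0)).
have ig e := average_integrable gam (measurable_line (e *: b)) x gL.
rewrite /line_average /average -(RintegralB measurableT (ig c) (ig c')).
rewrite (le_trans (le_normr_Rintegral measurableT (integrableRB (ig c) (ig c'))))//.
have iN := integrableR_norm (@integrable_gaussian R).
rewrite [leRHS](_ : _ = \int[gam]_z (C * (`|c - c'| * norm1 b) * `|z|)); last first.
  by rewrite (RintegralZl _ measurableT iN) !mulrA.
apply: le_Rintegral => //.
- exact: (integrableR_norm (integrableRB (ig c) (ig c'))).
- exact: (integrableRZ _ iN).
- move=> z _ /=; rewrite (le_trans (gL.2 _ _))//.
  rewrite opprD addrACA subrr add0r -scalerBr -scalerBl scalerA norm1Z normrM.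
  by rewrite -!mulrA ler_wpM2l// mulrC !mulrA.
Qed.

(** After [n] replacements the scale of the Gaussian vector is only close to its limit; this
    estimate controls the change of the scale. *)
Lemma gaussian_average_lipschitz (c c' : R) bs C g x : bounded_lipschitz C g ->
  `|gaussian_average (scale_seq c bs) g x - gaussian_average (scale_seq c' bs) g x| <=
  C * (`|c - c'| * (\sum_(b <- bs) norm1 b) * M1).
Proof.
move=> gL; have C0 : 0 <= C by rewrite (le_trans _ (gL.1 0)).
elim: bs x => [|b bs IHbs] x.
  by rewrite /= subrr normr0 !mulr_ge0// big_nil.
rewrite /= !(gaussian_average_cons _ _ gL) big_cons.
have gLc e := averaging_bounded_lipschitz (averaging_gaussian (scale_seq e bs)) gL.
rewrite (le_trans (ler_distD (line_average (c *: b) (gaussian_average (scale_seq c' bs) g) x) _ _))//.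
rewrite mulrDr mulrDl mulrDr addrC lerD//; first exact: line_average_lipschitz.
exact: averaging_dist (averaging_line _) (gLc c) (gLc c') IHbs x.
Qed.

End GaussianSemigroup.

(** * Positive semidefinite matrices as Gram matrices *)

Section GramDecomposition.
Variables (R : realType) (p : nat).
Implicit Types (G : 'M[R]_p) (s t : 'cV[R]_p).

Let form G s t : R := (s^T *m G *m t) 0 0.

Let formDl G s s' t : form G (s + s') t = form G s t + form G s' t.
Proof. by rewrite /form linearD /= !mulmxDl mxE. Qed.

Let formZl G a s t : form G (a *: s) t = a * form G s t.
Proof. by rewrite /form linearZ /= -!scalemxAl mxE. Qed.

Let formDr G s t t' : form G s (t + t') = form G s t + form G s t'.
Proof. by rewrite /form !mulmxDr mxE. Qed.

Let formZr G a s t : form G s (a *: t) = a * form G s t.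
Proof. by rewrite /form -!scalemxAr mxE. Qed.

Let formC G s t : G^T = G -> form G s t = form G t s.
Proof.
move=> GT; transitivity ((s^T *m G *m t)^T 0 0); first by rewrite [RHS]mxE.
by rewrite !trmx_mul trmxK GT mulmxA.
Qed.

Let form_delta G i j : form G (delta_mx i 0) (delta_mx j 0) = G i j.
Proof. by rewrite /form trmx_delta -rowE -colE !mxE. Qed.

Let psd G := G^T = G /\ forall t, 0 <= form G t t.

(** If [G i j] were nonzero, the form at $e_i + s e_j$ would be $G_{ii} + 2 s G_{ij}$, which is
    unbounded below; the chosen [s] gives -1. *)
Let psd_diag0 G i j : psd G -> G j j = 0 -> G i j = 0.
Proof.
move=> [GT G0] Gjj; apply/eqP; apply: contraT => Gij.
pose s : R := - (G i i + 1) / (2 * G i j).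
have := G0 (delta_mx i 0 + s *: delta_mx j 0).
rewrite formDl !formDr !formZl !formZr !form_delta Gjj.
rewrite -(form_delta G j i) (formC _ _ GT) form_delta /s.
rewrite [X in 0 <= X](_ : _ = -1); last by field.
by rewrite ler0N1.
Qed.

(** Elimination as in the Cholesky decomposition. Subtracting [b *m b^T], with [b] the [i]-th column
    over the square root of [G i i], makes the [i]-th diagonal entry 0 and keeps those that are 0
    already, so that the induction runs on the number of nonzero diagonal entries. *)
Lemma psd_gram G : G^T = G -> (forall t, 0 <= (t^T *m G *m t) 0 0) ->
  exists bs, G = gram bs.
Proof.
move=> GT G0; have : psd G by []. clear GT G0.
have [k] := ubnP #|[pred i | G i i != 0]|; elim: k => // k IHk in G *.
rewrite ltnS => Gk pG.
have [/existsP[i Gii]|] := boolP [exists i, G i i != 0]; last first.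
  rewrite negb_exists => /forallP G0; exists [::]; rewrite /gram big_nil.
  apply/matrixP => i j; rewrite mxE psd_diag0//.
  by apply/eqP; have := G0 j; rewrite negbK.
have [GT G0] := pG.
have Gii0 : 0 < G i i by rewrite lt_neqAle eq_sym Gii -form_delta G0.
pose b : 'cV[R]_p := (Num.sqrt (G i i))^-1 *: col i G.
have bE j j' : (b *m b^T) j j' = G j i * G j' i / G i i.
  rewrite mxE big_ord1 !mxE mulrACA -invfM -expr2 sqr_sqrtr ?ltW//.
  by rewrite mulrC.
have [bs Gbs] : exists bs, G - b *m b^T = gram bs.
  apply: IHk.
    apply: leq_trans Gk; apply: proper_card; apply/properP; split.
      apply/fintype.subsetP => j; rewrite !inE; apply: contra => /eqP Gjj.
      rewrite mxE [X in _ + X]mxE bE Gjj -(form_delta G j i) (formC _ _ GT) form_delta.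
      by rewrite (psd_diag0 _ pG Gjj) !mul0r subr0.
    exists i; first by rewrite inE.
    by rewrite inE negbK mxE [X in _ + X]mxE bE mulfK// subrr.
  split; first by rewrite linearB /= GT trmx_mul trmxK.
  (* [al] minimizes the form along the direction $e_i$; the minimum is the form of the Schur
     complement, hence nonnegative. *)
  move=> t; pose al := form G (delta_mx i 0) t / G i i.
  have := G0 (t - al *: delta_mx i 0).
  have -> : t - al *: delta_mx i 0 = t + (- al) *: delta_mx i 0 by rewrite scaleNr.
  rewrite formDl !formDr !formZl !formZr form_delta (formC t _ GT).
  move=> H; have -> : form (G - b *m b^T) t t = form G t t - form G (delta_mx i 0) t ^+ 2 / G i i.
    rewrite /form mulmxBr mulmxBl mxE [X in _ + X]mxE; congr (_ - _).
    rewrite mulmxA -mulmxA mxE big_ord1.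
    have -> : (t^T *m b) 0 0 = (b^T *m t) 0 0.
      by rewrite -[t in RHS]trmxK -trmx_mul [RHS]mxE.
    have -> : (b^T *m t) 0 0 = (Num.sqrt (G i i))^-1 * form G (delta_mx i 0) t.
      by rewrite /form trmx_delta -rowE /b linearZ /= -scalemxAl mxE tr_col GT.
    by rewrite mulrACA -invfM -!expr2 sqr_sqrtr ?ltW// mulrC.
  apply: le_trans H _; rewrite le_eqVlt; apply/orP; left; apply/eqP.
  by rewrite /al; field.
by exists (b :: bs); rewrite /gram big_cons -/(gram bs) -Gbs addrC subrK.
Qed.

End GramDecomposition.

(** * B-splines *)

Section TaylorClass.
Variable R : realType.

(** The 7 counts terms of size [C ^+ 2 * m]. For [N <= 1] everything of order below 3 cancels,
    leaving four products and one of weight 3; for [N > 1] the seven terms are estimated separately,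
    each by [C ^+ 2 * N ^+ 2]. *)
Lemma taylor_product_bound (C N m f F L Q h G L' Q' : R) : 0 <= N ->
  m = Num.min (N ^+ 2) (N ^+ 3) ->
  `|f| <= C -> `|F| <= C -> `|h| <= C -> `|G| <= C ->
  `|L| <= C * N -> `|L'| <= C * N -> `|Q| <= C * N ^+ 2 -> `|Q'| <= C * N ^+ 2 ->
  `|F - f - L - Q| <= C * m -> `|G - h - L' - Q'| <= C * m ->
  `|F * G - f * h - (f * L' + h * L) - (f * Q' + h * Q + L * L')| <= 7 * C ^+ 2 * m.
Proof.
move=> N0 mE fC FC hC GC LC L'C QC Q'C rF rG.
have C0 : 0 <= C by rewrite (le_trans _ fC).
have prod (a b A B : R) : `|a| <= A -> `|b| <= B -> `|a * b| <= A * B.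
  by move=> aA bB; rewrite normrM ler_pM.
have [N1|N1] := leP N 1.
  have mN : m = N ^+ 3.
    by rewrite mE; apply/min_idPr; rewrite exprS ler_piMl ?exprn_ge0.
  set r := F - f - L - Q in rF; set r' := G - h - L' - Q' in rG.
  have -> : F * G - f * h - (f * L' + h * L) - (f * Q' + h * Q + L * L') =
    F * r' + L * Q' + Q * L' + Q * Q' + r * (h + L' + Q') by rewrite /r /r'; ring.
  have NN : N ^+ 2 * N ^+ 2 <= N ^+ 3.
    by rewrite -exprD [leLHS]exprS ler_piMl ?exprn_ge0.
  have C20 : 0 <= C ^+ 2 by exact: sqr_ge0.
  have b1 := prod _ _ _ _ FC rG; have b2 := prod _ _ _ _ LC Q'C.
  have b3 := prod _ _ _ _ QC L'C; have b4 := prod _ _ _ _ QC Q'C.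
  have b5 : `|r * (h + L' + Q')| <= C * m * (C * 3).
    apply: prod => //; have := ler_normD (h + L') Q'.
    have N21 : N ^+ 2 <= 1 by rewrite exprn_ile1.
    have : `|h + L'| <= `|h| + `|L'| by exact: ler_normD.
    have h1 : C * N <= C by rewrite ler_piMr.
    have h2 : C * N ^+ 2 <= C by rewrite ler_piMr.
    lra.
  rewrite mN in b1 b5 *.
  have b4' : `|Q * Q'| <= C ^+ 2 * N ^+ 3.
    by rewrite (le_trans b4)// mulrACA -expr2 ler_wpM2l.
  have e2 : C * N * (C * N ^+ 2) = C ^+ 2 * N ^+ 3 by ring.
  have e3 : C * N ^+ 2 * (C * N) = C ^+ 2 * N ^+ 3 by ring.
  have e1 : C * (C * N ^+ 3) = C ^+ 2 * N ^+ 3 by ring.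
  have e5 : C * N ^+ 3 * (C * 3) = 3 * (C ^+ 2 * N ^+ 3) by ring.
  rewrite e1 in b1; rewrite e2 in b2; rewrite e3 in b3; rewrite e5 in b5.
  rewrite -mulrA; move: (C ^+ 2 * N ^+ 3) b1 b2 b3 b4' b5 => K b1 b2 b3 b4' b5.
  have t1 := ler_normD (F * r' + L * Q' + Q * L' + Q * Q') (r * (h + L' + Q')).
  have t2 := ler_normD (F * r' + L * Q' + Q * L') (Q * Q').
  have t3 := ler_normD (F * r' + L * Q') (Q * L').
  have t4 := ler_normD (F * r') (L * Q').
  lra.
have mN : m = N ^+ 2.
  by rewrite mE; apply/min_idPl; rewrite [leRHS]exprS ler_peMl ?exprn_ge0// ltW.
have N2 : N <= N ^+ 2 by rewrite ler_eXnr// ltW.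
have N21 : 1 <= N ^+ 2 by rewrite exprn_ege1// ltW.
have b1 := prod _ _ _ _ FC GC; have b2 := prod _ _ _ _ fC hC.
have b3 := prod _ _ _ _ fC L'C; have b4 := prod _ _ _ _ hC LC.
have b5 := prod _ _ _ _ fC Q'C; have b6 := prod _ _ _ _ hC QC.
have b7 := prod _ _ _ _ LC L'C.
rewrite mN.
have t1 := ler_normB (F * G - f * h - (f * L' + h * L)) (f * Q' + h * Q + L * L').
have t2 := ler_normB (F * G - f * h) (f * L' + h * L).
have t3 := ler_normB (F * G) (f * h).
have t4 := ler_normD (f * L') (h * L).
have t5 := ler_normD (f * Q' + h * Q) (L * L').
have t6 := ler_normD (f * Q') (h * Q).
have C20 : 0 <= C ^+ 2 by exact: sqr_ge0.
have c1 : C ^+ 2 <= C ^+ 2 * N ^+ 2 by rewrite ler_peMr.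
have c2 : C ^+ 2 * N <= C ^+ 2 * N ^+ 2 by rewrite ler_wpM2l.
have e1 : C * C = C ^+ 2 by ring.
have e2 : C * (C * N) = C ^+ 2 * N by ring.
have e3 : C * (C * N ^+ 2) = C ^+ 2 * N ^+ 2 by ring.
have e4 : C * N * (C * N) = C ^+ 2 * N ^+ 2 by ring.
rewrite e1 in b1 b2; rewrite e2 in b3 b4; rewrite e3 in b5 b6; rewrite e4 in b7.
rewrite -mulrA.
move: (C ^+ 2 * N ^+ 2) (C ^+ 2 * N) (C ^+ 2) b1 b2 b3 b4 b5 b6 b7 c1 c2 => K K1 K2.
move=> *; lra.
Qed.

(** [D] and [H] stand for the first derivative and half of the second. Only the expansion is
    recorded, uniformly in [s]. *)
Definition taylor1 (C : R) (f : R -> R) :=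
  (forall s, `|f s| <= C) /\
  forall s, exists D H, [/\ `|D| <= C, `|H| <= C &
    forall u, `|f (s + u) - f s - D * u - H * u ^+ 2| <= C * Num.min (`|u| ^+ 2) (`|u| ^+ 3)].

Let pcube (x : R) : R := Num.max x 0 ^+ 3.

(** The cube of the positive part has a Lipschitz second derivative. The four cases are the signs of
    [x] and [x + u]. *)
Let pcube_taylor x u :
  `|pcube (x + u) - pcube x - 3 * Num.max x 0 ^+ 2 * u - 3 * Num.max x 0 * u ^+ 2| <= `|u| ^+ 3.
Proof.
rewrite -normrX /pcube.
have [x0|x0] := lerP 0 x; have [xu0|xu0] := lerP 0 (x + u).
- by rewrite (_ : _ - _ = u ^+ 3) ?lexx//; ring.
- rewrite expr0n /= (_ : _ - _ = u ^+ 3 - (x + u) ^+ 3); last by ring.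
  have u0 : 0 <= - u by lra.
  have y0 : 0 <= - (x + u) by lra.
  have h1 : 0 <= (- (x + u)) ^+ 3 by rewrite exprn_ge0.
  have h2 : (- (x + u)) ^+ 3 <= (- u) ^+ 3 by rewrite lerXn2r// ?nnegrE//; lra.
  have e1 : (x + u) ^+ 3 = - (- (x + u)) ^+ 3 by ring.
  have e2 : u ^+ 3 = - (- u) ^+ 3 by ring.
  rewrite e1 e2; move: ((- (x + u)) ^+ 3) ((- u) ^+ 3) h1 h2 => Y U h1 h2.
  by rewrite !ler0_norm; lra.
- rewrite (_ : _ - _ = (x + u) ^+ 3); last by ring.
  have h1 : 0 <= (x + u) ^+ 3 by rewrite exprn_ge0.
  have h2 : (x + u) ^+ 3 <= u ^+ 3 by rewrite lerXn2r// ?nnegrE//; lra.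
  by rewrite !ger0_norm// (le_trans h1).
- by rewrite (_ : _ - _ = 0) ?normr0//; ring.
Qed.

Let ppart (x : R) : R := Num.max x 0.

Let ppart_id x : 0 <= x -> ppart x = x. Proof. by move=> x0; apply/max_idPl. Qed.

Let ppart_0 x : x <= 0 -> ppart x = 0. Proof. by move=> x0; apply/max_idPr. Qed.

(* The distribution function of the quadratic B-spline on [0, 3]. *)
Definition smooth_step (x : R) : R :=
  (pcube x - 3 * pcube (x - 1) + 3 * pcube (x - 2) - pcube (x - 3)) / 6.

(** The cubic B-spline on [0, 4]. Written as a difference of shifted steps, its integer translates
    have a telescoping sum. *)
Definition bump (x : R) : R := smooth_step x - smooth_step (x - 1).

Lemma smooth_step_eq0 x : x <= 0 -> smooth_step x = 0.
Proof.
move=> x0; rewrite /smooth_step /pcube -!/(ppart _) !ppart_0; last 4 first.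
all: try lra.
all: by field.
Qed.

Lemma smooth_step_eq1 x : 3 <= x -> smooth_step x = 1.
Proof.
move=> x3; rewrite /smooth_step /pcube -!/(ppart _) !ppart_id; last 4 first.
all: try lra.
all: by field.
Qed.

Lemma smooth_step_ge0_le1 x : 0 <= smooth_step x <= 1.
Proof.
have [x0|x0] := leP x 0; first by rewrite smooth_step_eq0// lexx ler01.
have [x3|x3] := leP 3 x; first by rewrite smooth_step_eq1// ler01 lexx.
rewrite /smooth_step /pcube -!/(ppart _) (ppart_id (ltW x0)).
rewrite (@ppart_0 (x - 3)); last lra.
have [x1|x1] := leP x 1.
  rewrite (@ppart_0 (x - 1)) ?(@ppart_0 (x - 2)); [|lra..].
  have a0 : 0 <= x ^+ 3 by rewrite exprn_ge0 ?ltW.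
  have a1 : x ^+ 3 <= 1 by rewrite exprn_ile1// ltW.
  by apply/andP; split; lra.
have [x2|x2] := leP x 2.
  rewrite (@ppart_id (x - 1)) ?(@ppart_0 (x - 2)); [|lra..].
  pose t := x - 1; have -> : x = t + 1 by rewrite /t; ring.
  have t0 : 0 <= t by rewrite /t; lra.
  have t1 : t <= 1 by rewrite /t; lra.
  rewrite !addrK; have a0 : 0 <= t ^+ 3 by rewrite exprn_ge0.
  have a1 : t ^+ 3 <= t by rewrite exprS ler_piMr// exprn_ile1.
  have a2 : t ^+ 2 <= t by rewrite exprS ler_piMr// exprn_ile1.
  have a3 : 0 <= t ^+ 2 by rewrite sqr_ge0.
  (* Expands to [1 - 3 t^2 + 2 t^3]; the linear bounds on the separate powers of [t] do not imply
     the upper bound 1. *)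
  have a4 : 0 <= (1 - t) ^+ 2 * (1 + 2 * t) by rewrite mulr_ge0 ?sqr_ge0//; lra.
  by apply/andP; split; lra.
rewrite (@ppart_id (x - 1)) ?(@ppart_id (x - 2)); [|lra..].
pose t := 3 - x; have -> : x = 3 - t by rewrite /t; ring.
have t0 : 0 <= t by rewrite /t; lra.
have t1 : t <= 1 by rewrite /t; lra.
have a0 : 0 <= t ^+ 3 by rewrite exprn_ge0.
have a1 : t ^+ 3 <= 1 by rewrite exprn_ile1.
by apply/andP; split; lra.
Qed.

Lemma bump_eq0 x : x <= 0 \/ 4 <= x -> bump x = 0.
Proof.
by rewrite /bump => -[x0|x4]; [rewrite !smooth_step_eq0|rewrite !smooth_step_eq1];
  rewrite ?subrr//; lra.
Qed.

Lemma bump_ge0 x : 0 <= bump x.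
Proof.
have [x0|x0] := leP x 0; first by rewrite bump_eq0//; left.
have [x1|x1] := leP x 1.
  by rewrite /bump (@smooth_step_eq0 (x - 1)) ?subr0; [case/andP: (smooth_step_ge0_le1 x)|lra].
have [x3|x3] := leP 3 x.
  rewrite /bump smooth_step_eq1// subr_ge0.
  by case/andP: (smooth_step_ge0_le1 (x - 1)).
rewrite /bump /smooth_step /pcube -!/(ppart _).
rewrite (@ppart_id x) ?(@ppart_id (x - 1)) ?(@ppart_0 (x - 3)) ?(@ppart_0 (x - 1 - 2)) ?(@ppart_0 (x - 1 - 3)); [|lra..].
have -> : x - 1 - 1 = x - 2 by ring.
have [x2|x2] := leP x 2.
  rewrite (@ppart_0 (x - 2)); [|lra].
  pose t := x - 1; have -> : x = t + 1 by rewrite /t; ring.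
  have t0 : 0 <= t by rewrite /t; lra.
  have t1 : t <= 1 by rewrite /t; lra.
  rewrite !addrK; have a1 : t ^+ 3 <= t by rewrite exprS ler_piMr// exprn_ile1.
  have a2 : 0 <= t ^+ 2 by rewrite sqr_ge0.
  lra.
rewrite (@ppart_id (x - 2)); [|lra].
pose t := 3 - x; have -> : x = 3 - t by rewrite /t; ring.
have t0 : 0 <= t by rewrite /t; lra.
have t1 : t <= 1 by rewrite /t; lra.
have a1 : t ^+ 3 <= t by rewrite exprS ler_piMr// exprn_ile1.
have a2 : 0 <= t ^+ 2 by rewrite sqr_ge0.
lra.
Qed.

(** The constant is 2 + 36 + 12: for increments longer than 1 the two values of the step, the linear
    term and the quadratic term are bounded separately, with [36] and [12] the crude bounds on [D]
    and [H]. For short increments the four cubes contribute only (1 + 3 + 3 + 1) / 6. *)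
Lemma taylor1_smooth_step : taylor1 50 smooth_step.
Proof.
have s01 x : `|smooth_step x| <= 1.
  by have /andP[a b] := smooth_step_ge0_le1 x; rewrite ger0_norm.
split => [x|x]; first by rewrite (le_trans (s01 x))//; lra.
pose D := (ppart x ^+ 2 - 3 * ppart (x - 1) ^+ 2 + 3 * ppart (x - 2) ^+ 2 - ppart (x - 3) ^+ 2) / 2.
pose H := (ppart x - 3 * ppart (x - 1) + 3 * ppart (x - 2) - ppart (x - 3)) / 2.
have [DB HB] : `|D| <= 36 /\ `|H| <= 12.
  (* Beyond 3 both are third differences of polynomials of degree at most 2 and vanish. *)
  rewrite /D /H; have [x3|x3] := leP 3 x.
    rewrite !ppart_id; [|lra..].
    by split; rewrite (_ : _ / 2 = 0) ?normr0//; field.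
  have pb y : y <= 3 -> 0 <= ppart y <= 3.
    by move=> y3; rewrite /ppart le_max lexx orbT ge_max y3 ler0n.
  have pb2 y : y <= 3 -> 0 <= ppart y ^+ 2 <= 9.
    move=> /pb /andP[a b]; rewrite sqr_ge0 /= (_ : 9 = 3 ^+ 2); last by ring.
    by rewrite lerXn2r ?nnegrE.
  have := pb x (ltW x3); have := pb (x - 1); have := pb (x - 2); have := pb (x - 3).
  have := pb2 x (ltW x3); have := pb2 (x - 1); have := pb2 (x - 2); have := pb2 (x - 3).
  move=> a1 a2 a3 a4 b1 b2 b3 b4.
  have /andP[? ?] := a1 ltac:(lra); have /andP[? ?] := a2 ltac:(lra).
  have /andP[? ?] := a3 ltac:(lra); have /andP[? ?] := b1 ltac:(lra).
  have /andP[? ?] := b2 ltac:(lra); have /andP[? ?] := b3 ltac:(lra).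
  have /andP[? ?] := a4; have /andP[? ?] := b4.
  by split; rewrite ler_norml; apply/andP; split; lra.
exists D, H; split; [lra|lra|move=> u].
have [u1|u1] := leP `|u| 1.
  have -> : Num.min (`|u| ^+ 2) (`|u| ^+ 3) = `|u| ^+ 3.
    by apply/min_idPr; rewrite exprS ler_piMl ?exprn_ge0.
  have sh (y : R) : x + u - y = (x - y) + u by ring.
  rewrite /smooth_step !sh.
  have t1 := pcube_taylor x u; have t2 := pcube_taylor (x - 1) u.
  have t3 := pcube_taylor (x - 2) u; have t4 := pcube_taylor (x - 3) u.
  rewrite /D /H /ppart; move: t1 t2 t3 t4; rewrite !ler_norml.
  have u30 : 0 <= `|u| ^+ 3 by rewrite exprn_ge0.
  move: (`|u| ^+ 3) u30 => U U0 /andP[? ?] /andP[? ?] /andP[? ?] /andP[? ?].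
  by apply/andP; split; lra.
have -> : Num.min (`|u| ^+ 2) (`|u| ^+ 3) = `|u| ^+ 2.
  by apply/min_idPl; rewrite [leRHS]exprS ler_peMl ?exprn_ge0// ltW.
have uu : `|u| <= `|u| ^+ 2 by rewrite ler_eXnr// ltW.
have u21 : 1 <= `|u| ^+ 2 by rewrite exprn_ege1// ltW.
have t1 := ler_normB (smooth_step (x + u) - smooth_step x - D * u) (H * u ^+ 2).
have t2 := ler_normB (smooth_step (x + u) - smooth_step x) (D * u).
have t3 := ler_normB (smooth_step (x + u)) (smooth_step x).
have s1 := s01 (x + u); have s2 := s01 x.
have d1 : `|D * u| <= 36 * `|u| ^+ 2 by rewrite normrM ler_pM.
have d2 : `|H * u ^+ 2| <= 12 * `|u| ^+ 2 by rewrite normrM normrX ler_pM.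
lra.
Qed.

Lemma taylor1B C C' f g : taylor1 C f -> taylor1 C' g ->
  taylor1 (C + C') (fun x => f x - g x).
Proof.
move=> [fC fT] [gC gT]; split => [x|x].
  by rewrite (le_trans (ler_normB _ _))// lerD.
have [D [H [DC HC fr]]] := fT x; have [D' [H' [DC' HC' gr]]] := gT x.
exists (D - D'), (H - H'); split.
- by rewrite (le_trans (ler_normB _ _))// lerD.
- by rewrite (le_trans (ler_normB _ _))// lerD.
- move=> u; rewrite (_ : _ - _ = (f (x + u) - f x - D * u - H * u ^+ 2) -
    (g (x + u) - g x - D' * u - H' * u ^+ 2)); last by ring.
  by rewrite (le_trans (ler_normB _ _))// mulrDl lerD.
Qed.

(** The factor [(1 + a) ^+ 3] bounds 1, [a], [a ^+ 2] and [a ^+ 3] together, so that it serves on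
    both sides of the minimum. *)
Lemma taylor1_affine C f a e : 0 <= a -> taylor1 C f ->
  taylor1 (C * (1 + a) ^+ 3) (fun x => f (a * x + e)).
Proof.
move=> a0 [fC fT]; have C0 : 0 <= C by rewrite (le_trans _ (fC 0)).
have a1 : 1 <= 1 + a by rewrite lerDl.
have k1 : 1 <= (1 + a) ^+ 3 by rewrite exprn_ege1.
have ka : a <= (1 + a) ^+ 3.
  by rewrite (@le_trans _ _ (1 + a))// ?lerDr// ler_eXnr.
have k2 : a ^+ 2 <= (1 + a) ^+ 3.
  rewrite (@le_trans _ _ ((1 + a) ^+ 2))//.
    by rewrite lerXn2r ?nnegrE ?addr_ge0// lerDr.
  by rewrite [leRHS]exprS ler_peMl ?sqr_ge0.
have k3 : a ^+ 3 <= (1 + a) ^+ 3 by rewrite lerXn2r ?nnegrE ?addr_ge0// lerDr.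
split => [x|x]; first by rewrite (le_trans (fC _))// ler_peMr.
have [D [H [DC HC fr]]] := fT (a * x + e).
exists (a * D), (a ^+ 2 * H); split.
- by rewrite normrM (ger0_norm a0) mulrC ler_pM.
- by rewrite normrM (ger0_norm (sqr_ge0 _)) mulrC ler_pM// sqr_ge0.
- move=> u; have := fr (a * u).
  rewrite (_ : a * x + e + a * u = a * (x + u) + e); last by ring.
  rewrite (_ : D * (a * u) = a * D * u); last by ring.
  rewrite (_ : H * (a * u) ^+ 2 = a ^+ 2 * H * u ^+ 2); last by ring.
  move=> h; apply: (le_trans h); rewrite -mulrA ler_wpM2l//.
  rewrite normrM !exprMn (ger0_norm a0).
  have [u1|u1] := leP (`|u| ^+ 2) (`|u| ^+ 3).
    by rewrite ge_min ler_wpM2r ?sqr_ge0.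
  by rewrite ge_min (ler_wpM2r _ k3) ?exprn_ge0// orbT.
Qed.

Lemma taylor1_bump : taylor1 (50 + 50 * (1 + 1) ^+ 3) bump.
Proof.
have := taylor1B taylor1_smooth_step (taylor1_affine (-1) ler01 taylor1_smooth_step).
by congr taylor1; apply/funext => x; rewrite mul1r.
Qed.

End TaylorClass.

(** * Test functions with a second order expansion *)

Section Taylor2.
Variables (R : realType) (p : nat).
Implicit Types (g h : 'cV[R]_p -> R) (C : R) (x u D : 'cV[R]_p) (H : 'M[R]_p).

Definition quad H u : R := \sum_i \sum_j H i j * (u i 0 * u j 0).

Definition cubic_cutoff (r : R) : R := Num.min (r ^+ 2) (r ^+ 3).

Definition taylor2 C g :=
  (forall x, `|g x| <= C) /\
  forall x, exists D H, [/\ (forall i, `|D i 0| <= C), (forall i j, `|H i j| <= C) &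
    forall u, `|g (x + u) - g x - dotv D u - quad H u| <= C * cubic_cutoff (norm1 u)].

Lemma norm1_sqr u : norm1 u ^+ 2 = \sum_i \sum_j `|u i 0| * `|u j 0|.
Proof. by rewrite expr2 mulr_suml; apply: eq_bigr => i _; rewrite mulr_sumr. Qed.

Lemma cubic_cutoff_ge0 r : 0 <= r -> 0 <= cubic_cutoff r.
Proof. by move=> r0; rewrite /cubic_cutoff le_min !exprn_ge0. Qed.

Lemma dotv_bound C D u : (forall i, `|D i 0| <= C) -> `|dotv D u| <= C * norm1 u.
Proof.
move=> DC; rewrite dotvE mulr_sumr (le_trans (ler_norm_sum _ _ _))//.
by apply: ler_sum => i _; rewrite normrM ler_wpM2r.
Qed.

Lemma quad_bound C H u : (forall i j, `|H i j| <= C) -> `|quad H u| <= C * norm1 u ^+ 2.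
Proof.
move=> HC; rewrite norm1_sqr mulr_sumr (le_trans (ler_norm_sum _ _ _))//.
apply: ler_sum => i _; rewrite mulr_sumr (le_trans (ler_norm_sum _ _ _))//.
by apply: ler_sum => j _; rewrite !normrM ler_wpM2r// mulr_ge0.
Qed.

Lemma taylor2_ge0 C g : taylor2 C g -> 0 <= C.
Proof. by move=> [gC _]; rewrite (le_trans _ (gC 0)). Qed.

Lemma taylor2_le C C' g : C <= C' -> taylor2 C g -> taylor2 C' g.
Proof.
move=> CC' [gC gT]; split=> [x|x]; first exact: le_trans (gC x) CC'.
have [D [H [DC HC gr]]] := gT x; exists D, H; split.
- by move=> i; exact: le_trans (DC i) CC'.
- by move=> i j; exact: le_trans (HC i j) CC'.
- move=> u; rewrite (le_trans (gr u))// ler_wpM2r//.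
  by rewrite cubic_cutoff_ge0// norm1_ge0.
Qed.

(** For an increment of norm at most 1 the remainder, the linear and the quadratic term are each at
    most [C * norm1 u], whence the 3; for a longer one the bound on [g] gives [2 * C]. *)
Lemma taylor2_bounded_lipschitz C g : taylor2 C g -> bounded_lipschitz (3 * C) g.
Proof.
move=> gT; have C0 := taylor2_ge0 gT; have [gC gx] := gT.
split=> [x|x y]; first by rewrite (le_trans (gC x))// ler_peMl//; lra.
have -> : x = y + (x - y) by rewrite addrC subrK.
move: (x - y) => u {x}; rewrite addrAC subrr add0r.
have N0 := norm1_ge0 u; set N := norm1 u in N0 *.
have [N1|N1] := leP N 1.
  have [D [H [DC HC gr]]] := gx y.
  have := gr u; have := dotv_bound u DC; have := quad_bound u HC; rewrite -/N.
  have mN : C * cubic_cutoff N <= C * N.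
    rewrite ler_wpM2l// /cubic_cutoff ge_min; apply/orP; left.
    by rewrite exprS ler_piMr.
  have NN : C * N ^+ 2 <= C * N by rewrite ler_wpM2l// exprS ler_piMr.
  move=> b1 b2 b3.
  have t1 := ler_normD (g (y + u) - g y - dotv D u - quad H u) (dotv D u + quad H u).
  have t2 := ler_normD (dotv D u) (quad H u).
  have -> : g (y + u) - g y = g (y + u) - g y - dotv D u - quad H u + (dotv D u + quad H u).
    by ring.
  lra.
have t := ler_normB (g (y + u)) (g y).
have a := gC (y + u); have b := gC y.
have : C <= C * N by rewrite ler_peMr// ltW.
lra.
Qed.

Lemma taylor2_cst c : taylor2 `|c| (fun=> c).
Proof.
split=> // x; exists 0, 0; split=> [i|i j|u]; rewrite ?mxE ?normr0//.
rewrite subrr dotvE big1 => [|i _]; last by rewrite mxE mul0r.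
rewrite /quad big1 => [|i _]; last by rewrite big1// => j _; rewrite mxE mul0r.
by rewrite !subr0 normr0 mulr_ge0// cubic_cutoff_ge0// norm1_ge0.
Qed.

Lemma taylor2M C g h : taylor2 C g -> taylor2 C h ->
  taylor2 (7 * C ^+ 2) (fun x => g x * h x).
Proof.
move=> gT hT; have C0 := taylor2_ge0 gT; have [gC gx] := gT; have [hC hx] := hT.
have C20 : 0 <= C ^+ 2 by exact: sqr_ge0.
have prod (a b : R) : `|a| <= C -> `|b| <= C -> `|a * b| <= C ^+ 2.
  by move=> aA bB; rewrite normrM expr2 ler_pM.
split=> [x|x]; first by rewrite (le_trans (prod _ _ (gC x) (hC x)))//; lra.
have [D [H [DC HC gr]]] := gx x; have [D' [H' [DC' HC' hr]]] := hx x.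
(* The product of the two linear parts enters the second order term as [D *m D'^T]. It need not be
   symmetric, as only its quadratic form is used. *)
exists (g x *: D' + h x *: D), (g x *: H' + h x *: H + D *m D'^T); split.
- move=> i; rewrite !mxE.
  have := prod _ _ (gC x) (DC' i); have := prod _ _ (hC x) (DC i).
  have := ler_normD (g x * D' i 0) (h x * D i 0); lra.
- move=> i j; rewrite !mxE big_ord1 mxE.
  have := prod _ _ (gC x) (HC' i j); have := prod _ _ (hC x) (HC i j).
  have := prod _ _ (DC i) (DC' j).
  have := ler_normD (g x * H' i j + h x * H i j) (D i 0 * D' j 0).
  have := ler_normD (g x * H' i j) (h x * H i j); lra.
- move=> u.
  have -> : dotv (g x *: D' + h x *: D) u = g x * dotv D' u + h x * dotv D u.
    rewrite !dotvE !mulr_sumr -big_split /=; apply: eq_bigr => i _.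
    by rewrite !mxE mulrDl !mulrA.
  have -> : quad (g x *: H' + h x *: H + D *m D'^T) u =
      g x * quad H' u + h x * quad H u + dotv D u * dotv D' u.
    have -> : dotv D u * dotv D' u =
        \sum_i \sum_j (D i 0 * u i 0) * (D' j 0 * u j 0).
      by rewrite !dotvE mulr_suml; apply: eq_bigr => i _; rewrite mulr_sumr.
    rewrite /quad !mulr_sumr -!big_split /=; apply: eq_bigr => i _.
    rewrite !mulr_sumr -!big_split /=; apply: eq_bigr => j _.
    by rewrite !mxE big_ord1 !mxE; ring.
  apply: (taylor_product_bound (N := norm1 u)) => //.
  + exact: norm1_ge0.
  + exact: dotv_bound.
  + exact: dotv_bound.
  + exact: quad_bound.
  + exact: quad_bound.
Qed.

Lemma taylor2_coord C f (i : 'I_p) : taylor1 C f -> taylor2 C (fun x => f (x i 0)).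
Proof.
move=> [fC fT]; split=> [x|x]; first exact: fC.
have C0 : 0 <= C by rewrite (le_trans _ (fC 0)).
have [d [h [dC hC fr]]] := fT (x i 0).
exists (d *: delta_mx i 0), (h *: delta_mx i i); split.
- by move=> j; rewrite !mxE eqxx andbT; case: eqP => _; rewrite ?mulr1// mulr0 normr0.
- by move=> j k; rewrite !mxE; case: andP => _; rewrite ?mulr1// mulr0 normr0.
- move=> u.
  have -> : dotv (d *: delta_mx i 0) u = d * u i 0.
    rewrite dotvE (bigD1 i)//= big1 ?addr0 => [|j ji]; first by rewrite !mxE !eqxx mulr1.
    by rewrite !mxE (negbTE ji) mulr0 mul0r.
  have -> : quad (h *: delta_mx i i) u = h * u i 0 ^+ 2.
    rewrite /quad (bigD1 i)//= [X in _ + X]big1 ?addr0 => [|j ji]; last first.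
      by rewrite big1// => k _; rewrite !mxE (negbTE ji) mulr0 mul0r.
    rewrite (bigD1 i)//= big1 ?addr0 => [|j ji]; first by rewrite !mxE !eqxx mulr1 expr2.
    by rewrite !mxE (negbTE ji) andbF mulr0 mul0r.
  rewrite mxE (le_trans (fr (u i 0)))// ler_wpM2l//.
  have uN := coord_le_norm1 u i.
  by rewrite le_min !ge_min !lerXn2r ?nnegrE ?norm1_ge0 ?orbT.
Qed.

Lemma taylor2_prod (I : Type) (s : seq I) (g : I -> 'cV[R]_p -> R) :
  (forall i, exists C, taylor2 C (g i)) ->
  exists C, taylor2 C (fun x => \prod_(i <- s) g i x).
Proof.
move=> gT; elim: s => [|i s [C IHs]].
  by exists `|1|; under eq_fun do rewrite big_nil; exact: taylor2_cst.
have [C' gi] := gT i; exists (7 * Num.max C C' ^+ 2).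
under eq_fun do rewrite big_cons.
by apply: taylor2M; [apply: taylor2_le gi|apply: taylor2_le IHs]; rewrite le_max lexx ?orbT.
Qed.

End Taylor2.

Section LocalExpansion.
Variables (R : realType) (p : nat).
Context d (T : measurableType d).
Variables (mu : probability T R) (Y : T -> mxborel R p 1) (G : 'M[R]_p).
Hypothesis mY : measurable_fun [set: T] Y.
Hypothesis Y2 : forall i, integrableR mu (fun w => Y w i 0 ^+ 2).
Hypothesis Y0 : forall i, \int[mu]_w (Y w i 0) = 0.
Hypothesis YG : forall i j, \int[mu]_w (Y w i 0 * Y w j 0) = G i j.

(** The mean of the cutoff at the scaled vector [c *: Y w], after the factor [c ^+ 2] has been taken
    out. *)
Definition truncated_moment (c : R) :=
  \int[mu]_w Num.min (norm1 (Y w) ^+ 2) (`|c| * norm1 (Y w) ^+ 3).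

Let mYi i : measurable_fun [set: T] (fun w => Y w i 0).
Proof. exact: measurable_coord. Qed.

Let iY i : integrableR mu (fun w => Y w i 0).
Proof.
apply: (integrableR_le _ _ (integrableRD (integrableR_cst mu 1) (Y2 i))) => // w.
by rewrite ler_norml /=; apply/andP; split; nra.
Qed.

Let iYY i j : integrableR mu (fun w => Y w i 0 * Y w j 0).
Proof.
apply: (integrableR_le _ _ (integrableRD (Y2 i) (Y2 j))).
  exact: measurable_funM.
by move=> w; rewrite ler_norml /=; apply/andP; split; nra.
Qed.

Let iN2 : integrableR mu (fun w => norm1 (Y w) ^+ 2).
Proof.
under eq_fun do rewrite norm1_sqr.
apply: integrableR_sum => i; apply: integrableR_sum => j.
have := integrableR_norm (iYY i j).
by apply: eq_integrable => // w _ /=; rewrite normrM.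
Qed.

Let mmin (c : R) : measurable_fun [set: T]
  (fun w => Num.min (norm1 (Y w) ^+ 2) (`|c| * norm1 (Y w) ^+ 3)).
Proof.
have mN := measurable_norm1 mY.
apply: measurable_minr; first exact: measurable_funX.
by apply: measurable_funM => //; exact: measurable_funX.
Qed.

Let min_le (c : R) w :
  `|Num.min (norm1 (Y w) ^+ 2) (`|c| * norm1 (Y w) ^+ 3)| <= norm1 (Y w) ^+ 2.
Proof.
rewrite ger0_norm; first by rewrite ge_min lexx.
by rewrite le_min ?mulr_ge0 ?exprn_ge0 ?norm1_ge0.
Qed.

Let imin (c : R) : integrableR mu
  (fun w => Num.min (norm1 (Y w) ^+ 2) (`|c| * norm1 (Y w) ^+ 3)).
Proof. exact: (integrableR_le (mmin c) (min_le c) iN2). Qed.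

(** Dominated convergence with majorant [norm1 (Y w) ^+ 2]; a third moment may be infinite. *)
Lemma cvg_truncated_moment (c : nat -> R) :
  c m @[m --> \oo] --> 0 -> truncated_moment (c m) @[m --> \oo] --> 0.
Proof.
move=> c0; pose F m w := (Num.min (norm1 (Y w) ^+ 2) (`|c m| * norm1 (Y w) ^+ 3))%:E.
have : (\int[mu]_w F m w @[m --> \oo] --> \int[mu]_w cst 0%E w)%E.
  apply: (@dominated_cvg _ _ _ mu setT measurableT F _ (fun w => (norm1 (Y w) ^+ 2)%:E)).
  - by move=> m; apply/measurable_EFinP; exact: mmin.
  - move=> w _; apply: cvg_EFin; first by near=> m.
    have h : (fun m => `|c m| * norm1 (Y w) ^+ 3) @ \oo --> (0 : R).
      rewrite -[X in _ --> X](mul0r (norm1 (Y w) ^+ 3)); apply: cvgMl.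
      by rewrite -[X in _ --> X](@normr0 R R); apply: cvg_norm.
    apply: (squeeze_cvgr _ (cvg_cst 0) h); near=> m.
    rewrite /F /= le_min ge_min lexx orbT andbT.
    by rewrite ?mulr_ge0 ?exprn_ge0 ?norm1_ge0.
  - by move=> w _.
  - exact: iN2.
  - by move=> m w _; rewrite lee_fin.
rewrite integral0 => /fine_cvg; rewrite /=.
exact.
Unshelve. all: by end_near. Qed.

(** The linear term has mean 0 and the quadratic one depends on the law only through [G], so that
    laws with the same second moments have the same main term. *)
Lemma average_expansion C g (c : R) x D H : taylor2 C g ->
  (forall u, `|g (x + u) - g x - dotv D u - quad H u| <= C * cubic_cutoff (norm1 u)) ->
  `|average mu (fun w => c *: (Y w : 'cV_p)) g x -
    (g x + c ^+ 2 * \sum_i \sum_j H i j * G i j)| <= C * (c ^+ 2 * truncated_moment c).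
Proof.
move=> gT gr; have gL := taylor2_bounded_lipschitz gT.
have mcY : measurable_fun [set: T] ((fun w => c *: (Y w : 'cV_p)) : T -> mxborel R p 1).
  apply: measurable_mxborelP => i j; under eq_fun do rewrite mxE.
  by apply: measurable_funM => //; exact: measurable_coord.
have ig := average_integrable mu mcY x gL.
have ilin : integrableR mu (fun w => dotv D (c *: (Y w : 'cV_p))).
  under eq_fun do rewrite dotvZ dotvE.
  by apply: integrableRZ; apply: integrableR_sum => i; exact: integrableRZ.
have iquad : integrableR mu (fun w => quad H (c *: (Y w : 'cV_p))).
  apply: integrableR_sum => i; apply: integrableR_sum => j; apply: integrableRZ.
  have := integrableRZ (c ^+ 2) (iYY i j); apply: eq_integrable => // w _ /=.
  by rewrite !mxE expr2 mulrACA.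
have lin0 : \int[mu]_w dotv D (c *: (Y w : 'cV_p)) = 0.
  under eq_Rintegral do rewrite dotvZ dotvE.
  have iDY i : integrableR mu (fun w => D i 0 * Y w i 0) by exact: integrableRZ.
  rewrite (RintegralZl _ measurableT (integrableR_sum _ iDY)) (Rintegral_sum _ iDY).
  rewrite big1 ?mulr0// => i _.
  by rewrite (RintegralZl _ measurableT (iY i)) Y0 mulr0.
have quadG : \int[mu]_w quad H (c *: (Y w : 'cV_p)) =
    c ^+ 2 * \sum_i \sum_j H i j * G i j.
  have iHYY i j : integrableR mu (fun w => c ^+ 2 * H i j * (Y w i 0 * Y w j 0)).
    exact: integrableRZ.
  rewrite [LHS](_ : _ = \int[mu]_w \sum_i \sum_j c ^+ 2 * H i j * (Y w i 0 * Y w j 0)).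
    rewrite Rintegral_sum; last by move=> i; exact: integrableR_sum.
    rewrite mulr_sumr; apply: eq_bigr => i _.
    rewrite (Rintegral_sum _ (iHYY i)) mulr_sumr; apply: eq_bigr => j _.
    by rewrite (RintegralZl _ measurableT (iYY i j)) YG mulrA.
  apply: eq_Rintegral => w _; rewrite /quad; apply: eq_bigr => i _; apply: eq_bigr => j _.
  by rewrite !mxE; ring.
have i1 := integrableRB ig (integrableR_cst mu (g x)).
have i2 := integrableRB i1 ilin; have i3 := integrableRB i2 iquad.
have <- : \int[mu]_w (g (x + c *: (Y w : 'cV_p)) - g x - dotv D (c *: (Y w : 'cV_p))
    - quad H (c *: (Y w : 'cV_p))) = average mu (fun w => c *: (Y w : 'cV_p)) g x -
    (g x + c ^+ 2 * \sum_i \sum_j H i j * G i j).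
  rewrite (RintegralB measurableT i2 iquad) (RintegralB measurableT i1 ilin).
  rewrite (RintegralB measurableT ig (integrableR_cst mu (g x))).
  by rewrite Rintegral_prob_cst lin0 quadG subr0 opprD addrA.
rewrite (le_trans (le_normr_Rintegral measurableT i3))//.
rewrite -(RintegralZl _ measurableT (imin c)).
rewrite -(RintegralZl _ measurableT (integrableRZ _ (imin c))).
apply: le_Rintegral => //.
- exact: integrableR_norm.
- by do 2 apply: integrableRZ.
- move=> w _; rewrite (le_trans (gr _))// ler_wpM2l//; first exact: taylor2_ge0 gT.
  rewrite /cubic_cutoff norm1Z !exprMn minr_pMr ?sqr_ge0//.
  by rewrite -(real_normK (num_real c)) [X in _ <= Num.min _ X]mulrA -exprSr.
Qed.

End LocalExpansion.

Section LocalComparison.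
Variables (R : realType) (p : nat).
Context d (T : measurableType d) d' (T' : measurableType d').
Variables (mu : probability T R) (Y : T -> mxborel R p 1).
Variables (mu' : probability T' R) (Y' : T' -> mxborel R p 1) (G : 'M[R]_p).
Hypotheses (mY : measurable_fun [set: T] Y) (mY' : measurable_fun [set: T'] Y').
Hypothesis Y2 : forall i, integrableR mu (fun w => Y w i 0 ^+ 2).
Hypothesis Y0 : forall i, \int[mu]_w (Y w i 0) = 0.
Hypothesis YG : forall i j, \int[mu]_w (Y w i 0 * Y w j 0) = G i j.
Hypothesis Y'2 : forall i, integrableR mu' (fun w => Y' w i 0 ^+ 2).
Hypothesis Y'0 : forall i, \int[mu']_w (Y' w i 0) = 0.
Hypothesis Y'G : forall i j, \int[mu']_w (Y' w i 0 * Y' w j 0) = G i j.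

(** Both averages are expanded with the same [D] and [H]. The second one has the scale [|c|],
    because the scaling of Gaussian averages is stated for nonnegative factors. *)
Lemma average_comparison C g (c : R) x : taylor2 C g ->
  `|average mu (fun w => c *: (Y w : 'cV_p)) g x -
    average mu' (fun w => `|c| *: (Y' w : 'cV_p)) g x| <=
  C * (c ^+ 2 * (truncated_moment mu Y c + truncated_moment mu' Y' c)).
Proof.
move=> gT; have [D [H [_ _ gr]]] := gT.2 x.
have := average_expansion mY Y2 Y0 YG c gT gr.
have := average_expansion mY' Y'2 Y'0 Y'G `|c| gT gr.
have -> : truncated_moment mu' Y' `|c| = truncated_moment mu' Y' c.
  by rewrite /truncated_moment normr_id.
rewrite real_normK ?num_real//.
set b := g x + _ => h1 h2; rewrite (le_trans (ler_distD b _ _))//.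
by rewrite !mulrDr lerD// distrC.
Qed.

End LocalComparison.

Lemma cvg_sum_seq (R : realType) (I : Type) (r : seq I) (f : I -> nat -> R) (l : I -> R) :
  (forall i, f i m @[m --> \oo] --> l i) ->
  \sum_(i <- r) f i m @[m --> \oo] --> \sum_(i <- r) l i.
Proof.
move=> fl; elim: r => [|i r IHr].
  by rewrite big_nil; under eq_fun do rewrite big_nil; exact: cvg_cst.
by rewrite big_cons; under eq_fun do rewrite big_cons; exact: cvgD.
Qed.

Lemma big_ord2 (A : nmodType) (F : 'I_2 -> A) : \sum_i F i = F ord0 + F ord_max.
Proof. by rewrite big_ord_recl big_ord1; congr (_ + F _); exact/val_inj. Qed.

(** * Central limit theorem for two samples *)

Section AveragePairs.
Variables (R : realType) (p : nat).
Implicit Types (A B : ('cV[R]_p -> R) -> 'cV[R]_p -> R).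

Lemma iter_iterC A B C g n m : averaging A -> averaging B ->
  bounded_lipschitz C g -> iter n A (iter m B g) = iter m B (iter n A g).
Proof.
move=> aA aB gL; elim: m => //= m <-.
exact: (iter_averagingC n aA aB (iter_bounded_lipschitz m aB gL)).
Qed.

Lemma iter2_averaging_dist A A' B B' C g e e' n n' x :
  averaging A -> averaging A' -> averaging B -> averaging B' -> bounded_lipschitz C g ->
  (forall y, `|A g y - B g y| <= e) -> (forall y, `|A' g y - B' g y| <= e') ->
  `|iter n A (iter n' A' g) x - iter n B (iter n' B' g) x| <= n%:R * e + n'%:R * e'.
Proof.
move=> aA aA' aB aB' gL Ae A'e.
rewrite (le_trans (ler_distD (iter n A (iter n' B' g) x) _ _))// addrC lerD//.
  rewrite (iter_iterC n n' aA aB' gL) (iter_iterC n n' aB aB' gL).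
  apply: (iter_averaging_dist n' aB' (iter_bounded_lipschitz n aA gL)
    (iter_bounded_lipschitz n aB gL)).
  exact: (iter_averaging_telescope n aA aB gL Ae).
apply: (iter_averaging_dist n aA (iter_bounded_lipschitz n' aA' gL)
  (iter_bounded_lipschitz n' aB' gL)).
exact: (iter_averaging_telescope n' aA' aB' gL A'e).
Qed.

Lemma average_gaussian_scale (c : R) bs C g : bounded_lipschitz C g ->
  average (gaussian bs) (fun y : mxborel R p 1 => c *: (y : 'cV_p)) g =
  gaussian_average (scale_seq c bs) g.
Proof.
move=> gL; apply/funext => x.
have C0 : 0 <= C by rewrite (le_trans _ (gL.1 0)).
(* The recursion for Gaussian averages concerns the identity map, so that the factor [c] is moved
   into the test function and the average is taken at 0. *)
pose gc (y : 'cV[R]_p) := g (x + c *: y).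
have gcL : bounded_lipschitz (C * (1 + `|c|)) gc.
  split=> [y|y y']; first by rewrite (le_trans (gL.1 _))// ler_peMr// lerDl.
  rewrite (le_trans (gL.2 _ _))// opprD addrACA subrr add0r -scalerBr norm1Z.
  by rewrite -mulrA ler_wpM2l// ler_wpM2r ?norm1_ge0// lerDr.
transitivity (gaussian_average bs gc 0).
  by apply: eq_Rintegral => y _; rewrite /gc add0r.
rewrite /gaussian_average (average_gaussian _ gcL) (average_gaussian _ gL).
suff H : foldr (fun b => average (@normal_prob R 0 1) (fun z => z *: b)) gc bs =
    fun u => foldr (fun b => average (@normal_prob R 0 1) (fun z => z *: b)) g
      (scale_seq c bs) (x + c *: u).
  by rewrite H scaler0 addr0.
elim: bs => //= b bs ->; apply/funext => u; apply: eq_Rintegral => z _.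
by rewrite scalerDr addrA !scalerA mulrC.
Qed.

End AveragePairs.

Section TwoSampleCLT.
Context dsp dsp' (Om : measurableType dsp) (E : measurableType dsp') (R : realType).
Variables (P : probability Om R) (X : 'I_2 -> nat -> Om -> E).
Hypothesis mX : forall i k, measurable_fun [set: Om] (X i k).
Hypothesis X_indep : mutually_independent P (fun ik : 'I_2 * nat => X ik.1 ik.2).
Hypothesis X_id : forall i k, identically_distributed P (X i k) (X i 0%N).
Variables (p : nat) (phi : 'I_2 -> E -> mxborel R p 1) (bs : 'I_2 -> seq 'cV[R]_p).
Hypothesis mphi : forall i, measurable_fun [set: E] (phi i).

Let Y i w : mxborel R p 1 := phi i (X i 0 w).

Hypothesis Y2 : forall i j, integrableR P (fun w => Y i w j 0 ^+ 2).
Hypothesis Y0 : forall i j, \int[P]_w (Y i w j 0) = 0.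
Hypothesis YG : forall i j k, \int[P]_w (Y i w j 0 * Y i w k 0) = gram (bs i) j k.
Variables (n : 'I_2 -> nat -> nat) (a : 'I_2 -> nat -> R) (s : 'I_2 -> R).
Hypothesis s_ge0 : forall i, 0 <= s i.
Hypothesis a0 : forall i, a i m @[m --> \oo] --> 0.
Hypothesis na : forall i, (n i m)%:R * a i m ^+ 2 @[m --> \oo] --> s i ^+ 2.

Let mY i : measurable_fun [set: Om] (Y i).
Proof. exact: (measurableT_comp (mphi i)). Qed.

Let A i m := average P (fun w => a i m *: (Y i w : 'cV_p)).
Let B i m := average (gaussian (bs i)) (fun y : mxborel R p 1 => `|a i m| *: (y : 'cV_p)).

Let measurable_scale (c : R) d (T : measurableType d) (Z : T -> mxborel R p 1) :
  measurable_fun [set: T] Z ->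
  measurable_fun [set: T] ((fun w => c *: (Z w : 'cV_p)) : T -> mxborel R p 1).
Proof.
move=> mZ; apply: measurable_mxborelP => i j; under eq_fun do rewrite mxE.
by apply: measurable_funM => //; exact: measurable_coord.
Qed.

Let aA i m : averaging (A i m).
Proof. by exists _, Om, P, (fun w => a i m *: (Y i w : 'cV_p)); split => //; exact: measurable_scale. Qed.

Let aB i m : averaging (B i m).
Proof.
exists _, (mxborel R p 1), (gaussian (bs i)), (fun y => `|a i m| *: (y : 'cV_p)); split => //.
by apply: measurable_scale; exact: measurable_id.
Qed.

(** The weights may be negative: a difference of normalized sums of two samples is of this form. *)
Definition two_sample_sum m w : 'cV[R]_p :=
  \sum_i a i m *: \sum_(k < n i m) (phi i (X i k w) : 'cV_p).

Let index_seq m : seq ('I_2 * nat) :=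
  [seq (ord0, k) | k <- iota 0 (n ord0 m)] ++ [seq (ord_max, k) | k <- iota 0 (n ord_max m)].

Let uniq_index_seq m : uniq (index_seq m).
Proof.
rewrite cat_uniq !map_inj_uniq ?iota_uniq//=; last 2 first.
- by move=> k k' [].
- by move=> k k' [].
rewrite andbT; apply/hasPn => ik /mapP[k _ ->].
by apply/negP => /mapP[k' _ []].
Qed.

Let average_id i k m C g : bounded_lipschitz C g ->
  average P (fun w => a i m *: (phi i (X i k w) : 'cV_p)) g = A i m g.
Proof.
move=> gL; apply/funext => x; rewrite /A /average.
pose h e := g (x + a i m *: (phi i e : 'cV_p)).
have mh : measurable_fun [set: E] h.
  apply: (measurable_bounded_lipschitz (bounded_lipschitz_shift x gL)).
  exact: measurable_scale.
have mE : measurable_fun [set: E] (EFin \o h) by exact/measurable_EFinP.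
have ih j : integrableR P (h \o X i j).
  apply: (@integrable_bounded _ _ _ _ _ C) => [|w]; last exact: gL.1.
  exact: (measurableT_comp mh).
pose XX j : {mfun Om >-> E} := mfun_Sub (mem_set (mX i j)).
congr fine.
transitivity (\int[distribution P (XX k)]_e (h e)%:E)%E.
  by rewrite (@integral_distribution _ _ _ _ _ P (XX k) _ mE (ih k)).
rewrite [LHS](eq_measure_integral (distribution P (XX 0%N))); last first.
  by move=> D mD _; exact: X_id.
by rewrite (@integral_distribution _ _ _ _ _ P (XX 0%N) _ mE (ih 0%N)).
Qed.

Let average_two_sample_sum m C g : bounded_lipschitz C g ->
  average P (two_sample_sum m) g =
  iter (n ord0 m) (A ord0 m) (iter (n ord_max m) (A ord_max m) g).
Proof.
move=> gL.
pose psi (ik : 'I_2 * nat) e : mxborel R p 1 := a ik.1 m *: (phi ik.1 e : 'cV_p).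
have mpsi ik : measurable_fun [set: E] (psi ik) by exact: measurable_scale.
have iotaE q : iota 0 q = index_iota 0 q by rewrite /index_iota subn0.
have -> : two_sample_sum m = fun w => \sum_(ik <- index_seq m) (psi ik (X ik.1 ik.2 w) : 'cV_p).
  apply/funext => w; rewrite /two_sample_sum big_cat !big_map /= big_ord2.
  by rewrite !scaler_sumr; congr (_ + _); rewrite iotaE big_mkord.
rewrite (average_sum_independent (fun ik => mX ik.1 ik.2) X_indep mpsi (uniq_index_seq m) gL).
rewrite foldr_cat !foldr_map /=.
have iterE i h : bounded_lipschitz C h -> forall t,
    foldr (fun k => average P (fun w => a i m *: (phi i (X i k w) : 'cV_p))) h t =
    iter (size t) (A i m) h.
  move=> hL; elim => //= k t ->.
  by rewrite (average_id _ _ _ (iter_bounded_lipschitz _ (aA i m) hL)).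
rewrite (iterE ord_max g gL) size_iota (iterE ord0) ?size_iota//.
exact: iter_bounded_lipschitz.
Qed.

(** The sum is compared with a Gaussian vector of the scales [t i m] by successive replacement, and
    this vector with the limit by changing the scales to [s i]. *)
Theorem two_sample_clt_taylor2 C g : taylor2 C g ->
  \int[P]_w g (two_sample_sum m w) @[m --> \oo] -->
  \int[gaussian (scale_seq (s ord0) (bs ord0) ++ scale_seq (s ord_max) (bs ord_max))]_y g y.
Proof.
move=> gT; have gL := taylor2_bounded_lipschitz gT; set K := 3 * C in gL.
have C0 := taylor2_ge0 gT.
have K0 : 0 <= K by rewrite mulr_ge0.
(* The scale that [n i m] Gaussian steps of size [|a i m|] produce; its square is
   [(n i m)%:R * a i m ^+ 2], which tends to [s i ^+ 2]. *)
pose t i m := `|a i m| * Num.sqrt (n i m)%:R.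
pose rho i m := truncated_moment P (Y i) (a i m) +
  truncated_moment (gaussian (bs i)) (id : mxborel R p 1 -> _) (a i m).
(* [e] is the cost of all replacements, small since [rho] tends to 0 while $n a^2$ converges; [e']
   below is the cost of changing the scales. *)
pose e m := \sum_i C * ((n i m)%:R * a i m ^+ 2 * rho i m).
pose M : R := \int[@normal_prob R 0 1]_z `|z|.
pose e' m := \sum_i K * (`|t i m - s i| * (\sum_(b <- bs i) norm1 b) * M).
have bound m : `|\int[P]_w g (two_sample_sum m w) -
    \int[gaussian (scale_seq (s ord0) (bs ord0) ++ scale_seq (s ord_max) (bs ord_max))]_y g y|
    <= e m + e' m.
  have -> : \int[P]_w g (two_sample_sum m w) = average P (two_sample_sum m) g 0.
    by apply: eq_Rintegral => w _; rewrite add0r.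
  set bb := _ ++ _; have -> : \int[gaussian bb]_y g y = gaussian_average bb g 0.
    by apply: eq_Rintegral => y _; rewrite add0r.
  rewrite (average_two_sample_sum m gL) /bb (gaussian_average_cat _ _ gL).
  pose Z i := iter (n i m) (B i m).
  have BE i h : bounded_lipschitz K h -> B i m h = gaussian_average (scale_seq `|a i m| (bs i)) h.
    exact: average_gaussian_scale.
  have ZE i h : bounded_lipschitz K h -> Z i h = gaussian_average (scale_seq (t i m) (bs i)) h.
    move=> hL; rewrite /t -(iter_gaussian_average _ _ (normr_ge0 _) hL) /Z.
    elim: (n i m) => //= k ->; apply: BE.
    exact: iter_bounded_lipschitz (averaging_gaussian _) hL.
  have ABe i y : `|A i m g y - B i m g y| <= C * (a i m ^+ 2 * rho i m).
    apply: (average_comparison (mY i) (@measurable_id _ _ _) (Y2 i) (Y0 i) (YG i)) => //.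
    - by move=> j; exact: integrable_gaussian_coord_sqr.
    - by move=> j; exact: Rintegral_gaussian_coord.
    - by move=> j k; exact: Rintegral_gaussian_coordM.
  rewrite (le_trans (ler_distD (Z ord0 (Z ord_max g) 0) _ _))// lerD//.
    rewrite (le_trans (iter2_averaging_dist _ _ _ (aA _ _) (aA _ _) (aB _ _) (aB _ _) gL
      (ABe ord0) (ABe ord_max)))//.
    rewrite /e big_ord2.
    by rewrite le_eqVlt; apply/orP; left; apply/eqP; ring.
  have gLs i c := averaging_bounded_lipschitz (averaging_gaussian (scale_seq c (bs i))) gL.
  rewrite (ZE ord_max g gL) (ZE ord0 _ (gLs ord_max _)).
  rewrite (le_trans (ler_distD (gaussian_average (scale_seq (s ord0) (bs ord0))
    (gaussian_average (scale_seq (t ord_max m) (bs ord_max)) g) 0) _ _))//.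
  rewrite /e' big_ord2.
  apply: lerD; first exact: gaussian_average_lipschitz.
  apply: (averaging_dist (averaging_gaussian _) (gLs ord_max _) (gLs ord_max _)) => y.
  exact: gaussian_average_lipschitz.
have rho0 i : rho i m @[m --> \oo] --> 0.
  rewrite -[X in _ --> X]addr0; apply: cvgD.
    exact: (cvg_truncated_moment (mY i) (Y2 i)).
  apply: (cvg_truncated_moment (@measurable_id _ _ _)) => // j.
  exact: integrable_gaussian_coord_sqr.
have ts i : t i m @[m --> \oo] --> s i.
  have -> : t i = fun m => Num.sqrt ((n i m)%:R * a i m ^+ 2).
    by apply/funext => m; rewrite sqrtrM// sqrtr_sqr mulrC.
  rewrite -[X in _ --> X](ger0_norm (s_ge0 i)) -sqrtr_sqr.
  by apply: continuous_cvg; [exact: sqrt_continuous|exact: na].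
have e0 : e m @[m --> \oo] --> 0.
  rewrite [X in _ --> X](_ : _ = \sum_(i < 2) C * (s i ^+ 2 * 0)); last first.
    by rewrite big1// => i _; rewrite !mulr0.
  apply: cvg_sum_seq => i; apply: cvgMr; exact: cvgM.
have e'0 : e' m @[m --> \oo] --> 0.
  rewrite [X in _ --> X](_ : _ = \sum_(i < 2) K * (`|s i - s i| * (\sum_(b <- bs i) norm1 b) * M)); last first.
    by rewrite big1// => i _; rewrite subrr normr0 !mul0r mulr0.
  apply: cvg_sum_seq => i; apply: cvgMr; apply: cvgMl; apply: cvgMl.
  by apply: cvg_norm; apply: cvgB => //; exact: cvg_cst.
have ee0 : e m + e' m @[m --> \oo] --> 0.
  by rewrite -[X in _ --> X]addr0; exact: cvgD.
apply/cvgrPdist_le => eps eps0; near=> m.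
rewrite distrC (le_trans (bound m))// (le_trans (ler_norm _))//.
rewrite -[leLHS]normrN -[X in `|X|]sub0r; near: m.
by move/cvgrPdist_le : ee0; apply.
Unshelve. all: by end_near. Qed.

End TwoSampleCLT.

(** * From smooth to bounded continuous test functions *)

Section UniformContinuity.
Variables (R : realType) (p : nat).

Lemma continuous_trmx : continuous (trmx : 'rV[R]_p -> 'cV[R]_p).
Proof.
move=> x; apply/(@cvgrPdist_lt _ _ _ _ (nbhs_filter x)) => /= e e0.
apply/nbhs_ballP; exists e => //= y; rewrite mx_norm_ball /= => xy.
apply: mx_norm_ltP => // i j; rewrite !mxE.
by have := le_mx_norm_coord (x - y) j i; rewrite !mxE => /le_lt_trans; exact.
Qed.

Lemma compact_box (L : R) : compact [set x : 'cV[R]_p | forall j, `|x j 0| <= L].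
Proof.
have -> : [set x : 'cV[R]_p | forall j, `|x j 0| <= L] =
    trmx @` [set v : 'rV[R]_p | forall i, `[- L, L]%classic (v ord0 i)].
  apply/seteqP; split=> [x xL|_ [v vL <-] j].
    exists x^T; last by rewrite trmxK.
    by move=> i; rewrite /= in_itv /= mxE -ler_norml.
  by have := vL j; rewrite /= in_itv /= mxE -ler_norml.
apply: continuous_compact.
  by apply: continuous_subspaceT; exact: continuous_trmx.
by apply: (@rV_compact _ _ (fun=> `[- L, L]%classic)) => _; exact: segment_compact.
Qed.

(** The Heine-Cantor argument, with only [x] confined to the compact box: the property handed to the
    covering form of compactness quantifies over all [y]. *)
Lemma continuous_box_uniform (f : 'cV[R]_p -> R) (L e : R) : continuous f -> 0 < e ->
  exists2 del, 0 < del & forall x y : 'cV[R]_p, (forall j, `|x j 0| <= L) ->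
    (forall j, `|x j 0 - y j 0| < del) -> `|f x - f y| <= e.
Proof.
move=> cf e0.
have /compact_near_coveringP/(_ _ (0 : R)^'+ (fun (del : R) (x : 'cV[R]_p) => forall y : 'cV[R]_p,
  (forall j, `|x j 0 - y j 0| < del) -> `|f x - f y| <= e)) := @compact_box L.
case=> [x xL|del /= del0 H].
- have e20 : 0 < e / 2 by rewrite divr_gt0.
  have /(@cvgrPdist_lt _ _ _ _ (nbhs_filter x)) /(_ _ e20) := cf x.
  move=> /nbhs_ballP[r /= r0 fr].
  have r20 : 0 < r / 2 by rewrite divr_gt0.
  (* Half of the radius for [x'] and half for the step from [x'] to [y], so that [y] stays in the
     ball of radius [r]. *)
  exists (ball x (r / 2), [set del | del < r / 2]) => /=.
    split; first exact: nbhsx_ballx.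
    exact: nbhs_right_lt.
  move=> [x' del] [/= xx' delr] y x'y.
  have fx' : `|f x - f x'| < e / 2.
    by apply: fr; apply: le_ball xx'; rewrite ler_pdivrMr// ler_pMr// ler1n.
  have fy : `|f x - f y| < e / 2.
    apply: fr; move: xx'; rewrite mx_norm_ball /= => xx'.
    apply: mx_norm_ltP => // j k; rewrite !mxE ord1.
    have := le_mx_norm_coord (x - x') j 0; rewrite !mxE => h1; have h2 := x'y j.
    rewrite (le_lt_trans (ler_distD (x' j 0) _ _))// [ltRHS]splitr ltrD//.
      exact: le_lt_trans h1 xx'.
    exact: lt_trans h2 delr.
  rewrite (le_trans (ler_distD (f x) _ _))// [leRHS]splitr lerD ?(ltW fy)//.
  by rewrite distrC ltW.
- exists (del / 2) => /=; first by rewrite divr_gt0.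
  move=> x y xL xy; apply: (H (del / 2)) => //=.
    rewrite /ball_ /= sub0r normrN gtr0_norm ?divr_gt0//.
    by rewrite ltr_pdivrMr// ltr_pMr// ltr1n.
  by rewrite divr_gt0.
Qed.

End UniformContinuity.

Section PartitionOfUnity.
Variables (R : realType) (p : nat).
Variables (N K : nat).
Local Notation W := (K + K)%N.

(** Bumps on a grid of mesh [1 / N]; the shift by [K] places the [K + K] cells around the origin. *)
Definition cell (i : nat) (x : R) : R := bump (N%:R * x + (K%:R - i%:R)).

Definition cell_prod (c : {ffun 'I_p -> 'I_W}) (x : 'cV[R]_p) : R :=
  \prod_j cell (c j) (x j 0).

(* bump is supported in [0, 4], so that cell i is centred at this point. *)
Definition cell_center (c : {ffun 'I_p -> 'I_W}) : 'cV[R]_p :=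
  \col_j (((c j)%:R - K%:R + 2) / N%:R).

Definition cutoff (x : 'cV[R]_p) : R := \sum_c cell_prod c x.

Lemma sum_cell x : \sum_(i < W) cell i x =
  smooth_step (N%:R * x + K%:R) - smooth_step (N%:R * x - K%:R).
Proof.
have tel (y : R) n : \sum_(i < n) bump (y - i%:R) = smooth_step y - smooth_step (y - n%:R).
  elim: n => [|n IHn]; first by rewrite big_ord0 subr0 subrr.
  by rewrite big_ord_recr /= IHn /bump addrA subrK -addrA -opprD -natr1.
under eq_bigr do rewrite /cell addrA.
by rewrite tel; congr (_ - smooth_step _); rewrite natrD; ring.
Qed.

(** By distributivity, the sum of products over all multi-indices is a product of one-dimensional
    telescoping sums. *)
Lemma cutoffE x : cutoff x = \prod_j (smooth_step (N%:R * x j 0 + K%:R) -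
  smooth_step (N%:R * x j 0 - K%:R)).
Proof.
rewrite /cutoff /cell_prod -(bigA_distr_bigA (fun j (i : 'I_W) => cell i (x j 0))).
by apply: eq_bigr => j _; rewrite sum_cell.
Qed.

Lemma cell_prod_ge0 c x : 0 <= cell_prod c x.
Proof. by apply: prodr_ge0 => j _; exact: bump_ge0. Qed.

Lemma cutoff_ge0 x : 0 <= cutoff x.
Proof. by apply: sumr_ge0 => c _; exact: cell_prod_ge0. Qed.

Lemma cutoff_le1 x : cutoff x <= 1.
Proof.
rewrite cutoffE [leRHS](_ : _ = \prod_(j < p) 1); last by rewrite big1.
apply: ler_prod => j _; apply/andP; split.
  by rewrite -sum_cell sumr_ge0 => // i _; exact: bump_ge0.
have /andP[_ a] := smooth_step_ge0_le1 (N%:R * x j 0 + K%:R).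
have /andP[b _] := smooth_step_ge0_le1 (N%:R * x j 0 - K%:R); lra.
Qed.

(** The margin 3 is the length of the interval on which [smooth_step] rises from 0 to 1. *)
Lemma cutoff_eq1 (x : 'cV[R]_p) : (forall j, N%:R * `|x j 0| + 3 <= K%:R) -> cutoff x = 1.
Proof.
move=> xK; rewrite cutoffE big1// => j _; have := xK j.
have : N%:R * `|x j 0| = `|N%:R * x j 0| by rewrite normrM normr_nat.
move=> -> h; move: (h); have /= := ler_norm (N%:R * x j 0).
have := ler_norm (- (N%:R * x j 0)); rewrite normrN => h1 h2 h3.
rewrite smooth_step_eq1 ?smooth_step_eq0 ?subr0//; lra.
Qed.

Hypothesis N0 : (0 < N)%N.

Lemma cell_support c x j : cell_prod c x != 0 ->
  `|x j 0 - cell_center c j 0| < 2 / N%:R.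
Proof.
move=> /prodf_neq0 /(_ j isT) h.
have NR : 0 < N%:R :> R by rewrite ltr0n.
pose y := N%:R * x j 0 + (K%:R - (c j)%:R).
have y0 : 0 < y by rewrite ltNge; apply: contra h => y0; rewrite /cell bump_eq0//; left.
have y4 : y < 4 by rewrite ltNge; apply: contra h => yle; rewrite /cell bump_eq0//; right.
rewrite mxE ltr_pdivlMr// -{2}(gtr0_norm NR) -normrM mulrBl divfK ?gt_eqF//.
rewrite ltr_norml; apply/andP; split; move: y0 y4; rewrite /y; lra.
Qed.

Lemma cell_center_bound c j : `|cell_center c j 0| <= (K%:R + 2) / N%:R.
Proof.
have NR : 0 < N%:R :> R by rewrite ltr0n.
rewrite mxE normrM [X in _ * X]ger0_norm ?invr_ge0 ?ler0n// ler_wpM2r ?invr_ge0 ?ler0n//.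
have : (c j)%:R < W%:R :> R by rewrite ltr_nat.
have : 0 <= (c j)%:R :> R by rewrite ler0n.
by rewrite natrD ler_norml => a b; apply/andP; split; lra.
Qed.

Lemma taylor2_cell_prod c : exists C, taylor2 C (cell_prod c).
Proof.
apply: taylor2_prod => j; eexists.
apply: (taylor2_coord (f := cell (c j))).
by apply: taylor1_affine (@taylor1_bump R); rewrite ler0n.
Qed.

End PartitionOfUnity.

Section PortmanteauTaylor2.
Context dsp (Om : measurableType dsp) (R : realType).
Variables (P : probability Om R) (p : nat) (Y : nat -> Om -> 'cV[R]_p).
Variable nu : probability (mxborel R p 1) R.
Hypothesis mY : forall m, measurable_fun [set: Om] (Y m : Om -> mxborel R p 1).
Hypothesis Y_taylor2 : forall C g, taylor2 C g ->
  \int[P]_w g (Y m w) @[m --> \oo] --> \int[nu]_x g x.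

Let box (L : nat) : set (mxborel R p 1) := [set x | forall j, `|x j 0| <= L%:R].

Let measurable_box L : measurable (box L).
Proof.
have -> : box L = \bigcap_(j in [set: 'I_p]) [set x : mxborel R p 1 | `|x j 0| <= L%:R].
  by apply/seteqP; split => [x xL j _|x xL j]; [exact: xL|exact: (xL j I)].
apply: fin_bigcap_measurable => // j _.
have mj : measurable_fun [set: mxborel R p 1] (fun x : mxborel R p 1 => `|x j 0|).
  by apply: measurableT_comp => //; exact: (measurable_coord (Y := id)).
have := mj measurableT `]-oo, L%:R]%classic (measurable_itv _).
by rewrite setTI; congr (measurable _); apply/seteqP; split => x /=; rewrite in_itv.
Qed.

(** Continuity from below along the increasing boxes. This concerns the limit law; the mass of the
    laws of [Y m] far away is controlled afterwards through the convergence of the integrals of the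
    cutoff. *)
Let tight_box (e : R) : 0 < e -> exists L, 1 - e <= \int[nu]_x \1_(box L) x.
Proof.
move=> e0.
have UF : \bigcup_L box L = setT.
  apply/seteqP; split => // x _.
  exists (Num.truncn (norm1 (x : 'cV_p))).+1 => // j.
  by rewrite (le_trans (coord_le_norm1 _ _))// ltW// truncnS_gt.
have ndF : nondecreasing_seq box.
  move=> a b ab; apply/subsetPset => x xa j; rewrite (le_trans (xa j))//.
  by rewrite ler_nat.
have := @nondecreasing_cvg_mu _ _ _ nu box measurable_box; rewrite UF => /(_ measurableT ndF).
rewrite [X in _ --> X]probability_setT => /fine_cvg /= /cvgrPdist_lt /(_ e e0) [L _ /(_ L (leqnn _)) /= h].
exists L; rewrite /Rintegral (@integral_indic _ _ _ nu setT measurableT _ (measurable_box L)) setIT.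
move: h; rewrite ltr_norml => /andP[_ h].
by rewrite lerBlDr -lerBlDl ltW.
Qed.

(** [f] is replaced by [g], which interpolates its values at the cell centres and is a finite
    combination of admissible test functions. The error is small where the cutoff [chi] is 1 and at
    most of the order of [1 - chi] elsewhere. *)
Lemma cvg_in_distribution_taylor2 : cvg_in_distribution P Y nu.
Proof.
move=> f cf [M' fM'].
have [M fM] : exists M : R, forall x, `|f x| <= M by exists M'.
have M0 : 0 <= M by rewrite (le_trans _ (fM 0)).
have mf : measurable_fun [set: mxborel R p 1] f by exact: continuous_measurable_mxborel.
have mfY m : measurable_fun [set: Om] (fun w => f (Y m w)).
  exact: (measurableT_comp (f := (f : mxborel R p 1 -> R))).
have bi d (T : measurableType d) (mu : probability T R) (Z : T -> mxborel R p 1) :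
    measurable_fun [set: T] Z -> integrableR mu (fun w => f (Z w)).
  move=> mZ; apply: (@integrable_bounded _ _ _ _ _ M) => //.
  exact: (measurableT_comp (f := (f : mxborel R p 1 -> R))).
have -> : ('E_nu[f] = (\int[nu]_x f x)%:E)%E.
  by rewrite unlock EFin_Rintegral//; exact: (bi _ _ nu id (@measurable_id _ _ _)).
have -> : (fun m => 'E_P[fun w => f (Y m w)])%E = EFin \o (fun m => \int[P]_w f (Y m w)).
  by apply/funext => m; rewrite unlock /= EFin_Rintegral//; exact: bi.
apply: cvg_EFin; first by near=> m.
apply/cvgrPdist_le => e e0.
(* The final estimate adds up to [3 * eta] and [M] times [eta + 2 * eta]: the limit law leaves mass
   at most [eta] outside the cutoff, the law of [Y m] at most twice as much. *)
pose eta : R := e / (3 + 3 * M).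
have eta0 : 0 < eta by rewrite divr_gt0// ltr_wpDr ?mulr_ge0.
have [L nuL] := tight_box eta0.
have [del del0 fdel] := continuous_box_uniform (L%:R + 6) cf eta0.
have [N0 Ndel] : exists N, 2 / N.+1%:R < del.
  have d2 : 0 < del / 2 by rewrite divr_gt0.
  have [N _ /(_ N (leqnn _)) /= h] := near_infty_natSinv_lt (PosNum d2).
  by exists N; rewrite mulrC -ltr_pdivlMr.
(* With this [K] the cutoff is 1 on the box of size [L], and the cell centres lie within
   [(K + 2) / N <= L + 5], inside the box on which [fdel] holds. *)
pose N := N0.+1; pose K := (N * L + 3)%N.
have NR : 0 < N%:R :> R by rewrite ltr0n.
have N1 : 1 <= N%:R :> R by rewrite ler1n.
pose chi : 'cV[R]_p -> R := cutoff N K.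
pose g (x : 'cV[R]_p) := \sum_(c : {ffun 'I_p -> 'I_(K + K)}) f (cell_center R N c) * cell_prod N c x.
have g_chi x : `|f x - g x| <= eta + M * (1 - chi x).
  have -> : f x - g x = f x * (1 - chi x) + \sum_(c : {ffun 'I_p -> 'I_(K + K)}) (f x - f (cell_center R N c)) * cell_prod N c x.
    under [X in _ = _ + X]eq_bigr do rewrite mulrBl.
    by rewrite sumrB -mulr_sumr -/(cutoff N K x) -/(chi x) /g; ring.
  have chi01 : 0 <= 1 - chi x by rewrite subr_ge0 cutoff_le1.
  rewrite (le_trans (ler_normD _ _))// addrC lerD//; last first.
    by rewrite normrM (ger0_norm chi01) ler_wpM2r.
  rewrite (le_trans (ler_norm_sum _ _ _))//.
  rewrite (@le_trans _ _ (\sum_(c : {ffun 'I_p -> 'I_(K + K)}) eta * cell_prod N c x))//; last first.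
    by rewrite -mulr_sumr ger_pMr// cutoff_le1.
  apply: ler_sum => c _; rewrite normrM (ger0_norm (cell_prod_ge0 _ _ _)).
  have [->|c0] := eqVneq (cell_prod N c x) 0; first by rewrite !mulr0.
  have sup j := cell_support (ltn0Sn N0) j c0.
  rewrite ler_wpM2r ?cell_prod_ge0// distrC; apply: fdel => j; last first.
    by rewrite distrC (lt_trans (sup j)).
  rewrite (le_trans (cell_center_bound _ _ _ _))// ler_pdivrMr//.
  rewrite /K natrD natrM; move: N1; set n := N%:R; move=> n1.
  have : 0 <= L%:R :> R by [].
  nra.
have cellL (c : {ffun 'I_p -> 'I_(K + K)}) : exists C, bounded_lipschitz C (cell_prod N c : 'cV[R]_p -> R).
  by have [C cT] := taylor2_cell_prod R N c; exists (3 * C); exact: taylor2_bounded_lipschitz.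
have cell_int (c : {ffun 'I_p -> 'I_(K + K)}) d (T : measurableType d) (mu : probability T R) (Z : T -> mxborel R p 1) :
    measurable_fun [set: T] Z -> integrableR mu (fun w => cell_prod N c (Z w)).
  move=> mZ; have [C cL] := cellL c.
  apply: (@integrable_bounded _ _ _ _ _ C) => [|w]; last exact: cL.1.
  exact: measurable_bounded_lipschitz cL mZ.
have g_int d (T : measurableType d) (mu : probability T R) (Z : T -> mxborel R p 1)
    (mZ : measurable_fun [set: T] Z) : integrableR mu (fun w => g (Z w)).
  by apply: integrableR_sum => c; apply: integrableRZ; exact: cell_int.
have chi_int d (T : measurableType d) (mu : probability T R) (Z : T -> mxborel R p 1)
    (mZ : measurable_fun [set: T] Z) : integrableR mu (fun w => chi (Z w)).
  by apply: integrableR_sum => c; exact: cell_int.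
have approx d (T : measurableType d) (mu : probability T R) (Z : T -> mxborel R p 1) :
    measurable_fun [set: T] Z ->
    `|\int[mu]_w f (Z w) - \int[mu]_w g (Z w)| <= eta + M * (1 - \int[mu]_w chi (Z w)).
  move=> mZ; have fi := bi _ _ mu _ mZ; have gi := g_int _ _ mu _ mZ.
  have ci := chi_int _ _ mu _ mZ.
  have c1 := integrableRB (integrableR_cst mu 1) ci.
  have c2 := integrableRD (integrableR_cst mu eta) (integrableRZ M c1).
  rewrite -(RintegralB measurableT fi gi).
  rewrite (le_trans (le_normr_Rintegral measurableT (integrableRB fi gi)))//.
  rewrite -[X in _ <= X + _](Rintegral_prob_cst mu).
  rewrite -[X in _ <= _ + M * (X - _)](Rintegral_prob_cst mu).
  rewrite -(RintegralB measurableT (integrableR_cst mu 1) ci).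
  rewrite -(RintegralZl _ measurableT c1).
  rewrite -(RintegralD measurableT (integrableR_cst mu eta) (integrableRZ M c1)).
  apply: le_Rintegral => //; first exact: (integrableR_norm (integrableRB fi gi)).
have g_cvg : \int[P]_w g (Y m w) @[m --> \oo] --> \int[nu]_x g x.
  have E d (T : measurableType d) (mu : probability T R) (Z : T -> mxborel R p 1)
      (mZ : measurable_fun [set: T] Z) :
      \int[mu]_w g (Z w) = \sum_(c : {ffun 'I_p -> 'I_(K + K)}) f (cell_center R N c) * \int[mu]_w cell_prod N c (Z w).
    rewrite Rintegral_sum => [|c]; last by apply: integrableRZ; exact: cell_int.
    by apply: eq_bigr => c _; rewrite (RintegralZl _ measurableT (cell_int c _ _ mu _ mZ)).
  rewrite (E _ _ nu id (@measurable_id _ _ _)).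
  under eq_fun do rewrite (E _ _ P _ (mY _)).
  apply: cvg_sum_seq => c; apply: cvgMr.
  by have [C cT] := taylor2_cell_prod R N c; exact: Y_taylor2 cT.
have chi_cvg : \int[P]_w chi (Y m w) @[m --> \oo] --> \int[nu]_x chi x.
  have E d (T : measurableType d) (mu : probability T R) (Z : T -> mxborel R p 1)
      (mZ : measurable_fun [set: T] Z) :
      \int[mu]_w chi (Z w) = \sum_(c : {ffun 'I_p -> 'I_(K + K)}) \int[mu]_w cell_prod N c (Z w).
    by rewrite Rintegral_sum => [|c]; last exact: cell_int.
  rewrite (E _ _ nu id (@measurable_id _ _ _)).
  under eq_fun do rewrite (E _ _ P _ (mY _)).
  apply: cvg_sum_seq => c.
  by have [C cT] := taylor2_cell_prod R N c; exact: Y_taylor2 cT.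
have chi_nu : 1 - eta <= \int[nu]_x chi x.
  apply: (le_trans nuL); apply: le_Rintegral => //.
  - exact: (integrable_indic nu (measurable_box L)).
  - exact: (chi_int _ _ nu id (@measurable_id _ _ _)).
  - move=> x _; rewrite indicE; case: (boolP (x \in box L)) => [|_]; last exact: cutoff_ge0.
    rewrite inE => xL; rewrite /chi cutoff_eq1// => j.
    by rewrite /K natrD natrM lerD2r ler_pM2l.
near=> m.
have gm : `|\int[nu]_x g x - \int[P]_w g (Y m w)| <= eta.
  by near: m; move/cvgrPdist_le : g_cvg; apply.
have cm : `|\int[nu]_x chi x - \int[P]_w chi (Y m w)| <= eta.
  by near: m; move/cvgrPdist_le : chi_cvg; apply.
have a1 := approx _ _ nu id (@measurable_id _ _ _).
have a2 := approx _ _ P _ (mY m).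
have eE : e = eta * (3 + 3 * M) by rewrite /eta divfK// gt_eqF// ltr_wpDr ?mulr_ge0.
rewrite eE; move: gm cm a1 a2 chi_nu.
set f1 := \int[nu]_x f x; set f2 := \int[P]_w f (Y m w).
set g1 := \int[nu]_x g x; set g2 := \int[P]_w g (Y m w).
rewrite -/f1 -/g1.
set c1 := \int[nu]_x chi x; set c2 := \int[P]_w chi (Y m w).
move=> gm cm a1 a2 cnu.
have h1 : M * (1 - c1) <= M * eta by rewrite ler_wpM2l// lerBlDr -lerBlDl.
have h2 : M * (1 - c2) <= M * (2 * eta).
  rewrite ler_wpM2l//; move: cm; rewrite ler_norml => /andP[_ cm]; lra.
rewrite (le_trans (ler_distD g1 _ _))// (le_trans (lerD (lexx _) (ler_distD g2 _ _)))//.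
rewrite (distrC g2); lra.
Unshelve. all: by end_near. Qed.

End PortmanteauTaylor2.

(** * Half-vectorization *)

Section Vech.
Variable d : nat.
Local Notation ij := ('I_d * 'I_d)%type.

Definition upper_row (i : 'I_d) : seq ij := [seq (i, k) | k : 'I_d <- enum 'I_d & (i <= k)%N].
(** The index pairs in the order in which [vech] reads a matrix. Statements about positions in
    vectors become statements about this list, which does not depend on the entries. *)
Definition upper_pairs : seq ij := flatten [seq upper_row i | i : 'I_d <- enum 'I_d].
Definition strict_upper_pairs : seq ij := [seq jk : ij <- upper_pairs | (jk.1 < jk.2)%N].

Lemma vech_seqE V (B : 'M[V]_d) : vech_seq B = [seq B jk.1 jk.2 | jk <- upper_pairs].
Proof.
rewrite /vech_seq /allpairs_dep /upper_pairs map_flatten -map_comp; congr flatten.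
by apply: eq_map => i; rewrite /upper_row /= -map_comp.
Qed.

Lemma vechu_seqE V (B : 'M[V]_d) : vechu_seq B = [seq B jk.1 jk.2 | jk <- strict_upper_pairs].
Proof.
rewrite /vechu_seq /allpairs_dep /strict_upper_pairs /upper_pairs filter_flatten map_flatten.
rewrite -!map_comp; congr flatten; apply: eq_map => i; rewrite /upper_row /=.
rewrite filter_map -map_comp -filter_predI; congr map; apply: eq_filter => k /=.
by rewrite andb_idr// => /ltnW.
Qed.

Lemma size_upper_pairs : size upper_pairs = pdim d.
Proof. by rewrite -(size_vech_seq (0 : 'M[nat]_d)) vech_seqE size_map. Qed.

Lemma size_strict_upper_pairs : size strict_upper_pairs = pudim d.
Proof. by rewrite -(size_vechu_seq (0 : 'M[nat]_d)) vechu_seqE size_map. Qed.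

Lemma uniq_upper_pairs : uniq upper_pairs.
Proof.
apply: allpairs_uniq_dep => [|i _|].
- exact: enum_uniq.
- exact: filter_uniq (enum_uniq _).
- by move=> [i k] [i' k'] /= _ _ [-> ->].
Qed.

Lemma mem_upper_pairs (j k : 'I_d) : ((j, k) \in upper_pairs) = (j <= k)%N.
Proof.
apply/flatten_mapP/idP => [[i _ /mapP[k']]|jk].
  by rewrite mem_filter => /andP[ik' _] [-> ->].
exists j; first exact: mem_enum.
by apply/mapP; exists k => //; rewrite mem_filter jk mem_enum.
Qed.

Lemma upper_rowE (i : 'I_d) : upper_row i = [seq (i, k) | k <- drop i (enum 'I_d)].
Proof.
congr map; apply: (inj_map val_inj).
rewrite -(filter_map val (fun k => (i <= k)%N)) map_drop val_enum_ord drop_iota add0n.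
have gen q n : [seq k <- iota 0 (q + n) | (q <= k)%N] = iota q n.
  rewrite iotaD filter_cat add0n (@eq_in_filter _ _ pred0) ?filter_pred0; last first.
    by move=> k; rewrite mem_iota add0n leq0n /= => ki; rewrite leqNgt ki.
  rewrite (@eq_in_filter _ _ predT) ?filter_predT//.
  by move=> k; rewrite mem_iota => /andP[].
by rewrite -(gen i (d - i)%N) subnKC// ltnW.
Qed.

Lemma apos_pred (i : 'I_d) : (apos d i.+1).-1 = (\sum_(k < i) (d - k))%N.
Proof.
rewrite /apos add1n /= big_add1 big_mkord.
by apply: eq_bigr => k _; rewrite subSS.
Qed.

(** The pair [(i, i)] opens row [i], and the rows before it have the lengths [d], [d - 1] and so on,
    whose sum is the 1-based position [apos d i.+1] minus 1. *)
Lemma upper_pairs_apos (i : 'I_d) : exists t s,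
  upper_pairs = t ++ (i, i) :: s /\ size t = (apos d i.+1).-1.
Proof.
rewrite apos_pred; have dE : drop i (enum 'I_d) = i :: drop i.+1 (enum 'I_d).
  by rewrite (drop_nth i) ?size_enum_ord// nth_ord_enum.
rewrite /upper_pairs -(cat_take_drop i (enum 'I_d)) map_cat flatten_cat.
rewrite dE /= upper_rowE dE /=.
eexists _, _; split; first reflexivity.
rewrite size_flatten /shape -map_comp sumnE big_map.
rewrite (eq_bigr (fun j : 'I_d => (d - j)%N)); last first.
  by move=> j _; rewrite /= upper_rowE size_map size_drop size_enum_ord.
rewrite -(big_map val xpredT (fun k => (d - k)%N)) map_take val_enum_ord.
rewrite take_iota (minn_idPl (ltnW (ltn_ord i))).
by rewrite -[RHS](big_mkord xpredT (fun k => (d - k)%N)) /index_iota subn0.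
Qed.

Lemma nth_upper_pairs_apos x0 (i : 'I_d) : nth x0 upper_pairs (apos d i.+1).-1 = (i, i).
Proof. by have [t [s [-> <-]]] := upper_pairs_apos i; rewrite nth_cat ltnn subnn. Qed.

Lemma apos_gt0 k : (0 < apos d k)%N.
Proof. by rewrite /apos. Qed.

Lemma apos_le (i : 'I_d) : (apos d i.+1 <= pdim d)%N.
Proof.
have [t [s [E tE]]] := upper_pairs_apos i.
rewrite -size_upper_pairs E size_cat -(prednK (apos_gt0 _)) -tE /=.
by rewrite addnS ltnS leq_addr.
Qed.

(** Both lists arise from the positions [0, ..., pdim d - 1] by the same filter: as the pairs are
    distinct, a position holds a strictly upper pair exactly when its successor is none of the
    [apos d k]. *)
Lemma nth_bseq x0 l : (l < pudim d)%N ->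
  (0 < nth 0 (Defs.bseq d) l <= pdim d)%N /\
  nth x0 upper_pairs (nth 0 (Defs.bseq d) l).-1 = nth x0 strict_upper_pairs l.
Proof.
move=> ld.
have offdiag m : (m < pdim d)%N ->
    ((nth x0 upper_pairs m).1 < (nth x0 upper_pairs m).2)%N =
    (m.+1 \notin [seq apos d k | k <- iota 1 d]).
  move=> md; case E : (nth x0 upper_pairs m) => [j k] /=.
  have jk : (j <= k)%N by rewrite -mem_upper_pairs -E mem_nth// size_upper_pairs.
  rewrite ltn_neqAle jk andbT; congr (~~ _); apply/eqP/mapP => [jkE|[k' k'd mE]].
    have {}jkE : j = k by exact: val_inj.
    exists j.+1; first by rewrite mem_iota add1n !ltnS leq0n /=.
    rewrite -(prednK (apos_gt0 j.+1)); congr S; apply/eqP.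
    rewrite -(nth_uniq x0 _ _ uniq_upper_pairs) ?size_upper_pairs//; last first.
      by rewrite prednK ?apos_gt0// apos_le.
    by rewrite E nth_upper_pairs_apos jkE.
  move: k'd mE; rewrite mem_iota add1n => /andP[]; case: k' => // k' _; rewrite ltnS => k'd mE.
  have := nth_upper_pairs_apos x0 (Ordinal k'd); rewrite -[apos d _]/(apos d k'.+1) -mE /= E.
  by move=> [-> ->].
have SE : strict_upper_pairs = [seq nth x0 upper_pairs m | m <- iota 0 (pdim d) &
    m.+1 \notin [seq apos d k | k <- iota 1 d]].
  rewrite /strict_upper_pairs -{1}(mkseq_nth x0 upper_pairs) /mkseq filter_map size_upper_pairs.
  congr map; apply: eq_in_filter => m; rewrite mem_iota add0n => /andP[_ md] /=.
  exact: offdiag.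
have BE : Defs.bseq d = [seq m.+1 | m <- iota 0 (pdim d) &
    m.+1 \notin [seq apos d k | k <- iota 1 d]].
  rewrite /Defs.bseq (_ : iota 1 (pdim d) = [seq (1 + m)%N | m <- iota 0 (pdim d)]).
    by rewrite filter_map.
  by rewrite -iotaDl.
set s := [seq m <- iota 0 (pdim d) | _] in SE BE.
have ss : size s = pudim d by rewrite -size_strict_upper_pairs SE size_map.
have sm : nth 0 s l \in s by rewrite mem_nth ?ss.
rewrite BE SE !(nth_map 0) ?ss//; split => //=.
by move: sm; rewrite mem_filter mem_iota add0n => /andP[_ /andP[]].
Qed.

(** An index of the vector shows that the list of pairs is not empty, which supplies the default
    value for [nth]. *)
Lemma inhabited_pair (l : 'I_(pdim d)) : inhabited ij.
Proof.
have : (0 < size upper_pairs)%N by rewrite size_upper_pairs (leq_ltn_trans _ (ltn_ord l)).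
by case: upper_pairs => // x0 s _; exists.
Qed.

Lemma inhabited_pairu (l : 'I_(pudim d)) : inhabited ij.
Proof.
have : (0 < size strict_upper_pairs)%N.
  by rewrite size_strict_upper_pairs (leq_ltn_trans _ (ltn_ord l)).
by case: strict_upper_pairs => // x0 s _; exists.
Qed.

Lemma vech_entry (V : nmodType) (B : 'M[V]_d) x0 (l : 'I_(pdim d)) :
  vech B l 0 = B (nth x0 upper_pairs l).1 (nth x0 upper_pairs l).2.
Proof. by rewrite mxE vech_seqE (nth_map x0)// size_upper_pairs. Qed.

Lemma vechu_entry (V : nmodType) (B : 'M[V]_d) x0 (l : 'I_(pudim d)) :
  vechu B l 0 = B (nth x0 strict_upper_pairs l).1 (nth x0 strict_upper_pairs l).2.
Proof. by rewrite mxE vechu_seqE (nth_map x0)// size_strict_upper_pairs. Qed.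

End Vech.

Section VechMatrices.
Variables (R : rcfType) (d : nat).
Implicit Types (B V : 'M[R]_d).

Let mul_evec (p k : nat) (v : 'cV[R]_p) (kp : (k.-1 < p)%N) : (0 < k)%N ->
  ((evec R k p)^T *m v) 0 0 = v (Ordinal kp) 0.
Proof.
move=> k0; rewrite mxE (bigD1 (Ordinal kp))//= big1 => [|i ik].
  by rewrite !mxE /= prednK// eqxx mul1r addr0.
rewrite !mxE; case: eqP => [E|_]; last by rewrite mul0r.
by move: ik; rewrite -val_eqE /= -E /= eqxx.
Qed.

Let mul_select (m p : nat) (u : 'I_m -> 'cV[R]_p) (v : 'cV[R]_p) l :
  ((\sum_(i < m) evec R i.+1 m *m (u i)^T) *m v) l 0 = ((u l)^T *m v) 0 0.
Proof.
rewrite mulmx_suml summxE (bigD1 l)//= big1 ?addr0 => [|i il].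
  by rewrite -mulmxA mxE big_ord1 mxE eqxx mul1r.
by rewrite -mulmxA mxE big_ord1 mxE eqSS val_eqE eq_sym (negbTE il) mul0r.
Qed.

Lemma Amx_vech B (i : 'I_d) : (Amx R d *m vech B) i 0 = B i i.
Proof.
have ip : ((apos d i.+1).-1 < pdim d)%N by rewrite prednK ?apos_gt0 ?apos_le.
rewrite mul_select (mul_evec _ ip) ?apos_gt0//.
by rewrite (vech_entry B (i, i)) /= nth_upper_pairs_apos.
Qed.

(** When [r] is the vector of correlations of [V], the right-hand side is the differential of
    [V j k / sqrt (V j j * V k k)] in the direction [B]. The terms [B j j / V j j] come from the
    scaling at diagonal positions, where the square root is that of [V j j ^+ 2]. *)
Lemma Mmx_vech V r B (x0 : 'I_d * 'I_d) (l : 'I_(pudim d))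
  (j := (nth x0 (strict_upper_pairs d) l).1) (k := (nth x0 (strict_upper_pairs d) l).2) :
  (forall i, 0 < V i i) ->
  (Mmx V r *m vech B) l 0 = (Num.sqrt (V j j * V k k))^-1 * B j k -
    2^-1 * (r l 0 * (B j j / V j j + B k k / V k k)).
Proof.
move=> V0; rewrite /Mmx -mulmxA mulmxBl.
set w := diag_invsqrt _ *m _.
have wE (q : 'I_(pdim d)) : w q 0 = (Num.sqrt (V (nth x0 (upper_pairs d) q).1 (nth x0 (upper_pairs d) q).1 *
    V (nth x0 (upper_pairs d) q).2 (nth x0 (upper_pairs d) q).2))^-1 *
    B (nth x0 (upper_pairs d) q).1 (nth x0 (upper_pairs d) q).2.
  rewrite /w /diag_invsqrt mul_diag_mx mxE [X in X * _]mxE !(vech_entry _ x0).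
  by congr ((Num.sqrt _)^-1 * _); rewrite mxE big_ord1 !mxE.
have wdiag (i : 'I_d) (ip : ((apos d i.+1).-1 < pdim d)%N) : w (Ordinal ip) 0 = B i i / V i i.
  rewrite wE /= nth_upper_pairs_apos /= -expr2 sqrtr_sqr gtr0_norm//.
  by rewrite mulrC.
rewrite [LHS]mxE [X in _ + X]mxE; congr (_ - _).
  rewrite mul_select.
  have [/andP[b0 bp] bE] := nth_bseq x0 (ltn_ord l).
  have bp' : ((nth 0 (Defs.bseq d) l).-1 < pdim d)%N by rewrite prednK.
  by rewrite (mul_evec _ bp')// wE /= bE.
rewrite -scalemxAl mxE -mulmxA mul_diag_mx mxE [r^T _ _]mxE; congr (_ * (_ * _)).
rewrite mul_select linearD /= mulmxDl mxE !(vechu_entry _ x0).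
have HE a b : Hmx d a b = apos d b.+1 by rewrite mxE.
have HTE a b : (Hmx d)^T a b = apos d a.+1 by rewrite !mxE.
rewrite HE HTE.
have ip (i : 'I_d) : ((apos d i.+1).-1 < pdim d)%N by rewrite prednK ?apos_gt0 ?apos_le.
by rewrite !(mul_evec _ (ip _)) ?apos_gt0// !wdiag addrC.
Qed.

End VechMatrices.

(** * First order expansion of the empirical correlations *)

Section Expansion.
Variables (R : realType) (T : Type) (dom : T -> Prop) (del : T -> R).
Hypothesis del_ge0 : forall t, 0 <= del t.
Hypothesis del_le1 : forall t, dom t -> del t <= 1.

(** A first order expansion with quadratic error, uniform on [dom]. The bound on the linear part [l]
    is included because the product rule multiplies linear parts. *)
Definition expands (F : T -> R) (x : R) (l : T -> R) :=
  exists2 C, 0 <= C & forall t, dom t ->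
    `|F t - x - l t| <= C * del t ^+ 2 /\ `|l t| <= C * del t.

Lemma expandsM F x l G y m : expands F x l -> expands G y m ->
  expands (fun t => F t * G t) (x * y) (fun t => x * m t + y * l t).
Proof.
move=> [C C0 Fx] [C' C'0 Gy].
(* The first three summands bound [l * m], [(x + l) * r'] and [r * (y + m + r')], into which the
   remainder of the product decomposes; the last two bound its linear part. *)
exists (C * C' + (`|x| + C) * C' + C * (`|y| + 2 * C') + `|x| * C' + `|y| * C).
  by do ![apply: addr_ge0 | apply: mulr_ge0 | exact: normr_ge0 | done].
move=> t /[dup] tD /del_le1 d1; have d0 := del_ge0 t.
have [rF lF] := Fx t tD; have [rG mG] := Gy t tD.
set r := F t - x - l t in rF; set r' := G t - y - m t in rG.
have d2 : del t ^+ 2 <= del t by rewrite exprS ler_piMr.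
have d20 : 0 <= del t ^+ 2 by exact: sqr_ge0.
have lC : `|l t| <= C by rewrite (le_trans lF)// ler_piMr.
have mC : `|m t| <= C' by rewrite (le_trans mG)// ler_piMr.
have rC : `|r'| <= C' by rewrite (le_trans rG)// ler_piMr// (le_trans d2).
have prod (a b A B : R) : `|a| <= A -> `|b| <= B -> `|a * b| <= A * B.
  by move=> aA bB; rewrite normrM ler_pM.
split.
  have -> : F t * G t - x * y - (x * m t + y * l t) =
      l t * m t + (x + l t) * r' + r * (y + (m t + r')).
    by rewrite /r /r'; ring.
  have b1 := prod _ _ _ _ lF mG.
  have b2 : `|(x + l t) * r'| <= (`|x| + C) * (C' * del t ^+ 2).
    by apply: prod => //; rewrite (le_trans (ler_normD _ _))// lerD2l.
  have b3 : `|r * (y + (m t + r'))| <= C * del t ^+ 2 * (`|y| + 2 * C').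
    apply: prod => //; have := ler_normD y (m t + r'); have := ler_normD (m t) r'; lra.
  have t1 := ler_normD (l t * m t + (x + l t) * r') (r * (y + (m t + r'))).
  have t2 := ler_normD (l t * m t) ((x + l t) * r').
  have xC : 0 <= `|x| * C' * del t ^+ 2 by rewrite !mulr_ge0.
  have yC : 0 <= `|y| * C * del t ^+ 2 by rewrite !mulr_ge0.
  rewrite (_ : C * del t * (C' * del t) = C * C' * del t ^+ 2) in b1; last by ring.
  rewrite (_ : (`|x| + C) * (C' * del t ^+ 2) = `|x| * C' * del t ^+ 2 + C * C' * del t ^+ 2) in b2; last by ring.
  rewrite (_ : C * del t ^+ 2 * (`|y| + 2 * C') = C * `|y| * del t ^+ 2 + C * (2 * C') * del t ^+ 2) in b3; last by ring.
  lra.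
have b1 := prod _ _ _ _ (lexx `|x|) mG; have b2 := prod _ _ _ _ (lexx `|y|) lF.
have t1 := ler_normD (x * m t) (y * l t).
have p1 : 0 <= (C * C' + (`|x| + C) * C' + C * (`|y| + 2 * C')) * del t.
  by do ![apply: addr_ge0 | apply: mulr_ge0 | exact: normr_ge0 | done].
rewrite mulrDl mulrDl -addrA (le_trans t1)// (le_trans (lerD b1 b2))//.
by rewrite !mulrA lerDr.
Qed.

Lemma expands_ext F F' x x' l l' : (forall t, dom t -> F t = F' t) -> x = x' ->
  (forall t, dom t -> l t = l' t) -> expands F x l -> expands F' x' l'.
Proof.
move=> FF -> ll [C C0 H]; exists C => // t tD.
by rewrite -FF// -ll//; exact: H.
Qed.

Lemma expands_id (h : T -> R) x : (forall t, dom t -> `|h t| <= del t) ->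
  expands (fun t => x + h t) x h.
Proof.
move=> hd; exists 1 => // t tD; rewrite (_ : x + h t - x - h t = 0) ?normr0 ?mul1r; last by ring.
by rewrite sqr_ge0; split => //; exact: hd.
Qed.

(** With [s] and [s0] the square roots of [x + h t] and [x], the remainder is exactly
    [(s - s0)^2 (s + 2 s0) / (2 s0^3 s)]. The condition [del t <= x / 2] keeps [s] between [s0 / 2]
    and [s0 * 2]. *)
Lemma expands_invsqrt (h : T -> R) x : 0 < x ->
  (forall t, dom t -> `|h t| <= del t) -> (forall t, dom t -> del t <= x / 2) ->
  expands (fun t => (Num.sqrt (x + h t))^-1) (Num.sqrt x)^-1
    (fun t => - (2^-1 / (x * Num.sqrt x)) * h t).
Proof.
move=> x0 hd dx; pose s0 := Num.sqrt x.
have s0_gt0 : 0 < s0 by rewrite sqrtr_gt0.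
have xE : x = s0 ^+ 2 by rewrite sqr_sqrtr// ltW.
(* The first summand bounds the remainder, with [s] replaced by its extreme values; the second
   bounds the linear part. *)
pose C := (s0 * 2 + 2 * s0) / (2 * s0 ^+ 3 * (s0 / 2) * s0 ^+ 2) + 2^-1 / (x * s0).
have c1 : 0 <= 2^-1 / (x * s0) by rewrite divr_ge0// mulr_ge0// ltW.
have c2 : 0 <= (s0 * 2 + 2 * s0) / (2 * s0 ^+ 3 * (s0 / 2) * s0 ^+ 2).
  by rewrite divr_ge0 ?addr_ge0 ?mulr_ge0 ?divr_ge0 ?exprn_ge0// ltW.
exists C => [|t tD]; first exact: addr_ge0.
have ht := hd t tD; have dt := dx t tD; have d0 := del_ge0 t.
have hx : `|h t| <= x / 2 by exact: le_trans ht dt.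
have /andP[h1 h2] : - (x / 2) <= h t <= x / 2 by rewrite -ler_norml.
split; last first.
  rewrite normrM normrN (ger0_norm c1) (@le_trans _ _ (2^-1 / (x * s0) * del t))//.
    by rewrite ler_wpM2l.
  by rewrite ler_wpM2r// /C lerDr.
rewrite -/s0; pose s := Num.sqrt (x + h t).
have b0 : 0 < x + h t by lra.
have s_gt0 : 0 < s by rewrite sqrtr_gt0.
have sE : s ^+ 2 = x + h t by rewrite sqr_sqrtr// ltW.
have s_ge : s0 / 2 <= s.
  rewrite -(@ler_pXn2r _ 2) ?nnegrE ?divr_ge0 ?ltW// sE expr_div_n -xE; lra.
have s_le : s <= s0 * 2.
  rewrite -(@ler_pXn2r _ 2) ?nnegrE ?mulr_ge0 ?ltW// sE exprMn -xE; lra.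
have hE : h t = (s - s0) * (s + s0).
  by rewrite -subr_sqr sE -xE addrAC subrr add0r.
rewrite -/s (_ : _ - _ = (s - s0) ^+ 2 * (s + 2 * s0) / (2 * s0 ^+ 3 * s)); last first.
  by rewrite hE xE; field; rewrite !gt_eqF.
have ss : (s - s0) ^+ 2 <= del t ^+ 2 / s0 ^+ 2.
  rewrite ler_pdivlMr ?exprn_gt0//.
  rewrite (@le_trans _ _ (h t ^+ 2))//.
    rewrite hE exprMn ler_wpM2l ?sqr_ge0// lerXn2r ?nnegrE ?addr_ge0 ?ltW//.
    by rewrite ltrDr.
  by rewrite -(real_normK (num_real (h t))) lerXn2r ?nnegrE.
have s2 : 0 <= (s - s0) ^+ 2 by rewrite sqr_ge0.
rewrite ger0_norm; last first.
  by do ![done | exact: ltW | exact: sqr_ge0 | apply: addr_ge0 | apply: mulr_ge0 | apply: exprn_ge0 | rewrite invr_ge0].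
apply: (@le_trans _ _ ((s0 * 2 + 2 * s0) / (2 * s0 ^+ 3 * (s0 / 2) * s0 ^+ 2) * del t ^+ 2)); last first.
  by rewrite ler_wpM2r ?sqr_ge0// /C lerDl.
rewrite [leRHS](_ : _ = del t ^+ 2 / s0 ^+ 2 * (s0 * 2 + 2 * s0) / (2 * s0 ^+ 3 * (s0 / 2))); last first.
  by field; rewrite gt_eqF.
have D0 : 0 < 2 * s0 ^+ 3 * (s0 / 2) by rewrite mulr_gt0 ?divr_gt0// mulr_gt0// exprn_gt0.
apply: ler_pM.
- by do ![done | exact: ltW | exact: sqr_ge0 | apply: addr_ge0 | apply: mulr_ge0 | apply: exprn_ge0 | rewrite invr_ge0].
- by do ![done | exact: ltW | exact: sqr_ge0 | apply: addr_ge0 | apply: mulr_ge0 | apply: exprn_ge0 | rewrite invr_ge0].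
- by apply: ler_pM => //; [do ![done | exact: ltW | exact: sqr_ge0 | apply: addr_ge0 | apply: mulr_ge0 | apply: exprn_ge0 | rewrite invr_ge0]|rewrite lerD2r].
- rewrite lef_pV2 ?posrE//; last by rewrite mulr_gt0// mulr_gt0// exprn_gt0.
  by rewrite ler_pM2l// mulr_gt0// exprn_gt0.
Qed.

End Expansion.

Section CorExpansion.
Variables (R : realType) (d : nat).

Definition mx_norm1 (D : 'M[R]_d) := \sum_j \sum_k `|D j k|.

Lemma mx_norm1_ge0 D : 0 <= mx_norm1 D.
Proof. by apply: sumr_ge0 => j _; exact: sumr_ge0. Qed.

Lemma le_mx_norm1 (D : 'M[R]_d) j k : `|D j k| <= mx_norm1 D.
Proof.
rewrite /mx_norm1 (bigD1 j)//= (bigD1 k)//= -addrA lerDl addr_ge0// sumr_ge0//.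
by move=> i _; exact: sumr_ge0.
Qed.

Lemma mx_norm1_le (D : 'M[R]_d) e : (forall j k, `|D j k| <= e) -> mx_norm1 D <= d%:R * (d%:R * e).
Proof.
move=> De; rewrite mulr_natl -[X in _ *+ X]card_ord -sumr_const ler_sum// => j _.
by rewrite mulr_natl -[X in _ *+ X]card_ord -sumr_const ler_sum.
Qed.

Lemma norm1_vech_le D : norm1 (vech D) <= (pdim d)%:R * mx_norm1 D.
Proof.
rewrite mulr_natl -[X in _ *+ X]card_ord -sumr_const ler_sum// => l _.
have [x0] := inhabited_pair l.
by rewrite (vech_entry D x0); exact: le_mx_norm1.
Qed.

Lemma norm1_mulmx_le m n (M : 'M[R]_(m, n)) (u : 'cV[R]_n) :
  norm1 (M *m u) <= (\sum_i \sum_j `|M i j|) * norm1 u.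
Proof.
rewrite mulr_suml ler_sum// => i _; rewrite mxE (le_trans (ler_norm_sum _ _ _))//.
by rewrite mulr_suml ler_sum// => j _; rewrite normrM ler_wpM2l// coord_le_norm1.
Qed.

Lemma cor_mxE (W : 'M[R]_d) j k :
  cor_mx W j k = (Num.sqrt (W j j))^-1 * W j k * (Num.sqrt (W k k))^-1.
Proof. by rewrite /cor_mx /diag_invsqrt mul_diag_mx mul_mx_diag !mxE. Qed.

Variable V : 'M[R]_d.
Hypothesis V_gt0 : forall j, 0 < V j j.

(** Stands in for the minimum of 1 and all [V j j / 2], below which it lies. *)
Definition cor_radius := (1 + \sum_j 2 / V j j)^-1.

Lemma cor_radius_gt0 : 0 < cor_radius.
Proof. by rewrite invr_gt0 ltr_wpDr// sumr_ge0// => j _; rewrite divr_ge0// ltW. Qed.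

Lemma cor_radius_le1 : cor_radius <= 1.
Proof. by rewrite invf_le1 ?lerDl ?ltr_wpDr// sumr_ge0// => j _; rewrite divr_ge0// ltW. Qed.

Lemma cor_radius_le j : cor_radius <= V j j / 2.
Proof.
rewrite -[leRHS]invrK invf_div lef_pV2 ?posrE ?divr_gt0//; last first.
  by rewrite -invr_gt0 cor_radius_gt0.
rewrite (bigD1 j)//= addrCA lerDl addr_ge0// sumr_ge0// => i _.
by rewrite divr_ge0// ltW.
Qed.

Lemma cor_mx_expands j k :
  expands (fun D => mx_norm1 D <= cor_radius) mx_norm1
    (fun D => cor_mx (V + D) j k) (cor_mx V j k)
    (fun D => (Num.sqrt (V j j * V k k))^-1 * D j k -
      2^-1 * (cor_mx V j k * (D j j / V j j + D k k / V k k))).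
Proof.
have iv i := @expands_invsqrt R 'M[R]_d (fun D => mx_norm1 D <= cor_radius)
  mx_norm1 mx_norm1_ge0 (fun D => D i i) (V i i) (V_gt0 i) (fun D _ => le_mx_norm1 D i i)
  (fun D DV => le_trans DV (cor_radius_le i)).
have id := @expands_id R 'M[R]_d (fun D => mx_norm1 D <= cor_radius)
  mx_norm1 (fun D => D j k) (V j k) (fun D _ => le_mx_norm1 D j k).
have le1 D : mx_norm1 D <= cor_radius -> mx_norm1 D <= 1.
  by move=> /le_trans; apply; exact: cor_radius_le1.
have := expandsM mx_norm1_ge0 le1 (expandsM mx_norm1_ge0 le1 (iv j) id) (iv k).
apply: expands_ext => [D _||D _]; rewrite ?cor_mxE ?mxE//.
rewrite sqrtrM ?ltW//; field.
by rewrite !gt_eqF ?sqrtr_gt0.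
Qed.

(** The block of variances is linear in [D] and expands without error; each correlation contributes
    its own quadratic error, and the constants are added. *)
Lemma var_cor_expansion : exists2 C, 0 <= C & forall D, mx_norm1 D <= cor_radius ->
  norm1 (col_mx (dg (V + D)) (vechu (cor_mx (V + D))) -
    col_mx (dg V) (vechu (cor_mx V)) -
    col_mx (Amx R d) (Mmx V (vechu (cor_mx V))) *m vech D) <= C * mx_norm1 D ^+ 2.
Proof.
have := fun j k => cor_mx_expands j k.
move=> H; have {}H jk : {C | 0 <= C & forall D, mx_norm1 D <= cor_radius ->
   `|cor_mx (V + D) jk.1 jk.2 - cor_mx V jk.1 jk.2 -
     ((Num.sqrt (V jk.1 jk.1 * V jk.2 jk.2))^-1 * D jk.1 jk.2 -
      2^-1 * (cor_mx V jk.1 jk.2 * (D jk.1 jk.1 / V jk.1 jk.1 + D jk.2 jk.2 / V jk.2 jk.2)))|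
    <= C * mx_norm1 D ^+ 2}.
  apply: cid2; have [C C0 HC] := H jk.1 jk.2; exists C => // D DV.
  by have [] := HC D DV.
(* The value 0 is taken only for an empty list of pairs, when there is no index [l]. *)
pose C l := if strict_upper_pairs d is x0 :: _ then
   s2val (H (nth x0 (strict_upper_pairs d) l)) else 0.
exists (\sum_(l < pudim d) C l) => [|D DV].
  apply: sumr_ge0 => l _; rewrite /C; case: (strict_upper_pairs d) => // a s.
  exact: (s2valP (H _)).
have subE q (A B : 'cV[R]_q) i : (A - B) i 0 = A i 0 - B i 0 by rewrite !mxE.
rewrite /norm1 big_split_ord/= big1 ?add0r => [|i _]; last first.
  rewrite !subE mul_col_mx !col_mxEu Amx_vech !mxE.
  by rewrite addrAC addrC !addrA addNr add0r subrr normr0.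
rewrite mulr_suml ler_sum// => l _.
have : (0 < size (strict_upper_pairs d))%N.
  by rewrite size_strict_upper_pairs (leq_ltn_trans _ (ltn_ord l)).
rewrite /C; case E : (strict_upper_pairs d) => [//|x0 s] _; rewrite -E.
rewrite !subE mul_col_mx !col_mxEd (Mmx_vech _ D x0)// !(vechu_entry _ x0).
exact: (s2valP' (H _)).
Qed.

End CorExpansion.

(** * Linearization of the empirical variances and correlations *)

Section SampleCovariance.
Variables (R : realType) (d : nat).
Implicit Types (B : 'M[R]_d) (e : nat -> 'cV[R]_d).

Lemma vech_is_linear : linear (@vech R d).
Proof.
move=> a B B'; apply/colP => l.
have [x0] := inhabited_pair l.
by rewrite (vech_entry _ x0) 2!mxE mxE [in RHS]mxE !(vech_entry _ x0).
Qed.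
HB.instance Definition _ :=
  GRing.isLinear.Build R 'M[R]_d 'cV[R]_(pdim d) _ (@vech R d) vech_is_linear.

Lemma sample_covE n mu e j k : (0 < n)%N ->
  sample_cov n (fun i => mu + e i) j k =
  (n%:R - 1)^-1 * (\sum_(i < n) e i j 0 * e i k 0 -
    n%:R^-1 * (\sum_(i < n) e i j 0) * \sum_(i < n) e i k 0).
Proof.
move=> n0; have nn0 : n%:R != 0 :> R by rewrite pnatr_eq0 -lt0n.
rewrite mxE summxE; congr *%R.
pose s l := \sum_(i < n) e i l 0.
have ctr i l : (mu + e i - sample_mean n (fun i => mu + e i)) l 0 = e i l 0 - n%:R^-1 * s l.
  have smE : sample_mean n (fun i => mu + e i) l 0 = n%:R^-1 * \sum_(i < n) (mu l 0 + e i l 0).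
    by rewrite mxE summxE; congr *%R; apply: eq_bigr => q _; rewrite mxE.
  have -> : forall A B : 'cV[R]_d, (mu + A - B) l 0 = mu l 0 + A l 0 - B l 0.
    by move=> A B; rewrite !mxE.
  rewrite smE.
  rewrite big_split/= sumr_const card_ord -[mu l 0 *+ n]mulr_natl.
  by rewrite /s; field.
rewrite (eq_bigr (fun i : 'I_n => e i j 0 * e i k 0 - n%:R^-1 * s k * e i j 0 -
    n%:R^-1 * s j * e i k 0 + n%:R^-1 * s j * (n%:R^-1 * s k))); last first.
  by move=> i _; rewrite mxE big_ord1 ctr mxE ctr; ring.
rewrite !big_split/= !sumrN -!mulr_sumr sumr_const card_ord -mulr_natl -/(s j) -/(s k).
by field.
Qed.

Variable V : 'M[R]_d.
Hypothesis V_gt0 : forall j, 0 < V j j.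

(** If the centred sums are of order $\sqrt n$, then [D], the empirical covariance minus [V], is of
    order $n^{-1/2}$ and the quadratic error of the expansion is $O(1/n)$. Replacing [D] by the mean
    of [e e^T - V] costs another $O(1/n)$, from the centring at the sample mean and from the factor
    $n - 1$. *)
Lemma var_cor_stat_linearization K : 0 <= K -> exists2 C, 0 <= C & exists n0,
  forall n C0 mu e, (n0 <= n)%N ->
  (forall j, `|\sum_(i < n) e i j 0| <= K * Num.sqrt n%:R) ->
  (forall j k, `|\sum_(i < n) (e i j 0 * e i k 0 - V j k)| <= K * Num.sqrt n%:R) ->
  norm1 (var_cor_stat n C0 (fun i => mu + e i) - col_mx (dg V) (vechu (cor_mx V)) -
    n%:R^-1 *: \sum_(i < n) (col_mx (Amx R d) (Mmx V (vechu (cor_mx V))) *m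
      (vech (e i *m (e i)^T) - vech V))) <= C / n%:R.
Proof.
move=> K0; have [C1 C10 HC1] := var_cor_expansion V_gt0.
set J := col_mx (Amx _ _) _ in HC1 *.
pose CJ := \sum_i \sum_j `|J i j|.
have CJ0 : 0 <= CJ by apply: sumr_ge0 => i _; exact: sumr_ge0.
(* The three summands bound the normalized sum of products, the entry of [V] left over by $n - 1$,
   and the product of the two sample sums; the 2 comes from $(n-1)^{-1}\le 2/n$. *)
pose c2 := 2 * (K + mx_norm1 V + K ^+ 2).
have c20 : 0 <= c2 by rewrite mulr_ge0// !addr_ge0 ?mx_norm1_ge0 ?exprn_ge0.
pose C2 := d%:R * (d%:R * (c2 + K)).
have C20 : 0 <= C2 by do ![exact: ler0n | exact: c20 | exact: K0 | apply: mulr_ge0 | apply: addr_ge0].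
pose C3 := d%:R * (d%:R * c2).
have C30 : 0 <= C3 by do ![exact: ler0n | exact: c20 | apply: mulr_ge0].
exists (C1 * C2 ^+ 2 + CJ * ((pdim d)%:R * C3)).
  by do ![done | exact: sqr_ge0 | exact: ler0n | apply: addr_ge0 | apply: mulr_ge0].
(* The first bound gives $(n-1)^{-1}\le 2/n$, the second forces [mx_norm1 D], which is at most
   $C_2/\sqrt n$, below [cor_radius V]. *)
exists (maxn 2 (Num.bound ((C2 / cor_radius V) ^+ 2))) => n C0 mu e.
rewrite geq_max => /andP[n2 nb] es eV.
have n2R : 2 <= n%:R :> R by rewrite ler_nat.
have n0 : 0 < n%:R :> R by rewrite ltr0n (leq_trans _ n2).
pose rho := (Num.sqrt n%:R)^-1 : R.
have rho0 : 0 < rho by rewrite invr_gt0 sqrtr_gt0.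
have rhoE : n%:R^-1 = rho ^+ 2 by rewrite exprVn sqr_sqrtr// ltW.
have rhoE' : Num.sqrt n%:R = rho^-1 :> R by rewrite invrK.
have rho1 : rho <= 1.
  rewrite invf_le1 ?sqrtr_gt0// -[X in X <= _]sqrtr1 ler_wsqrtr//.
  by rewrite (ler_nat R 1) (leq_trans _ n2).
have n1 : (n%:R - 1)^-1 <= 2 * rho ^+ 2.
  have {}n2 : 2 <= n%:R :> R by rewrite ler_nat.
  rewrite -rhoE -[2]invrK -invfM lef_pV2 ?posrE; lra.
pose x i := mu + e i.
pose D := sample_cov n x - V.
pose L := \sum_(i < n) (e i *m (e i)^T - V).
have LE j k : L j k = \sum_(i < n) (e i j 0 * e i k 0 - V j k).
  by rewrite summxE; apply: eq_bigr => i _; rewrite !mxE big_ord1 mxE.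
have DL j k : `|(D - n%:R^-1 *: L) j k| <= c2 * rho ^+ 2.
  have -> : (D - n%:R^-1 *: L) j k = (n%:R - 1)^-1 * (rho ^+ 2 * L j k + V j k -
      rho * (\sum_(i < n) e i j 0) * (rho * (\sum_(i < n) e i k 0))).
    have dE : (D - n%:R^-1 *: L) j k = sample_cov n x j k - V j k - n%:R^-1 * L j k.
      by rewrite /D; case: (sample_cov n x) => ?; rewrite !mxE.
    rewrite dE sample_covE ?(leq_trans _ n2)// LE sumrB sumr_const card_ord -[V j k *+ n]mulr_natl.
    rewrite [rho * _ * _](_ : _ = n%:R^-1 * (\sum_(i < n) e i j 0) * \sum_(i < n) e i k 0); last first.
      by rewrite rhoE; ring.
    rewrite -rhoE; field; rewrite gt_eqF//= subr_eq0 (eqr_nat R n 1).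
    by case: (n) n2 => [|[]].
  have r1 : `|rho ^+ 2 * L j k| <= K.
    rewrite normrM ger0_norm ?sqr_ge0// LE (le_trans (ler_wpM2l (sqr_ge0 _) (eV j k)))//.
    rewrite rhoE' [leLHS](_ : _ = K * rho); first by rewrite ler_piMr.
    by field; rewrite gt_eqF.
  have r2 l : `|rho * \sum_(i < n) e i l 0| <= K.
    rewrite normrM (gtr0_norm rho0) (le_trans (ler_wpM2l (ltW rho0) (es l)))//.
    by rewrite rhoE' mulrCA divff ?mulr1// gt_eqF.
  have r3 := le_mx_norm1 V j k.
  have n1_ge0 : 0 <= (n%:R - 1)^-1 :> R by rewrite invr_ge0; lra.
  rewrite normrM (ger0_norm n1_ge0).
  rewrite [leRHS](_ : _ = 2 * rho ^+ 2 * (K + mx_norm1 V + K * K)); last by rewrite /c2; ring.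
  apply: ler_pM => //.
  rewrite (le_trans (ler_normB _ _))// lerD//.
    by rewrite (le_trans (ler_normD _ _))// lerD.
  by rewrite normrM ler_pM.
have Lle j k : `|(n%:R^-1 *: L) j k| <= K * rho.
  rewrite mxE LE normrM rhoE (ger0_norm (sqr_ge0 rho)).
  rewrite (le_trans (ler_wpM2l (sqr_ge0 _) (eV j k)))// rhoE'.
  by rewrite [leLHS](_ : _ = K * rho)//; field; rewrite gt_eqF.
have DL1 : mx_norm1 (D - n%:R^-1 *: L) <= C3 * rho ^+ 2.
  by rewrite /C3 -!(mulrA d%:R); exact: (mx_norm1_le DL).
have D1 : mx_norm1 D <= C2 * rho.
  rewrite /C2 -!(mulrA d%:R); apply: mx_norm1_le => j k.
  have -> : D j k = (D - n%:R^-1 *: L) j k + (n%:R^-1 *: L) j k by rewrite [RHS]addrC -[D in LHS](subrK (n%:R^-1 *: L)) mxE addrC.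
  rewrite (le_trans (ler_normD _ _))// mulrDl lerD// (le_trans (DL j k))// ler_wpM2l//.
  by rewrite exprS ler_piMr// ?expr1// ltW.
have DV : mx_norm1 D <= cor_radius V.
  have r0 := cor_radius_gt0 V_gt0.
  rewrite (le_trans D1)// /rho ler_pdivrMr ?sqrtr_gt0// -ler_pdivrMl//.
  have CV : 0 <= C2 / cor_radius V by rewrite divr_ge0// ltW.
  rewrite mulrC -(@ler_pXn2r _ 2) ?nnegrE ?sqrtr_ge0// (sqr_sqrtr (ltW n0)).
  by rewrite (le_trans (ltW (archi_boundP _)))// ?sqr_ge0// ler_nat.
have -> : \sum_(i < n) (J *m (vech (e i *m (e i)^T) - vech V)) = J *m vech L.
  rewrite -mulmx_sumr; congr (_ *m _).
  by rewrite /L raddf_sum; apply: eq_bigr => i _; rewrite raddfB.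
have -> : var_cor_stat n C0 x = col_mx (dg (V + D)) (vechu (cor_mx (V + D))).
  have -> : V + D = sample_cov n x by rewrite addrC subrK.
  (* An empirical variance equal to 0 would differ from [V j j] by more than the radius allows, so
     that the default [C0] is not selected. *)
  rewrite /var_cor_stat /sample_cor; case: ifPn => // /forallPn[j]; rewrite negbK => /eqP Dj.
  have := le_trans (le_mx_norm1 D j j) (le_trans DV (cor_radius_le V_gt0 j)).
  have subE (A : 'M[R]_d) : (A - V) j j = A j j - V j j by rewrite !mxE.
  rewrite subE Dj add0r.
  rewrite normrN (gtr0_norm (V_gt0 j)) leNgt => /negP; case.
  by have Vj := V_gt0 j; lra.
set a := col_mx (dg (V + D)) _; set b := col_mx (dg V) _.
have -> : a - b - n%:R^-1 *: (J *m vech L) =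
    (a - b - J *m vech D) + J *m vech (D - n%:R^-1 *: L).
  have -> : vech (D - n%:R^-1 *: L) = vech D - n%:R^-1 *: vech L by rewrite linearB linearZ.
  by rewrite mulmxBr -scalemxAr addrA subrK.
rewrite (le_trans (norm1D _ _))// [X in _ <= _ * X]rhoE mulrDl lerD//.
  rewrite (le_trans (HC1 D DV))// -mulrA -exprMn ler_wpM2l// lerXn2r ?nnegrE ?mx_norm1_ge0//.
  by rewrite mulr_ge0// ltW.
rewrite (le_trans (norm1_mulmx_le _ _))// -(mulrA CJ) ler_wpM2l//.
by rewrite -(mulrA (pdim d)%:R) (le_trans (norm1_vech_le _))// ler_wpM2l.
Qed.
End SampleCovariance.

(** * Moments *)

Section IdenticallyDistributed.
Context dsp d1 (Om : measurableType dsp) (E : measurableType d1) (R : realType).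
Variables (P : probability Om R) (X Y : Om -> E).
Hypotheses (mX : measurable_fun [set: Om] X) (mY : measurable_fun [set: Om] Y).
Hypothesis XY : identically_distributed P X Y.

Let ge0_integral_id (f : E -> \bar R) : measurable_fun [set: E] f -> (forall x, 0 <= f x)%E ->
  (\int[P]_w f (X w) = \int[P]_w f (Y w))%E.
Proof.
move=> mf f0.
have -> : (\int[P]_w f (X w) = \int[distribution P (mfun_Sub (mem_set mX))]_x f x)%E.
  by rewrite ge0_integral_distribution.
have -> : (\int[P]_w f (Y w) = \int[distribution P (mfun_Sub (mem_set mY))]_x f x)%E.
  by rewrite ge0_integral_distribution.
by apply: eq_measure_integral => A mA _; exact: XY.
Qed.

Lemma integral_identically_distributed (f : E -> \bar R) : measurable_fun [set: E] f ->
  (\int[P]_w f (X w) = \int[P]_w f (Y w))%E.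
Proof.
move=> mf; rewrite integralE [in RHS]integralE; congr (_ - _)%E.
  transitivity (\int[P]_w (f^\+)%E (X w))%E; first by apply: eq_integral => w _; rewrite !funeposE.
  rewrite (ge0_integral_id (f := f^\+%E)) => //; last exact: measurable_funepos.
  by apply: eq_integral => w _; rewrite !funeposE.
transitivity (\int[P]_w (f^\-)%E (X w))%E; first by apply: eq_integral => w _; rewrite !funenegE.
rewrite (ge0_integral_id (f := f^\-%E)) => //; last exact: measurable_funeneg.
by apply: eq_integral => w _; rewrite !funenegE.
Qed.

Lemma Rintegral_identically_distributed (f : E -> R) : measurable_fun [set: E] f ->
  \int[P]_w f (X w) = \int[P]_w f (Y w).
Proof.
move=> mf; congr fine; apply: (integral_identically_distributed (f := EFin \o f)).
exact/measurable_EFinP.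
Qed.

Lemma integrable_identically_distributed (f : E -> R) : measurable_fun [set: E] f ->
  integrableR P (fun w => f (Y w)) -> integrableR P (fun w => f (X w)).
Proof.
move=> mf /integrableP[_ fY]; apply/integrableP; split.
  by apply/measurable_EFinP; exact: measurableT_comp.
rewrite (le_lt_trans _ fY)//.
rewrite (integral_identically_distributed (f := fun x => `|(f x)%:E|%E))//.
by apply: measurableT_comp => //; exact/measurable_EFinP.
Qed.

End IdenticallyDistributed.

Section Moments.
Context dsp (Om : measurableType dsp) (R : realType) (P : probability Om R).

Lemma integrableRM (f g : Om -> R) :
  measurable_fun [set: Om] f -> measurable_fun [set: Om] g ->
  integrableR P (fun w => f w ^+ 2) -> integrableR P (fun w => g w ^+ 2) ->
  integrableR P (fun w => f w * g w).
Proof.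
move=> mf mg f2 g2; apply: integrableR_le (integrableRD f2 g2).
  exact: measurable_funM.
move=> w; have := sqr_ge0 (`|f w| - `|g w|); rewrite normrM sqrrB.
rewrite !(real_normK (num_real _)).
have := sqr_ge0 (f w); have := sqr_ge0 (g w); lra.
Qed.

Lemma integrableR_sqr (f : Om -> R) : measurable_fun [set: Om] f ->
  integrableR P (fun w => f w ^+ 2) -> integrableR P f.
Proof.
move=> mf f2; rewrite (_ : f = (fun w => f w * cst 1 w)); last by apply/funext => w; rewrite mulr1.
apply: integrableRM => //.
by rewrite [X in integrableR _ X](_ : _ = cst (1 ^+ 2))//; exact: integrableR_cst.
Qed.

Lemma integrableR_lincomb_sqr I (s : seq I) (c : I -> R) (F : I -> Om -> R) :
  (forall i, measurable_fun [set: Om] (F i)) ->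
  (forall i, integrableR P (fun w => F i w ^+ 2)) ->
  integrableR P (fun w => (\sum_(i <- s) c i * F i w) ^+ 2).
Proof.
move=> mF F2.
under eq_fun do rewrite expr2 mulr_suml.
apply: integrableR_sum => i; under eq_fun do rewrite mulr_sumr.
apply: integrableR_sum => j.
under eq_fun do rewrite mulrACA.
by apply: integrableRZ; exact: integrableRM.
Qed.

Section SecondMoments.
Variables (p : nat) (Y : Om -> 'cV[R]_p).
Hypothesis mY : forall j, measurable_fun [set: Om] (fun w => Y w j 0).
Hypothesis Y2 : forall j, integrableR P (fun w => Y w j 0 ^+ 2).

Definition second_moment : 'M[R]_p := \matrix_(j, k) \int[P]_w (Y w j 0 * Y w k 0).

(** The form at [t] is the integral of the square of the linear form [t^T Y]. *)
Lemma second_moment_gram : exists bs, second_moment = gram bs.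
Proof.
apply: psd_gram => [|t].
  by apply/matrixP => j k; rewrite !mxE; apply: eq_Rintegral => w _; rewrite mulrC.
have YY j k := integrableRM (mY j) (mY k) (Y2 j) (Y2 k).
have -> : (t^T *m second_moment *m t) 0 0 =
    \int[P]_w (\sum_k \sum_j (t j 0 * t k 0) * (Y w j 0 * Y w k 0)).
  rewrite Rintegral_sum => [|j]; last by apply: integrableR_sum => k; exact: integrableRZ.
  rewrite mxE; apply: eq_bigr => k _; rewrite mxE mulr_suml.
  rewrite Rintegral_sum => [|j]; last exact: integrableRZ.
  apply: eq_bigr => j _; rewrite !mxE RintegralZl//; last exact: YY.
  by rewrite mulrAC.
apply: Rintegral_ge0 => w _.
rewrite [leRHS](_ : _ = (\sum_j t j 0 * Y w j 0) ^+ 2) ?sqr_ge0//.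
rewrite expr2 mulr_suml; apply: eq_bigr => k _; rewrite mulr_sumr; apply: eq_bigr => j _.
by ring.
Qed.

End SecondMoments.

Lemma second_moment_mulmx p q (J : 'M[R]_(q, p)) (Y : Om -> 'cV[R]_p) :
  (forall j, measurable_fun [set: Om] (fun w => Y w j 0)) ->
  (forall j, integrableR P (fun w => Y w j 0 ^+ 2)) ->
  second_moment (fun w => J *m Y w) = J *m second_moment Y *m J^T.
Proof.
move=> mY Y2; have YY j k := integrableRM (mY j) (mY k) (Y2 j) (Y2 k).
apply/matrixP => i i'; rewrite mxE [RHS]mxE.
transitivity (\int[P]_w (\sum_k \sum_j (J i j * J i' k) * (Y w j 0 * Y w k 0))).
  apply: eq_Rintegral => w _; rewrite !mxE mulr_suml exchange_big.
  apply: eq_bigr => j _; rewrite mulr_sumr; apply: eq_bigr => k _.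
  by rewrite mulrACA.
rewrite Rintegral_sum => [|j]; last by apply: integrableR_sum => k; exact: integrableRZ.
apply: eq_bigr => k _; rewrite mxE mulr_suml Rintegral_sum => [|j]; last exact: integrableRZ.
apply: eq_bigr => j _; rewrite RintegralZl//; last exact: YY.
by rewrite !mxE mulrAC.
Qed.

End Moments.

(** * Asymptotically negligible perturbations *)

Section Perturbation.
Context dsp (Om : measurableType dsp) (R : realType) (P : probability Om R).
Variables (p : nat) (T L : nat -> Om -> mxborel R p 1) (Q : nat -> Om -> R) (v : R).
Hypotheses (mT : forall m, measurable_fun [set: Om] (T m))
  (mL : forall m, measurable_fun [set: Om] (L m)).
Hypotheses (Q_int : forall m, integrableR P (Q m)) (Q_ge0 : forall m w, 0 <= Q m w)
  (Q_le : forall m, \int[P]_w Q m w <= v).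
Hypothesis TL : forall K, 0 < K -> exists2 r : nat -> R, r m @[m --> \oo] --> (0 : R) &
  \forall m \near \oo, forall w, Q m w < K ->
    norm1 ((T m w : 'cV[R]_p) - L m w) <= r m.

(* Outside the event [Q m w < K] the difference is at most [2 * C <= 2 * C * Q m w / K],
   so that Markov's inequality is not needed. *)
Lemma cvg_perturbation C (g : 'cV[R]_p -> R) (l : R) : bounded_lipschitz C g ->
  \int[P]_w g (L m w) @[m --> \oo] --> l -> \int[P]_w g (T m w) @[m --> \oo] --> l.
Proof.
move=> gL gl; have C0 : 0 <= C by rewrite (le_trans _ (gL.1 0)).
have v0 : 0 <= v by rewrite (le_trans _ (Q_le 0))// Rintegral_ge0// => w _; exact: Q_ge0.
have gi (Y : Om -> mxborel R p 1) : measurable_fun setT Y -> integrableR P (fun w => g (Y w)).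
  move=> mY; apply: (@integrable_bounded _ _ _ _ _ C) => [|w]; last exact: gL.1.
  exact: measurable_bounded_lipschitz gL mY.
have dl : (\int[P]_w g (T m w) - \int[P]_w g (L m w)) @[m --> \oo] --> (0 : R).
  apply/cvgrPdist_lt => e e0.
  (* Chosen so that [2 * C / K * v] is at most [e / 2]; the added 1 keeps [K] positive. *)
  pose K := (4 * C * v + 1) / e.
  have Cv : 0 <= C * v by exact: mulr_ge0.
  have K0 : 0 < K by rewrite divr_gt0// ltr_wpDl// -mulrA mulr_ge0.
  have [r r0 rP] := TL K0.
  have : \forall m \near \oo, `|0 - C * r m| < e / 2.
    have : C * r m @[m --> \oo] --> C * 0 by apply: cvgM => //; exact: cvg_cst.
    rewrite mulr0 => /cvgrPdist_lt; apply.
    by rewrite divr_gt0.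
  move: rP; apply: filterS2 => m rP; rewrite sub0r normrN => rm.
  rewrite sub0r normrN -RintegralB//; [|exact: gi|exact: gi].
  have gTL := integrableRB (gi _ (mT m)) (gi _ (mL m)).
  have CK : 0 <= 2 * C / K by apply: divr_ge0; [exact: mulr_ge0|exact: ltW].
  have bnd w : `|g (T m w) - g (L m w)| <= `|C * r m| * 1 + 2 * C / K * Q m w.
    have QK : 0 <= 2 * C / K * Q m w by exact: mulr_ge0.
    have [/rP h|h] := ltP (Q m w) K.
      rewrite mulr1 (le_trans (gL.2 _ _))// ler_wpDr//.
      by rewrite (le_trans _ (ler_norm _))// ler_wpM2l.
    rewrite mulr1 ler_wpDl// (le_trans (ler_normB _ _))//.
    rewrite (le_trans (lerD (gL.1 _) (gL.1 _)))//.
    rewrite -mulrA (_ : C + C = 2 * C * 1); last by ring.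
    by rewrite ler_wpM2l ?mulr_ge0// ler_pdivlMl// mulr1.
  rewrite (le_lt_trans (le_normr_Rintegral _ _))//.
  have iB' : integrableR P (fun w => `|C * r m| * 1 + 2 * C / K * Q m w).
    by apply: integrableRD; apply: integrableRZ => //; exact: integrableR_cst.
  rewrite (@le_lt_trans _ _ (\int[P]_w (`|C * r m| * 1 + 2 * C / K * Q m w)))//.
    by apply: le_Rintegral => //; exact: integrableR_norm.
  rewrite RintegralD//; [|exact: integrableRZ (integrableR_cst _ _)|exact: integrableRZ].
  rewrite mulr1 Rintegral_prob_cst RintegralZl//.
  rewrite [ltRHS]splitr ltr_leD//.
  rewrite (@le_trans _ _ (2 * C / K * v))//.
    by rewrite ler_wpM2l.
  have A0 : 0 < 4 * C * v + 1 by rewrite ltr_wpDl// -mulrA mulr_ge0.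
  have -> : 2 * C / K * v = e / 2 * (4 * C * v / (4 * C * v + 1)).
    by rewrite /K; field; rewrite !gt_eqF.
  have A1 : 4 * C * v / (4 * C * v + 1) <= 1 by rewrite ler_pdivrMr// mul1r lerDl.
  by rewrite ler_piMr// divr_ge0// ltW.
  exact: Q_int.
have := cvgD dl gl; rewrite add0r => /(_ _); apply: cvg_trans; apply: near_eq_cvg.
by apply: nearW => m; rewrite /GRing.add /= subrK.
Qed.

End Perturbation.

(** * Second moments of sums of i.i.d. variables *)

Section IidSums.
Context dsp d1 (Om : measurableType dsp) (E : measurableType d1) (R : realType).
Variables (P : probability Om R) (X : 'I_2 -> nat -> Om -> E).
Hypothesis mX : forall i k, measurable_fun [set: Om] (X i k).
Hypothesis X_indep : mutually_independent P (fun ik : 'I_2 * nat => X ik.1 ik.2).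
Hypothesis X_id : forall i k, identically_distributed P (X i k) (X i 0%N).

Lemma iid_sum_sqr i (f : E -> R) n : measurable_fun [set: E] f ->
  integrableR P (fun w => f (X i 0 w) ^+ 2) -> \int[P]_w f (X i 0 w) = 0 ->
  integrableR P (fun w => (\sum_(k < n) f (X i k w)) ^+ 2) /\
  \int[P]_w ((\sum_(k < n) f (X i k w)) ^+ 2) = n%:R * \int[P]_w (f (X i 0 w) ^+ 2).
Proof.
move=> mf f2 f0.
have mf2 : measurable_fun [set: E] (fun x => f x ^+ 2) by exact: measurable_funX.
have mfX k : measurable_fun [set: Om] (fun w => f (X i k w)) by exact: measurableT_comp.
have f2k k : integrableR P (fun w => f (X i k w) ^+ 2).
  exact: (integrable_identically_distributed (mX i k) (mX i 0) (X_id i k) mf2 f2).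
split.
  have := integrableR_lincomb_sqr (index_enum 'I_n) (fun=> 1)
    (F := fun k : 'I_n => fun w => f (X i k w)) (fun k => mfX k) (fun k => f2k k).
  by under eq_fun do under eq_bigr do rewrite mul1r.
pose s := [seq (i, k) | k <- iota 0 n].
have us : uniq s by rewrite map_inj_uniq ?iota_uniq// => ? ? [].
have sE w : \sum_(k < n) f (X i k w) = \sum_(ik <- s) f (X ik.1 ik.2 w).
  by rewrite big_map (_ : iota 0 n = index_iota 0 n) ?big_mkord// /index_iota subn0.
have := sum_independent_sqr (fun ik => mX ik.1 ik.2) X_indep
  (f := fun=> f) (v := fun=> \int[P]_w (f (X i 0 w) ^+ 2)) us (fun=> mf).
have H ik : ik \in s -> ik.1 = i by move=> /mapP[k _ ->].
move=> /(_ _ _ _ _) S.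
rewrite /Rintegral; under eq_integral do rewrite sE.
rewrite S /=.
- by rewrite /s big_map big_const_seq count_predT size_iota -Monoid.iteropE /= ?mulr_natl.
- by move=> ik /H ->; exact: integrableR_sqr.
- by move=> ik /H ->.
- by move=> ik /H ->; rewrite -f0; exact: (Rintegral_identically_distributed (mX i _) (mX i 0) (X_id i _) mf).
- by move=> ik /H ->; exact: (Rintegral_identically_distributed (mX i _) (mX i 0) (X_id i _) mf2).
Qed.
End IidSums.

(** * Measurability of the statistic *)

Section Measurability.
Context dsp (Om : measurableType dsp) (R : realType).

(** At nonpositive arguments the square root is 0 and so is its inverse, which agrees with the
    second branch of a case distinction on the sign; the first branch is a real power. *)
Lemma measurable_invsqrt (f : Om -> R) : measurable_fun [set: Om] f ->
  measurable_fun [set: Om] (fun w => (Num.sqrt (f w))^-1).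
Proof.
move=> mf; rewrite (_ : (fun _ => _) = fun w => if 0 < f w then f w `^ (- 2^-1) else 0).
  apply: measurable_fun_ifT => //; first exact: measurable_fun_ltr.
  exact: (measurableT_comp (measurable_powR _) mf).
apply/funext => w; case: ltP => [f0|f0].
  by rewrite powRN powR12_sqrt// ltW.
by rewrite ler0_sqrtr// invr0.
Qed.

Variables (d n : nat) (mu : 'cV[R]_d) (e : nat -> Om -> 'cV[R]_d).
Hypothesis me : forall k, measurable_fun [set: Om] (e k : Om -> mxborel R d 1).

Lemma measurable_sample_cov j k :
  measurable_fun [set: Om] (fun w => sample_cov n (fun i => mu + e i w) j k).
Proof.
case: (posnP n) => [->|n0].
  under eq_fun do rewrite /sample_cov big_ord0 scaler0 mxE.
  exact: measurable_cst.
under eq_fun do rewrite (sample_covE _ _ _ _ n0).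
have mc i l : measurable_fun [set: Om] (fun w => e i w l 0) by exact: measurable_coord (me i).
apply: measurable_funM => //; apply: measurable_funB.
  by apply: measurable_sum => i; exact: measurable_funM.
apply: measurable_funM; last by apply: measurable_sum.
by apply: measurable_funM => //; exact: measurable_sum.
Qed.

Lemma measurable_var_cor_stat (C0 : Om -> 'M[R]_d) :
  measurable_fun [set: Om] (C0 : Om -> mxborel R d d) ->
  measurable_fun [set: Om]
    ((fun w => var_cor_stat n (C0 w) (fun i => mu + e i w)) : Om -> mxborel R (d + pudim d) 1).
Proof.
move=> mC; apply: measurable_mxborelP => i j; rewrite ord1.
case: (split_ordP i) => l ->.
  under eq_fun do rewrite col_mxEu mxE.
  exact: measurable_sample_cov.
have [x0] := inhabited_pairu l.
under eq_fun do rewrite col_mxEd (vechu_entry _ x0) /sample_cor.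
set a := (nth _ _ _).1; set b := (nth _ _ _).2.
(* All diagonal entries are nonzero exactly when their product is; this makes the condition one on a
   single measurable real function. *)
rewrite (_ : (fun _ => _) = fun w => if \prod_j sample_cov n (fun i => mu + e i w) j j != 0
  then (Num.sqrt (sample_cov n (fun i => mu + e i w) a a))^-1 *
    sample_cov n (fun i => mu + e i w) a b *
    (Num.sqrt (sample_cov n (fun i => mu + e i w) b b))^-1 else C0 w a b); last first.
  apply/funext => w; rewrite -cor_mxE.
  rewrite (_ : [forall j, _] = (\prod_j sample_cov n (fun i => mu + e i w) j j != 0)); first by case: ifP.
  by apply/forallP/prodf_neq0 => H k; [move=> _|]; exact: H.
have ms := measurable_sample_cov.
apply: measurable_fun_ifT; last exact: measurable_coord.
  apply: (measurableT_comp (f := negb)) => //.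
  by apply: measurable_fun_eqr => //; exact: measurable_prod.
apply: measurable_funM; last exact: measurable_invsqrt.
by apply: measurable_funM => //; exact: measurable_invsqrt.
Qed.

End Measurability.

(** * Moments of products of residuals *)

Section CovarianceMatrix.
Context dsp (Om : measurableType dsp) (R : realType) (P : probability Om R).

Lemma cov_mxE p (W : Om -> 'cV[R]_p) j k : cov_mx P W j k =
  \int[P]_w ((W w j 0 - \int[P]_v (W v j 0)) * (W w k 0 - \int[P]_v (W v k 0))).
Proof. by rewrite mxE covariance.unlock !expectation.unlock. Qed.

Variables (d : nat) (Y : Om -> 'cV[R]_d).
Hypothesis mY : measurable_fun [set: Om] (Y : Om -> mxborel R d 1).
Hypothesis Y_mean : forall j, ('E_P[fun w => Y w j 0%R] = 0)%E.
Hypothesis Y_mom4 : ('E_P[fun w => (enorm (Y w) ^+ 4)%R] < +oo)%E.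

Let mYj j : measurable_fun [set: Om] (fun w => Y w j 0).
Proof. exact: (measurable_coord _ _ mY). Qed.

Let enorm4E w : enorm (Y w) ^+ 4 = (\sum_j Y w j 0 ^+ 2) ^+ 2.
Proof.
by rewrite (exprM _ 2 2) sqr_sqrtr// sumr_ge0// => j _; exact: sqr_ge0.
Qed.

Let enorm4_int : integrableR P (fun w => (\sum_j Y w j 0 ^+ 2) ^+ 2).
Proof.
apply/integrableP; split.
  apply/measurable_EFinP; apply: measurable_funX; apply: measurable_sum => j.
  exact: measurable_funX.
move: Y_mom4; rewrite expectation.unlock; apply: le_lt_trans.
rewrite le_eqVlt; apply/orP; left; apply/eqP; apply: eq_integral => w _.
by rewrite /= ger0_norm ?sqr_ge0// enorm4E.
Qed.

Lemma integrable_prod_sqr j k : integrableR P (fun w => (Y w j 0 * Y w k 0) ^+ 2).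
Proof.
apply: integrableR_le enorm4_int => [|w].
  by apply: measurable_funX; exact: measurable_funM.
have le l : Y w l 0 ^+ 2 <= \sum_j Y w j 0 ^+ 2.
  by rewrite (bigD1 l)//= lerDl sumr_ge0// => i _; exact: sqr_ge0.
rewrite ger0_norm ?sqr_ge0// exprMn [leRHS]expr2.
by apply: ler_pM; rewrite ?sqr_ge0.
Qed.

Lemma integrable_coord_sqr j : integrableR P (fun w => Y w j 0 ^+ 2).
Proof.
under eq_fun do rewrite expr2.
apply: integrableR_sqr (integrable_prod_sqr j j).
exact: measurable_funM.
Qed.

Lemma Rintegral_coord j : \int[P]_w (Y w j 0) = 0.
Proof. by have := Y_mean j; rewrite expectation.unlock /Rintegral => ->. Qed.

Lemma cov_mx_centered j k : cov_mx P Y j k = \int[P]_w (Y w j 0 * Y w k 0).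
Proof. by rewrite cov_mxE !Rintegral_coord; apply: eq_Rintegral => w _; rewrite !subr0. Qed.

(** The centred summand of the linearization; its second moments form the covariance matrix of
    [vech (Y *m Y^T)]. *)
Definition vech_dev (y : 'cV[R]_d) : 'cV[R]_(pdim d) := vech (y *m y^T) - vech (cov_mx P Y).

Lemma vech_dev_entry x0 y (l : 'I_(pdim d)) (jk := nth x0 (upper_pairs d) l) :
  vech_dev y l 0 = y jk.1 0 * y jk.2 0 - cov_mx P Y jk.1 jk.2.
Proof.
have subE q (A B : 'cV[R]_q) i : (A - B) i 0 = A i 0 - B i 0 by rewrite !mxE.
by rewrite subE !(vech_entry _ x0) mxE big_ord1 [y^T _ _]mxE.
Qed.

Lemma product_dev j k : [/\ measurable_fun [set: Om] (fun w => Y w j 0 * Y w k 0 - cov_mx P Y j k),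
  integrableR P (fun w => (Y w j 0 * Y w k 0 - cov_mx P Y j k) ^+ 2) &
  \int[P]_w (Y w j 0 * Y w k 0 - cov_mx P Y j k) = 0].
Proof.
have mjk : measurable_fun [set: Om] (fun w => Y w j 0 * Y w k 0) by exact: measurable_funM.
have ijk := integrableR_sqr mjk (integrable_prod_sqr j k).
split; first exact: measurable_funB.
  apply: integrableR_le (integrableRD (integrableRZ 2 (integrable_prod_sqr j k))
    (integrableR_cst P (2 * cov_mx P Y j k ^+ 2))) => [|w].
    by apply: measurable_funX; exact: measurable_funB.
  rewrite ger0_norm ?sqr_ge0//; set x := Y w j 0 * _; set c := cov_mx _ _ _ _.
  have := sqr_ge0 (x + c); lra.
rewrite RintegralB//; last exact: integrableR_cst.
by rewrite Rintegral_prob_cst cov_mx_centered subrr.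
Qed.

Lemma measurable_vech_dev : measurable_fun [set: mxborel R d 1] (vech_dev : _ -> mxborel R (pdim d) 1).
Proof.
apply: measurable_mxborelP => l j; rewrite ord1; have [x0] := inhabited_pair l.
under eq_fun do rewrite (vech_dev_entry x0).
apply: measurable_funB => //.
by apply: measurable_funM; exact: (measurable_coord (Y := id)).
Qed.

Lemma vech_dev_sqr l : integrableR P (fun w => vech_dev (Y w) l 0 ^+ 2).
Proof.
have [x0] := inhabited_pair l; under eq_fun do rewrite (vech_dev_entry x0).
by have [] := product_dev (nth x0 (upper_pairs d) l).1 (nth x0 (upper_pairs d) l).2.
Qed.

Lemma vech_dev_mean l : \int[P]_w (vech_dev (Y w) l 0) = 0.
Proof.
have [x0] := inhabited_pair l; under eq_Rintegral do rewrite (vech_dev_entry x0).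
by have [] := product_dev (nth x0 (upper_pairs d) l).1 (nth x0 (upper_pairs d) l).2.
Qed.

Lemma cov_mx_vech : cov_mx P (fun w => vech (Y w *m (Y w)^T)) = second_moment P (fun w => vech_dev (Y w)).
Proof.
apply/matrixP => l l'; rewrite cov_mxE mxE; have [x0] := inhabited_pair l.
have mean q : \int[P]_w (vech (Y w *m (Y w)^T) q 0) = vech (cov_mx P Y) q 0.
  under eq_Rintegral do rewrite (vech_entry _ x0) mxE big_ord1 [(Y _)^T _ _]mxE.
  by rewrite (vech_entry _ x0) cov_mx_centered.
have subE q (A B : 'cV[R]_q) i : (A - B) i 0 = A i 0 - B i 0 by rewrite !mxE.
by apply: eq_Rintegral => w _; rewrite !mean /vech_dev !subE.
Qed.

End CovarianceMatrix.

(** * Sample sizes and weights *)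

Section Normalization.
Variables (R : realType) (n : 'I_2 -> nat -> nat) (kappa : 'I_2 -> R).
Hypothesis n_infty : minn (n ord0 m) (n ord_max m) @[m --> \oo] --> \oo.
Hypothesis kappa_gt0 : forall i, 0 < kappa i.
Hypothesis n_ratio : forall i,
  ((n i m)%:R / (n ord0 m + n ord_max m)%:R : R) @[m --> \oo] --> kappa i.

(** The weight of one summand: the factor $\sqrt N$ of the statistic over the size $n_i$ of the
    sample. *)
Definition clt_scale i m : R := Num.sqrt (n ord0 m + n ord_max m)%:R / (n i m)%:R.

Lemma ord_2_cases (i : 'I_2) : i = ord0 \/ i = ord_max.
Proof. by case: i => [[|[]]// h]; [left|right]; exact: val_inj. Qed.

Lemma sample_size_infty i : n i m @[m --> \oo] --> \oo.
Proof.
apply/cvgnyPge => A; move/cvgnyPge : n_infty => /(_ A); apply: filterS => m.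
by rewrite leq_min => /andP[]; case: (ord_2_cases i) => ->.
Qed.

Lemma clt_scale_sqr i m :
  (n i m)%:R * clt_scale i m ^+ 2 = ((n i m)%:R / (n ord0 m + n ord_max m)%:R)^-1.
Proof.
rewrite /clt_scale expr_div_n sqr_sqrtr// invf_div.
have [->|n0] := eqVneq ((n i m)%:R : R) 0; first by rewrite mul0r invr0 mulr0.
by rewrite mulrC expr2 invfM mulrA divfK.
Qed.

Lemma clt_scale_sqr_cvg i : (n i m)%:R * clt_scale i m ^+ 2 @[m --> \oo] --> (kappa i)^-1.
Proof.
under eq_fun do rewrite clt_scale_sqr.
by apply: cvgV; rewrite ?gt_eqF.
Qed.

(** Its square is the convergent sequence [n * clt_scale ^+ 2] times [1 / n]. *)
Lemma clt_scale_cvg0 i : clt_scale i m @[m --> \oo] --> 0.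
Proof.
have nV : (n i m)%:R^-1 @[m --> \oo] --> (0 : R).
  apply/gtr0_cvgV0.
    move/cvgnyPge : (sample_size_infty i) => /(_ 1%N); apply: filterS => m.
    by rewrite ltr0n.
  exact: (cvg_comp _ _ (sample_size_infty i) (@cvgr_idn R)).
have sq : clt_scale i m ^+ 2 @[m --> \oo] --> (0 : R).
  rewrite -[0](mulr0 (kappa i)^-1).
  apply: cvg_trans (cvgM (clt_scale_sqr_cvg (i := i)) nV); apply: near_eq_cvg.
  apply: nearW => m /=.
  have [n0|n0] := eqVneq ((n i m)%:R : R) 0; last by rewrite mulrAC divff// mul1r.
  by rewrite /clt_scale n0 invr0 !mulr0 expr0n.
apply/norm_cvg0P; under eq_fun do rewrite -sqrtr_sqr.
rewrite -sqrtr0; apply: continuous_cvg => //.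
exact: sqrt_continuous.
Qed.

End Normalization.

(** * Control of the centred sums *)

Section Fluctuation.
Variables (R : realType) (d : nat).

(** A single nonnegative variable whose smallness bounds all centred sums at once. The factor
    [n%:R^-1] makes its mean bounded in [n]. *)
Definition fluctuation (V : 'M[R]_d) n (e : nat -> 'cV[R]_d) : R :=
  \sum_j n%:R^-1 * (\sum_(k < n) e k j 0) ^+ 2 +
  \sum_j \sum_l n%:R^-1 * (\sum_(k < n) (e k j 0 * e k l 0 - V j l)) ^+ 2.

Let term_le (n : nat) (s F K : R) : (0 < n)%N -> n%:R^-1 * s ^+ 2 <= F -> F < K ->
  `|s| <= Num.sqrt K * Num.sqrt n%:R.
Proof.
move=> n0 sF FK; have n0R : 0 < n%:R :> R by rewrite ltr0n.
have : n%:R^-1 * s ^+ 2 <= K by rewrite (le_trans sF)// ltW.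
rewrite ler_pdivrMl// => sK.
have K0 : 0 <= K.
  by rewrite (le_trans _ (ltW FK))// (le_trans _ sF)// mulr_ge0 ?invr_ge0 ?sqr_ge0.
by rewrite -sqrtrM// -sqrtr_sqr ler_wsqrtr// mulrC.
Qed.

Lemma fluctuation_ge0 V n e : 0 <= fluctuation V n e.
Proof.
apply: addr_ge0; apply: sumr_ge0 => j _; first by rewrite mulr_ge0 ?invr_ge0 ?sqr_ge0.
by apply: sumr_ge0 => l _; rewrite mulr_ge0 ?invr_ge0 ?sqr_ge0.
Qed.

Lemma fluctuation_bound V n e K : (0 < n)%N -> fluctuation V n e < K ->
  (forall j, `|\sum_(k < n) e k j 0| <= Num.sqrt K * Num.sqrt n%:R) /\
  (forall j l, `|\sum_(k < n) (e k j 0 * e k l 0 - V j l)| <= Num.sqrt K * Num.sqrt n%:R).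
Proof.
move=> n0 FK.
have t0 (x : R) : 0 <= n%:R^-1 * x ^+ 2 by rewrite mulr_ge0 ?invr_ge0 ?sqr_ge0.
have tt0 (F : 'I_d -> 'I_d -> R) j : 0 <= \sum_l n%:R^-1 * (F j l) ^+ 2 by exact: sumr_ge0.
split=> [j|j l]; apply: (term_le n0 _ FK).
  rewrite /fluctuation (bigD1 j)//= -addrA lerDl.
  by apply: addr_ge0; apply: sumr_ge0 => i _ //; exact: sumr_ge0.
rewrite /fluctuation ler_wpDl ?sumr_ge0// (bigD1 j)//= (bigD1 l)//= -addrA lerDl.
by apply: addr_ge0; apply: sumr_ge0 => i _ //; exact: sumr_ge0.
Qed.

End Fluctuation.

Section GramOperations.
Variables (R : realType) (p : nat).
Implicit Types bs : seq 'cV[R]_p.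

Lemma gram_cat bs bs' : gram (bs ++ bs') = gram bs + gram bs'.
Proof. by rewrite /gram big_cat. Qed.

Lemma gram_scale_seq c bs : gram (scale_seq c bs) = c ^+ 2 *: gram bs.
Proof.
rewrite /gram /scale_seq big_map scaler_sumr; apply: eq_bigr => b _.
by rewrite linearZ /= -scalemxAl -scalemxAr scalerA expr2.
Qed.

End GramOperations.

Section IidFluctuation.
Context dsp (Om : measurableType dsp) (R : realType) (P : probability Om R) (d : nat).
Variable eps : 'I_2 -> nat -> Om -> 'cV[R]_d.
Hypothesis eps_meas : forall i k, measurable_fun [set: Om] (eps i k : Om -> mxborel R d 1).
Hypothesis eps_indep : mutually_independent P
  (fun ik : 'I_2 * nat => eps ik.1 ik.2 : Om -> mxborel R d 1).
Hypothesis eps_id : forall i k, identically_distributed P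
  (eps i k : Om -> mxborel R d 1) (eps i 0%N : Om -> mxborel R d 1).
Hypothesis eps_mean : forall i j, ('E_P[fun w => eps i 0%N w j 0%R] = 0)%E.
Hypothesis eps_mom4 : forall i, ('E_P[fun w => (enorm (eps i 0%N w) ^+ 4)%R] < +oo)%E.

(** By additivity of variances, each normalized square has the variance of one summand as its mean,
    whatever the positive sample size. *)
Lemma fluctuation_integral i : exists2 v, 0 <= v & forall n,
  integrableR P (fun w => fluctuation (cov_mx P (eps i 0)) n (fun k => eps i k w)) /\
  \int[P]_w fluctuation (cov_mx P (eps i 0)) n (fun k => eps i k w) <= v.
Proof.
pose V := cov_mx P (eps i 0).
have mY j : measurable_fun [set: mxborel R d 1] (fun y : mxborel R d 1 => y j 0).
  exact: (measurable_coord (Y := id)).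
have mYY j l : measurable_fun [set: mxborel R d 1]
    (fun y : mxborel R d 1 => y j 0 * y l 0 - V j l).
  by apply: measurable_funB => //; exact: measurable_funM.
have H1 j n := iid_sum_sqr eps_meas eps_indep eps_id (i := i) n (mY j)
  (integrable_coord_sqr (eps_meas i 0) (eps_mom4 i) j) (Rintegral_coord (eps_mean i) j).
have H2 j l n : integrableR P (fun w => (\sum_(k < n) (eps i k w j 0 * eps i k w l 0 - V j l)) ^+ 2) /\
    \int[P]_w ((\sum_(k < n) (eps i k w j 0 * eps i k w l 0 - V j l)) ^+ 2) =
    n%:R * \int[P]_w ((eps i 0 w j 0 * eps i 0 w l 0 - V j l) ^+ 2).
  have [_ p2 p0] := product_dev (eps_meas i 0) (eps_mean i) (eps_mom4 i) j l.
  exact: (iid_sum_sqr eps_meas eps_indep eps_id n (mYY j l) p2 p0).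
(* An inequality instead of an equality, because for [n = 0] the left-hand side is 0. *)
have nle n (x : R) : 0 <= x -> n%:R^-1 * (n%:R * x) <= x.
  by case: n => [|n] x0; [rewrite mul0r mulr0|rewrite mulKf// pnatr_eq0].
exists (\sum_j \int[P]_w (eps i 0 w j 0 ^+ 2) +
  \sum_j \sum_l \int[P]_w ((eps i 0 w j 0 * eps i 0 w l 0 - V j l) ^+ 2)).
  apply: addr_ge0; apply: sumr_ge0 => j _; first by apply: Rintegral_ge0 => w _; exact: sqr_ge0.
  by apply: sumr_ge0 => l _; apply: Rintegral_ge0 => w _; exact: sqr_ge0.
move=> n.
have i1 j := integrableRZ n%:R^-1 (H1 j n).1.
have i2 j l := integrableRZ n%:R^-1 (H2 j l n).1.
have is1 : integrableR P (fun w => \sum_j n%:R^-1 * (\sum_(k < n) eps i k w j 0) ^+ 2).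
  exact: (integrableR_sum _ i1).
have is2' j : integrableR P (fun w => \sum_l n%:R^-1 *
    (\sum_(k < n) (eps i k w j 0 * eps i k w l 0 - V j l)) ^+ 2).
  exact: (integrableR_sum _ (i2 j)).
have is2 : integrableR P (fun w => \sum_j \sum_l n%:R^-1 *
    (\sum_(k < n) (eps i k w j 0 * eps i k w l 0 - V j l)) ^+ 2).
  exact: (integrableR_sum _ is2').
split; first exact: integrableRD.
rewrite /fluctuation RintegralD//; apply: lerD.
  rewrite (Rintegral_sum _ i1) ler_sum// => j _.
  rewrite RintegralZl//; last exact: (H1 j n).1.
  rewrite (H1 j n).2 nle// Rintegral_ge0// => w _; exact: sqr_ge0.
rewrite (Rintegral_sum _ is2') ler_sum// => j _.
rewrite (Rintegral_sum _ (i2 j)) ler_sum// => l _.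
rewrite RintegralZl//; last exact: (H2 j l n).1.
rewrite (H2 j l n).2 nle// Rintegral_ge0// => w _; exact: sqr_ge0.
Qed.

End IidFluctuation.

(** * Asymptotic normality of the difference of variances and correlations *)

Theorem mainTheorem5 (R : realType) (dsp : measure_display)
  (Om : measurableType dsp) (P : probability Om R)
  (d : nat) (d_ge2 : (2 <= d)%N)
  (mu : 'I_2 -> 'cV[R]_d) (eps : 'I_2 -> nat -> Om -> 'cV[R]_d)
  (eps_meas : forall i k,
     measurable_fun [set: Om] (eps i k : Om -> mxborel R d 1))
  (eps_indep : mutually_independent P
     (fun (ik : 'I_2 * nat) => eps ik.1 ik.2 : Om -> mxborel R d 1))
  (eps_id : forall i k, identically_distributed P
     (eps i k : Om -> mxborel R d 1) (eps i 0%N : Om -> mxborel R d 1))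
  (eps_mean : forall i j, ('E_P[fun w => eps i 0%N w j 0%R] = 0)%E)
  (eps_mom4 : forall i, ('E_P[fun w => (enorm (eps i 0%N w) ^+ 4)%R] < +oo)%E)
  (V : 'I_2 -> 'M[R]_d) (V_def : forall i, V i = cov_mx P (eps i 0%N))
  (V_diag_gt0 : forall i j, 0 < V i j j)
  (n : 'I_2 -> nat -> nat) (kappa : 'I_2 -> R)
  (n_infty : minn (n ord0 m) (n ord_max m) @[m --> \oo] --> \oo)
  (kappa_itv : forall i, 0 < kappa i <= 1)
  (n_ratio : forall i,
     ((n i m)%:R / (n ord0 m + n ord_max m)%:R : R) @[m --> \oo] --> kappa i)
  (C0 : 'I_2 -> nat -> Om -> 'M[R]_d)
  (C0_meas : forall i m,
     measurable_fun [set: Om] (C0 i m : Om -> mxborel R d d))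
  (H0 : V ord0 = V ord_max) :
  let X i k w := mu i + eps i k w in
  let r i := vechu (cor_mx (V i)) in
  let Sigma i :=
    cov_mx P (fun w => vech (eps i 0%N w *m (eps i 0%N w)^T)) in
  let stat i m w := var_cor_stat (n i m) (C0 i m w) (fun k => X i k w) in
  let T m w := Num.sqrt (n ord0 m + n ord_max m)%:R *:
    (stat ord0 m w - stat ord_max m w) in
  let J i := col_mx (Amx R d) (Mmx (V i) (r i)) in
  let Gamma := \sum_(i < 2) (kappa i)^-1 *: (J i *m Sigma i *m (J i)^T) in
  exists nu : probability (mxborel R (d + pudim d) 1) R,
    is_mvnormal nu 0 Gamma /\ cvg_in_distribution P T nu.
Proof.
move=> X r Sigma stat T J Gamma.
have kappa_gt0 i : 0 < kappa i by have /andP[] := kappa_itv i.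
pose phi i (y : mxborel R d 1) : mxborel R (d + pudim d) 1 := J i *m vech_dev P (eps i 0) y.
have mphi i : measurable_fun [set: mxborel R d 1] (phi i).
  apply: measurable_mxborelP => l j; rewrite ord1; under eq_fun do rewrite mxE.
  apply: measurable_sum => q; apply: measurable_funM => //.
  exact: (measurable_coord _ _ (measurable_vech_dev _ _)).
have mdev i q : measurable_fun [set: Om] (fun w => vech_dev P (eps i 0) (eps i 0 w) q 0).
  apply: (measurable_coord (Y := fun w => vech_dev P (eps i 0) (eps i 0 w) : mxborel R _ 1)).
  exact: (measurableT_comp (measurable_vech_dev _ _) (eps_meas i 0)).
have dev2 i q := vech_dev_sqr (eps_meas i 0) (eps_mean i) (eps_mom4 i) q.
have Y2 i j : integrableR P (fun w => phi i (eps i 0 w) j 0 ^+ 2).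
  under eq_fun do rewrite mxE.
  exact: (integrableR_lincomb_sqr (index_enum _) (fun q => J i j q) (mdev i) (dev2 i)).
have Y0 i j : \int[P]_w (phi i (eps i 0 w) j 0) = 0.
  under eq_Rintegral do rewrite mxE.
  have dev1 q := integrableR_sqr (mdev i q) (dev2 i q).
  rewrite Rintegral_sum => [|q]; last exact: integrableRZ.
  rewrite big1// => q _; rewrite RintegralZl//; last exact: dev1.
  by rewrite (vech_dev_mean (eps_meas i 0) (eps_mean i) (eps_mom4 i)) mulr0.
have mY i j : measurable_fun [set: Om] (fun w => phi i (eps i 0 w) j 0).
  apply: (measurable_coord (Y := fun w => phi i (eps i 0 w))).
  exact: (measurableT_comp (mphi i) (eps_meas i 0)).
have /choice[bs bsE] : forall i, exists b, second_moment P (fun w => phi i (eps i 0 w)) = gram b.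
  by move=> i; exact: (second_moment_gram (mY i) (Y2 i)).
have YG i j k : \int[P]_w (phi i (eps i 0 w) j 0 * phi i (eps i 0 w) k 0) = gram (bs i) j k.
  by rewrite -bsE mxE.
have bsG i : gram (bs i) = J i *m Sigma i *m (J i)^T.
  rewrite -bsE (second_moment_mulmx _ (mdev i) (dev2 i)) /Sigma.
  by rewrite (cov_mx_vech (eps_mean i)).
pose s i : R := Num.sqrt (kappa i)^-1.
have s2 i : s i ^+ 2 = (kappa i)^-1 by rewrite sqr_sqrtr// invr_ge0 ltW.
(* The sign makes the difference of the two samples a sum; it disappears in the squares, so that
   both covariances are added. *)
pose a i m : R := (if i == ord0 then 1 else -1) * clt_scale R n i m.
have a0 i : a i m @[m --> \oo] --> (0 : R).
  rewrite -[0](mulr0 (if i == ord0 then 1 else -1)).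
  by apply: cvgM; [exact: cvg_cst|exact: (clt_scale_cvg0 n_infty kappa_gt0 n_ratio)].
have na i : (n i m)%:R * a i m ^+ 2 @[m --> \oo] --> s i ^+ 2.
  rewrite s2; under eq_fun => m.
    rewrite exprMn (_ : (if i == ord0 then 1 else -1) ^+ 2 = 1) ?mul1r; last first.
      by case: ifP; rewrite ?sqrrN expr1n.
    over.
  exact: (clt_scale_sqr_cvg kappa_gt0 n_ratio).
(* Concatenating lists adds their Gram matrices, and scaling by [s i] multiplies them by
   [(kappa i)^-1]. *)
pose nu := gaussian (scale_seq (s ord0) (bs ord0) ++ scale_seq (s ord_max) (bs ord_max)).
exists nu; split.
  have -> : Gamma = gram (scale_seq (s ord0) (bs ord0) ++ scale_seq (s ord_max) (bs ord_max)).
    by rewrite gram_cat !gram_scale_seq /Gamma big_ord2 !s2 !bsG.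
  exact: gaussian_mvnormal.
have mstat i m : measurable_fun [set: Om] (stat i m : Om -> mxborel R (d + pudim d) 1).
  exact: (@measurable_var_cor_stat _ _ _ d (n i m) (mu i) (eps i) (eps_meas i) (C0 i m) (C0_meas i m)).
have mT m : measurable_fun [set: Om] (T m : Om -> mxborel R (d + pudim d) 1).
  have scaleBE (c : R) (A B : 'cV[R]_(d + pudim d)) l j : (c *: (A - B)) l j = c * (A l j - B l j).
    by rewrite !mxE.
  apply: measurable_mxborelP => l j; under eq_fun do rewrite scaleBE.
  apply: measurable_funM => //; apply: measurable_funB.
  - exact: (measurable_coord _ _ (mstat ord0 m)).
  - exact: (measurable_coord _ _ (mstat ord_max m)).
apply: cvg_in_distribution_taylor2 => // C g gT.
have L_cvg := two_sample_clt_taylor2 eps_meas eps_indep eps_id mphi Y2 Y0 YG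
  (fun i => sqrtr_ge0 _) a0 na gT.
pose L m w : mxborel R (d + pudim d) 1 :=
  two_sample_sum (eps : 'I_2 -> nat -> Om -> mxborel R d 1) phi n a m w.
have mL m : measurable_fun [set: Om] (L m).
  apply: measurable_mxborelP => l j; rewrite ord1 /L /two_sample_sum.
  under eq_fun do rewrite summxE.
  apply: measurable_sum => i; under eq_fun do rewrite mxE summxE.
  apply: measurable_funM => //; apply: measurable_sum => k.
  apply: (measurable_coord (Y := fun w => phi i (eps i k w))).
  exact: (measurableT_comp (mphi i) (eps_meas i k)).
have /choice[v vP] : forall i, exists v, 0 <= v /\ forall n,
  integrableR P (fun w => fluctuation (V i) n (fun k => eps i k w)) /\
  \int[P]_w fluctuation (V i) n (fun k => eps i k w) <= v.
  move=> i; have [v v0 vP] := fluctuation_integral eps_meas eps_indep eps_id eps_mean eps_mom4 i.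
  by exists v; rewrite V_def.
(* Its mean is at most the sum of the [v i] for every [m]; where it is below [K], both
   linearizations hold. *)
pose Q m w := \sum_i fluctuation (V i) (n i m) (fun k => eps i k w).
have Qi m i : integrableR P (fun w => fluctuation (V i) (n i m) (fun k => eps i k w)).
  exact: ((vP i).2 (n i m)).1.
apply: (@cvg_perturbation _ _ _ _ _ T L Q (\sum_i v i) mT mL _ _ _ _ _ _ _
  (taylor2_bounded_lipschitz gT)) L_cvg.
- by move=> m; exact: (integrableR_sum _ (Qi m)).
- by move=> m w; apply: sumr_ge0 => i _; exact: fluctuation_ge0.
- move=> m; rewrite (Rintegral_sum _ (Qi m)) ler_sum// => i _.
  exact: ((vP i).2 (n i m)).2.
move=> K K0.
(* [Q m w < K] bounds the centred sums by [Num.sqrt K * Num.sqrt n], hence the square root of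
   [K]. *)
have lin i := var_cor_stat_linearization (V_diag_gt0 i) (sqrtr_ge0 K).
have /choice[D DP] : forall i, exists D, 0 <= D /\ \forall m \near \oo, forall w, Q m w < K ->
    norm1 (stat i m w - col_mx (dg (V i)) (vechu (cor_mx (V i))) -
      (n i m)%:R^-1 *: \sum_(k < n i m) (phi i (eps i k w) : 'cV_(d + pudim d))) <= D / (n i m)%:R.
  move=> i; have [D D0 [n0 Dn0]] := lin i; exists D; split => //.
  have n0_le : \forall m \near \oo, (n0 <= n i m)%N.
    by have /cvgnyPge/(_ n0) := sample_size_infty n_infty i.
  have n_gt0 : \forall m \near \oo, (0 < n i m)%N.
    by have /cvgnyPge/(_ 1%N) := sample_size_infty n_infty i.
  move: n0_le n_gt0; apply: filterS2 => m nm nm0 w QK.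
  have FK : fluctuation (V i) (n i m) (fun k => eps i k w) < K.
    rewrite (le_lt_trans _ QK)// /Q (bigD1 i)//= lerDl sumr_ge0// => l _.
    exact: fluctuation_ge0.
  have [e1 e2] := fluctuation_bound nm0 FK.
  have := Dn0 (n i m) (C0 i m w) (mu i) (fun k => eps i k w) nm e1 e2.
  by rewrite /phi /vech_dev -V_def.
(* The error [D i / n] of each linearization is multiplied by $\sqrt N$, which gives
   [D i * clt_scale] and tends to 0. *)
exists (fun m => \sum_i D i * clt_scale R n i m).
  have Dc i : D i * clt_scale R n i m @[m --> \oo] --> D i * 0.
    by apply: cvgM; [exact: cvg_cst|exact: (clt_scale_cvg0 n_infty kappa_gt0 n_ratio)].
  have := @cvg_sum_seq _ _ (index_enum 'I_2) _ _ Dc.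
  by rewrite big1// => i _; rewrite mulr0.
have := (DP ord_max).2; have := (DP ord0).2; apply: filterS2 => m D0 D1 w QK.
(* The centre of the first sample is subtracted from both statistics and cancels in their
   difference; by [H0] it is the centre of the second sample as well. *)
pose c := col_mx (dg (V ord0)) (vechu (cor_mx (V ord0))).
pose S i : 'cV_(d + pudim d) := \sum_(k < n i m) (phi i (eps i k w) : 'cV_(d + pudim d)).
pose u : R := Num.sqrt (n ord0 m + n ord_max m)%:R.
have -> : T m w - L m w = u *: ((stat ord0 m w - c - (n ord0 m)%:R^-1 *: S ord0) +
    (-1) *: (stat ord_max m w - c - (n ord_max m)%:R^-1 *: S ord_max)).
  rewrite /T /L /two_sample_sum big_ord2 /a /= mul1r mulN1r /clt_scale -/u -!/(S _).
  move: (stat _ _ _) (stat _ _ _) (S _) (S _) => s0 s1 S0 S1.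
  apply/colP => l; rewrite !mxE; ring.
rewrite norm1Z ger0_norm ?sqrtr_ge0// big_ord2 /clt_scale -/u.
rewrite mulrCA (mulrCA (D ord_max)) -mulrDr ler_wpM2l ?sqrtr_ge0//.
rewrite (le_trans (norm1D _ _))// norm1Z normrN1 mul1r lerD//; first exact: D0.
by rewrite /c H0; exact: D1.
Qed.
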